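(* Let $n$ be a prime and let $(S,\omega)\in\mathcal{H}(2)$ be an $n$-square-tiled surface. Then $(S,\omega)$ has a one-cylinder direction, i.e. a direction in which $S$ decomposes into one single cylinder.
   Context: A translation surface $(S,\omega)$ is a compact connected Riemann surface $S$ with a nonzero holomorphic $1$-form $\omega$. $\mathcal{H}(2)$ is the moduli space of translation surfaces of genus $2$ whose $1$-form has a single (double) zero. An $n$-square-tiled surface is a translation surface $(S,\omega)$ admitting a degree $n$ holomorphic map $f\colon S\to\mathbf{R}^2/\mathbf{Z}^2$ with $f^*(\mathrm{d}z)=\omega$, ramified only above the origin and sending the zeros of $\omega$ to the origin. A saddle connection is a straight segment (for the flat metric $|\omega|$) joining zeros of $\omega$ with no zero in its interior. A cylinder in a direction $\theta$ is a maximal open annulus in $S$ foliated by closed regular geodesics in direction $\theta$, isometric to $\mathbf{R}/w\mathbf{Z}\times(0,h)$. The surface decomposes into one single cylinder in direction $\theta$ if $S$ is the union of one such cylinder and of the saddle connections in direction $\theta$ bounding it. *)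

(* Defs.v *)
From HB Require Import structures.
From mathcomp Require Import all_boot all_order all_algebra.
From mathcomp Require Import all_classical all_reals.
From mathcomp Require Import topology normedtype.
From mathcomp Require Import complex.
From mathcomp Require Import zify ring lra.

Set Implicit Arguments.
Unset Strict Implicit.
Unset Printing Implicit Defensive.

Import Order.TTheory GRing.Theory Num.Theory.
Import numFieldNormedType.Exports.

Local Open Scope classical_set_scope.
Local Open Scope quotient_scope.
Local Open Scope ring_scope.

(* [R[i]] packed as a [numFieldType], so that its topology is the canonical one
   of a [numFieldType]; inferring it directly on [R[i]] can make unification
   diverge. *)
Definition cplx (R : realType) : numFieldType := R[i].

Definition rcplx (R : realType) (x : R) : cplx R := real_complex R x.

(* dF/du = l at x, as the limit of (F y - F x) / (u y - u x) when y tends to x.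
   With [u] a local coordinate this is the complex derivative of [F] read in
   that coordinate, i.e. of F \o u^-1 at u x; with [u := id] or [u := @rcplx R]
   it is the derivative of a function of a complex or a real variable. *)
Definition has_deriv_wrt (R : realType) (X : topologicalType)
    (u F : X -> cplx R) (x : X) (l : cplx R) : Prop :=
  (fun y => (F y - F x) / (u y - u x)) @ x^' --> l.

(* Outside [dom], [coord] is a junk value. *)
Record chart (R : realType) (S : topologicalType) := Chart {
  dom : set S ;
  coord : S -> cplx R }.

(* [coord c] restricts to a homeomorphism from an open subset of [S] onto an
   open subset of the complex plane. *)
Definition is_chart (R : realType) (S : topologicalType) (c : chart R S) :
    Prop :=
  [/\ open (dom c),
      forall p, dom c p -> {for p, continuous (coord c)},
      forall p q, dom c p -> dom c q -> coord c p = coord c q -> p = q &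
      forall V : set S, open V -> V `<=` dom c -> open (coord c @` V)].

Record riemannSurface (R : realType) := RiemannSurface {
  rs_carrier :> topologicalType ;
  atlas : set (chart R rs_carrier) ;
  rs_hausdorff : hausdorff_space rs_carrier ;
  atlas_chart : forall c, atlas c -> is_chart c ;
  atlas_cover : forall p, exists2 c, atlas c & dom c p ;
  atlas_compat : forall c d p, atlas c -> atlas d -> dom c p -> dom d p ->
    exists l, has_deriv_wrt (coord c) (coord d) p l }.

Definition chart_at (R : realType) (S : riemannSurface R) (p : S)
    (c : chart R S) : Prop := atlas c /\ dom c p.

Definition holomorphic (R : realType) (S T : riemannSurface R) (f : S -> T) :
    Prop :=
  continuous f /\
  forall p c d, chart_at p c -> chart_at (f p) d ->
    exists l, has_deriv_wrt (coord c) (coord d \o f) p l.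

(* A holomorphic 1-form is given in each chart c, with coordinate z_c, as
   [coef c] dz_c on [dom c]; the values of [coef c] outside [dom c], or for c
   not in the atlas, are junk. *)
Record holoForm (R : realType) (S : riemannSurface R) := HoloForm {
  coef : chart R S -> S -> cplx R ;
  coef_holomorphic : forall p c, chart_at p c ->
    exists l, has_deriv_wrt (coord c) (coef c) p l ;
  coef_compat : forall p c d l, chart_at p c -> chart_at p d ->
    has_deriv_wrt (coord c) (coord d) p l -> coef c p = coef d p * l }.

Definition form_zero (R : realType) (S : riemannSurface R) (omega : holoForm S)
    (p : S) : Prop :=
  exists2 c, chart_at p c & coef omega c p = 0.

Definition form_zero_of_order (R : realType) (S : riemannSurface R)
    (omega : holoForm S) (p : S) (k : nat) : Prop :=
  exists c (h : S -> cplx R),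
    [/\ chart_at p c,
        \forall q \near p, exists l, has_deriv_wrt (coord c) h q l,
        h p != 0 &
        \forall q \near p,
          coef omega c q = (coord c q - coord c p) ^+ k * h q].

(* f^*(eta) = omega *)
Definition is_pullback (R : realType) (S T : riemannSurface R) (f : S -> T)
    (eta : holoForm T) (omega : holoForm S) : Prop :=
  forall p c d, chart_at p c -> chart_at (f p) d ->
    exists2 l, has_deriv_wrt (coord c) (coord d \o f) p l &
               coef omega c p = coef eta d (f p) * l.

(* The genus as the dimension of the complex vector space of holomorphic
   1-forms: [e] is a basis of that space. *)
Definition has_genus (R : realType) (S : riemannSurface R) (g : nat) : Prop :=
  exists e : 'I_g -> holoForm S, forall omega : holoForm S,
    exists! a : 'rV[cplx R]_g, forall p c, chart_at p c ->
      coef omega c p = \sum_(i < g) a ord0 i * coef (e i) c p.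

Definition ramified (R : realType) (S T : riemannSurface R) (f : S -> T)
    (p : S) : Prop :=
  exists c d, [/\ chart_at p c, chart_at (f p) d &
                  has_deriv_wrt (coord c) (coord d \o f) p 0].

(* The degree of a holomorphic map, as the number of preimages of any point
   that is not a branch value. *)
Definition has_degree (R : realType) (S T : riemannSurface R) (f : S -> T)
    (n : nat) : Prop :=
  forall t : T, (forall p, f p = t -> ~ ramified f p) ->
    (f @^-1` [set t] #= `I_n)%card.

Record translationSurface (R : realType) := TranslationSurface {
  ts_surface :> riemannSurface R ;
  ts_compact : compact [set: ts_surface] ;
  ts_connected : connected [set: ts_surface] ;
  ts_form : holoForm ts_surface ;
  ts_form_neq0 : exists p, ~ form_zero ts_form p }.

Definition in_H2 (R : realType) (X : translationSurface R) : Prop :=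
  has_genus X 2 /\
  exists p, form_zero_of_order (ts_form X) p 2 /\
            forall q, form_zero (ts_form X) q -> q = p.

Section Torus.
Variable R : realType.
Local Notation C := (cplx R).

Definition gauss_rel (x y : C) : bool :=
  (complex.Re (x - y) \is a Num.int) && (complex.Im (x - y) \is a Num.int).

Lemma ReB (x y : C) : complex.Re (x - y) = complex.Re x - complex.Re y.
Proof. by case: x => ? ?; case: y. Qed.

Lemma ImB (x y : C) : complex.Im (x - y) = complex.Im x - complex.Im y.
Proof. by case: x => ? ?; case: y. Qed.

Lemma gauss_rel_refl : reflexive gauss_rel.
Proof. by move=> x; rewrite /gauss_rel !(ReB, ImB) !subrr !rpred0. Qed.

Lemma gauss_rel_sym : symmetric gauss_rel.
Proof.
move=> x y; rewrite /gauss_rel !(ReB, ImB).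
by rewrite -rpredN opprB -(rpredN _ (_ - complex.Im y)) opprB.
Qed.

Lemma gauss_rel_trans : transitive gauss_rel.
Proof.
move=> y x z; rewrite /gauss_rel !(ReB, ImB) => /andP[a b] /andP[c d].
rewrite -(subrKA (complex.Re y)) rpredD //=.
by rewrite -(subrKA (complex.Im y)) rpredD.
Qed.

Canonical gauss_equiv :=
  EquivRel gauss_rel gauss_rel_refl gauss_rel_sym gauss_rel_trans.

(* R^2/Z^2, as the quotient of the complex plane by the Gaussian integers *)
Definition torus_space : topologicalType :=
  quotient_topology {eq_quot gauss_equiv}.

Definition torus_proj (z : C) : torus_space :=
  \pi_(quotient_topology {eq_quot gauss_equiv}) z.

(* The coordinates of the torus are the local inverses of the projection. *)
Definition torus_atlas : set (chart R torus_space) :=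
  [set c | is_chart c /\ forall p, dom c p -> torus_proj (coord c p) = p].

Lemma torus_projP (x y : C) : torus_proj x = torus_proj y <-> gauss_rel x y.
Proof. by split => [/eqmodP|h]; last exact/eqmodP. Qed.

Lemma torus_proj_surj (p : torus_space) : exists z, torus_proj z = p.
Proof. exists (repr p); exact: reprK. Qed.

Lemma torus_proj_continuous : continuous torus_proj.
Proof. exact: pi_continuous. Qed.

Lemma torus_proj_open (V : set C) : open V -> open (torus_proj @` V).
Proof.
move=> oV; rewrite /open /= /quotient_open.
have -> : \pi_(quotient_topology {eq_quot gauss_equiv}) @^-1` (torus_proj @` V)
    = \bigcup_(v in [set v : C | gauss_rel v 0])
        ((fun z : C => z + v) @^-1` V).
  apply/seteqP; split => z /=.
    case=> y Vy /torus_projP yz; exists (y - z); last by rewrite /= addrC subrK.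
    by move: yz; rewrite /= /gauss_rel subr0.
  case=> v /= v0 Vzv; exists (z + v) => //; apply/torus_projP.
  by move: v0; rewrite /gauss_rel subr0 addrAC subrr add0r.
apply: bigcup_open => v _; apply: (open_comp _ oV) => z _.
apply: (@continuousD _ _ _ (fun z : C => z) (fun=> v)) => //.
exact: cst_continuous.
Qed.

Lemma Re_lt (w : C) (e : R) : `|w| < rcplx e -> `|complex.Re w| < e.
Proof. by move=> we; rewrite -ltcR; exact: le_lt_trans (normc_ge_Re w) we. Qed.

Lemma Im_lt (w : C) (e : R) : `|w| < rcplx e -> `|complex.Im w| < e.
Proof.
move=> we; rewrite -normrN -ReiNIm -ltcR.
apply: le_lt_trans (normc_ge_Re _) _.
suff -> : `|(w * 'i)%C| = `|w| by [].
by rewrite !normc_def; case: w {we} => a b /=; rewrite !mulr0 !mulr1 sub0r addr0 sqrrN addrC.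
Qed.

Lemma int_small (x : R) : x \is a Num.int -> `|x| < 1 -> x = 0.
Proof.
case/intrP => m ->; rewrite -intr_norm -[1]/(1%:~R) ltr_int => m1.
by move: m1; rewrite -[1]add0r ltzD1 normr_le0 => /eqP ->.
Qed.

Lemma int_dist (x : R) : x \isn't a Num.int ->
  exists2 e : R, 0 < e & forall m, m \is a Num.int -> e <= `|x - m|.
Proof.
move=> xNint; have /andP[lex ltx] := floor_itv x.
set k := Num.floor x in lex ltx.
have kx : k%:~R < x.
  by rewrite lt_neqAle lex andbT; apply: contraNneq xNint => <-; exact: intr_int.
exists (Num.min (x - k%:~R) ((k + 1)%:~R - x)).
  by rewrite lt_min !subr_gt0 kx ltx.
move=> m /intrP[j ->]; case: (leP j k) => jk.
  have jk' : (j%:~R : R) <= k%:~R by rewrite ler_int.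
  by rewrite ge_min; apply/orP; left; rewrite ger0_norm; lra.
have jk' : ((k + 1)%:~R : R) <= j%:~R by rewrite ler_int lezD1.
by rewrite ge_min; apply/orP; right; rewrite distrC ger0_norm; lra.
Qed.

Lemma gauss_small (x y : C) : gauss_rel x y -> `|x - y| < rcplx 1 -> x = y.
Proof.
move=> /andP[rx ix] xy1; apply/eqP; rewrite -subr_eq0; apply/eqP.
have := int_small rx (Re_lt xy1); have := int_small ix (Im_lt xy1).
by case: (x - y) => a b /= -> ->.
Qed.

Lemma gauss_dist (x y : C) : ~~ gauss_rel x y ->
  exists2 e : R, 0 < e & forall v, gauss_rel v 0 -> rcplx e <= `|x - y - v|.
Proof.
have real_ge (e : R) (w : C) : ~ (`|w| < rcplx e) -> rcplx e <= `|w|.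
  move=> /negP; rewrite -real_leNgt ?normr_real//.
  by rewrite /rcplx; apply/Creal_ReP; rewrite -complexRe.
rewrite negb_and => /orP[] /int_dist[e e0 he]; exists e => // v;
  rewrite /gauss_rel subr0 => /andP[rv iv]; apply: real_ge.
  by move/Re_lt; rewrite ReB; apply/negP; rewrite -leNgt he.
by move/Im_lt; rewrite ImB; apply/negP; rewrite -leNgt he.
Qed.

Lemma rcplx_gt0 (e : R) : 0 < e -> 0 < rcplx e.
Proof. by move=> e0; rewrite -[0]/(rcplx 0) ltcR. Qed.

Lemma torus_hausdorff : hausdorff_space torus_space.
Proof.
rewrite open_hausdorff => p q.
have [x <-] := torus_proj_surj p; have [y <-] := torus_proj_surj q.
move=> xy; have /gauss_dist[e e0 he] : ~~ gauss_rel x y.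
  by apply: contra xy => xy; apply/eqP/torus_projP.
have e20 : 0 < rcplx (e / 2) by rewrite rcplx_gt0// divr_gt0.
exists (torus_proj @` ball x (rcplx (e / 2)), torus_proj @` ball y (rcplx (e / 2))).
  split => /=; rewrite inE; [exists x|exists y] => //; exact: ballxx.
split; [exact/torus_proj_open/ball_open|exact/torus_proj_open/ball_open|].
apply/eqP/seteqP; split => // t [[a /= xa <-] [b /= yb /esym/torus_projP ab]].
have := he (a - b); rewrite /gauss_rel subr0 => /(_ ab).
apply/negP; rewrite -real_ltNge ?normr_real ?gtr0_real ?rcplx_gt0//.
move: xa yb; rewrite -!ball_normE /ball_ /= => xa yb.
have -> : x - y - (a - b) = (x - a) - (y - b) by ring.
apply: le_lt_trans (ler_normB _ _) _.
have -> : rcplx e = rcplx (e / 2) + rcplx (e / 2).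
  by rewrite /rcplx -rmorphD/= -splitr.
exact: ltrD.
Qed.

Lemma torus_atlas_cover (p : torus_space) :
  exists2 c, torus_atlas c & dom c p.
Proof.
have [z zp] := torus_proj_surj p.
pose B := ball z (rcplx 2^-1).
have h0 : 0 < rcplx (2^-1 : R) by rewrite rcplx_gt0// invr_gt0.
have Binj x y : B x -> B y -> torus_proj x = torus_proj y -> x = y.
  rewrite /B -!ball_normE /ball_ /= => Bx By /torus_projP xy.
  apply: gauss_small => //.
  have -> : x - y = (z - y) - (z - x) by ring.
  apply: le_lt_trans (ler_normB _ _) _.
  have -> : rcplx (1 : R) = rcplx 2^-1 + rcplx 2^-1.
    by rewrite /rcplx -rmorphD/= -[2^-1]mul1r -splitr.
  exact: ltrD.
pose co q := xget z [set x | B x /\ torus_proj x = q].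
have coP q : (torus_proj @` B) q -> B (co q) /\ torus_proj (co q) = q.
  by case=> x Bx <-; rewrite /co; case: xgetP => [y _ //|/(_ x) []].
have coK x : B x -> co (torus_proj x) = x.
  move=> Bx; have [] := coP (torus_proj x); first by exists x.
  by move=> Bc /Binj; exact.
have oB : open B by exact: ball_open.
have oD : open (torus_proj @` B) by exact: torus_proj_open.
exists (Chart (torus_proj @` B) co); last by exists z => //; exact: ballxx.
split => [|q /coP[]//]; split => //.
- move=> q /coP[Bq qE] A Aq; have : nbhs (co q) A by [].
  rewrite nbhsE => -[W [oW Wq] WA].
  suff : nbhs q (co @^-1` A) by [].
  rewrite nbhsE; exists (torus_proj @` (W `&` B)).
    by split; [apply: torus_proj_open; exact: openI|exists (co q)].
  by move=> _ [x [Wx Bx] <-] /=; rewrite coK//; exact: WA.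
- move=> q r /coP[_ qE] /coP[_ rE] qr.
  by rewrite -qE -rE; congr torus_proj.
- move=> V oV VD; have -> : co @` V = B `&` torus_proj @^-1` V.
    apply/seteqP; split => [_ [q Vq <-]|x [Bx Vx]].
      by have [? qE] := coP q (VD q Vq); split => //=; rewrite qE.
    by exists (torus_proj x) => //; rewrite coK.
  by apply: openI => //; apply: open_comp => // x _; exact: torus_proj_continuous.
Qed.

Lemma dnbhs_torus_proper (p : torus_space) : ProperFilter p^'.
Proof.
split; last exact: dnbhs_filter.
have [z <-] := torus_proj_surj p; rewrite /dnbhs /within /= => /torus_proj_continuous.
move=> /nbhs_ballP[e e0 he].
have e0' : 0 < complex.Re e by move: e0; rewrite /= ltcE => /andP[].
have eE : rcplx (complex.Re e) = e.
  move: e0; rewrite /= ltcE => /andP[/eqP /= i0 _].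
  by case: e i0 {he e0'} => a b /= ->.
pose r : R := Num.min (complex.Re e / 2) (2^-1).
have r0 : 0 < r by rewrite lt_min divr_gt0//= invr_gt0.
have rint : ~~ (r \is a Num.int).
  have r1 : r < 1 by rewrite gt_min; apply/orP; right; lra.
  apply/negP => /int_small; rewrite gtr0_norm// => /(_ r1) r00.
  by rewrite r00 ltxx in r0.
apply: (he (z + rcplx r)).
  rewrite -ball_normE /ball_ /= opprD addNKr normrN -eE normc_def /= expr0n addr0 sqrtr_sqr.
  rewrite gtr0_norm// ltcR gt_min; apply/orP; left; lra.
apply/eqP => /torus_projP/andP[]; rewrite ReB.
have -> : complex.Re (z + rcplx r) = complex.Re z + r by case: (z).
by rewrite addrAC subrr add0r (negbTE rint).
Qed.

Lemma torus_transition (c d : chart R torus_space) (p : torus_space) :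
  torus_atlas c -> torus_atlas d -> dom c p -> dom d p ->
  has_deriv_wrt (coord c) (coord d) p 1.
Proof.
move=> [[oc cc ic _] sc] [[od cd id _] sd] cp dp.
have cB : {for p, continuous (fun q => coord d q - coord c q)}.
  by apply: (@continuousB _ _ _ (coord d) (coord c)); [exact: cd|exact: cc].
have near1 : \forall q \near p, `|coord d p - coord c p - (coord d q - coord c q)| < rcplx 1.
  have /cvgrPdist_lt := cB; apply; exact: rcplx_gt0.
apply: (@cvg_trans _ ((fun=> (1 : C)) @ p^')); last exact: cvg_cst.
apply: near_eq_cvg; near=> q.
have qp : q != p by near: q; exact: nbhs_dnbhs_neq.
have cq : dom c q.
  by near: q; apply: nbhs_dnbhs; apply: open_nbhs_nbhs.
have dq : dom d q.
  by near: q; apply: nbhs_dnbhs; apply: open_nbhs_nbhs.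
have q1 : `|coord d p - coord c p - (coord d q - coord c q)| < rcplx 1.
  by near: q; apply: nbhs_dnbhs.
have e : coord d p - coord c p = coord d q - coord c q.
  apply: gauss_small q1.
  have /torus_projP/andP[a b] : torus_proj (coord d p) = torus_proj (coord c p).
    by rewrite sc// sd.
  have /torus_projP/andP[a' b'] : torus_proj (coord d q) = torus_proj (coord c q).
    by rewrite sc// sd.
  by rewrite /gauss_rel ReB ImB !rpredB.
have -> : coord d q - coord d p = coord c q - coord c p.
  apply/eqP; rewrite subr_eq addrAC -[X in _ == X]addrA e; apply/eqP; ring.
rewrite divff// subr_eq0; apply: contra qp => /eqP /ic qp; apply/eqP; exact: qp.
Unshelve. all: by end_near.
Qed.

Lemma torus_atlas_chart (c : chart R torus_space) : torus_atlas c -> is_chart c.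
Proof. by case. Qed.

Lemma torus_atlas_compat (c d : chart R torus_space) (p : torus_space) :
  torus_atlas c -> torus_atlas d -> dom c p -> dom d p ->
  exists l, has_deriv_wrt (coord c) (coord d) p l.
Proof. by move=> ac ad cp dp; exists 1; exact: torus_transition. Qed.

Definition torus : riemannSurface R :=
  RiemannSurface torus_hausdorff torus_atlas_chart torus_atlas_cover
    torus_atlas_compat.

Definition torus_origin : torus := torus_proj 0.

Lemma torus_dz_holomorphic (p : torus) (c : chart R torus) : chart_at p c ->
  exists l, has_deriv_wrt (coord c) (fun=> 1) p l.
Proof.
move=> _; exists 0; rewrite /has_deriv_wrt subrr.
under eq_fun do rewrite mul0r.
exact: cvg_cst.
Qed.

Lemma torus_dz_compat (p : torus) (c d : chart R torus) (l : C) :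
  chart_at p c -> chart_at p d -> has_deriv_wrt (coord c) (coord d) p l ->
  1 = 1 * l.
Proof.
move=> [ac cp] [ad dp] dl; rewrite mul1r.
have := torus_transition ac ad cp dp.
by have := dnbhs_torus_proper p => P /(cvg_unique _); apply.
Qed.

Definition torus_dz : holoForm torus :=
  @HoloForm R torus (fun _ _ => 1) torus_dz_holomorphic torus_dz_compat.

End Torus.

Definition square_tiled (R : realType) (n : nat) (X : translationSurface R) :
    Prop :=
  exists f : X -> torus R,
    [/\ holomorphic f,
        has_degree f n,
        is_pullback f (torus_dz R) (ts_form X),
        forall p, ramified f p -> f p = torus_origin R &
        forall p, form_zero (ts_form X) p -> f p = torus_origin R].

(* Directions are unit complex numbers u = e^(i theta). *)

(* [A] is the image of the open strip 0 < Im z < h under a map phi which is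
   injective modulo the translation by w and satisfies phi^*(omega) = u dz.
   For the flat metric |omega|, phi thus induces an isometry from
   R/wZ x (0,h) onto A, and the images of the horizontal circles are closed
   geodesics in direction u, which avoid the zeros of omega since u != 0. *)
Definition flat_annulus (R : realType) (X : translationSurface R) (u : cplx R)
    (A : set X) : Prop :=
  exists (w h : R) (phi : cplx R -> X),
    let strip := [set z : cplx R | 0 < complex.Im z < h] in
    [/\ 0 < w /\ 0 < h,
        open A /\ A = phi @` strip,
        forall z z', strip z -> strip z' ->
          (phi z = phi z' <-> exists k : int, z' = z + rcplx (k%:~R * w)),
        forall z, strip z -> {for z, continuous phi} &
        forall z c, strip z -> chart_at (phi z) c ->
          exists2 l, has_deriv_wrt id (coord c \o phi) z l &
                     coef (ts_form X) c (phi z) * l = u].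

Definition cylinder (R : realType) (X : translationSurface R) (u : cplx R)
    (A : set X) : Prop :=
  flat_annulus u A /\ forall B, flat_annulus u B -> A `<=` B -> B = A.

Definition saddle_connection (R : realType) (X : translationSurface R)
    (u : cplx R) (s : set X) : Prop :=
  exists (L : R) (gamma : R -> X),
    [/\ 0 < L,
        {within `[0, L], continuous gamma},
        form_zero (ts_form X) (gamma 0) /\ form_zero (ts_form X) (gamma L),
        forall t, 0 < t < L ->
          ~ form_zero (ts_form X) (gamma t) /\
          forall c, chart_at (gamma t) c ->
            exists2 l, has_deriv_wrt (@rcplx R) (coord c \o gamma) t l &
                       coef (ts_form X) c (gamma t) * l = u &
        s = gamma @` `[0, L]].

Definition one_cylinder_direction (R : realType) (X : translationSurface R)
    (u : cplx R) : Prop :=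
  `|u| = 1 /\
  exists2 A : set X, cylinder u A &
    [set: X] = A `|` \bigcup_(s in [set s | saddle_connection u s /\
                                     s `<=` closure A `\` A]) s.

(* Main.v *)
(* The map to the torus is a covering of degree n, totally ramified of order 3 at
   the zero P0 and unramified elsewhere. A basis (v1, v2) of the lattice gives two
   permutations r, u of a generic fibre, generating a transitive group; their
   commutator, the monodromy around P0, is a 3-cycle. The cycles of r are the
   cylinders in direction v1. If r is not a single cycle, then, n being prime, some
   u r^k has fewer cycles: the heights and circumferences of the cylinders are
   constrained by n, and a Chinese remainder argument chooses k so that an orbit of
   u r^k reaches back into a short initial piece of each row. Since u r^k is the
   first permutation of another basis, descent yields a basis for which r is an
   n-cycle. The strip 0 < y < 1 along v1 then lifts to an annulus, its lower edge
   extends continuously to a closed curve covering the rest of the surface, and the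
   passages of that curve through P0 cut it into saddle connections. A flat annulus
   larger than the strip would contain a whole horizontal line of that curve, hence
   P0, which is impossible. *)
From mathcomp Require Import all_boot fingroup perm.
From mathcomp Require Import boolp zify.

Set Implicit Arguments.
Unset Strict Implicit.
Unset Printing Implicit Defensive.

(** * Permutations whose commutator is a 3-cycle *)

(** A label stands for a unit parallelogram, and [x], [y], [z] are the labels whose upper right
    corner is [P0]. Apart from them [u] carries stretches of [r]-cycles (rows) rigidly upwards. If
    [r] is not a single cycle, exactly two rows contain these labels: one such row would have a
    length dividing n, and three would merge into one longer row with no row splitting to
    compensate. Hence there are a long cylinder of circumference w and a short one of circumference
    a. These are coprime because n is prime, so that the twist can be prescribed in both at once.

    Homotopy of paths is avoided. Lifts are taken only over convex open sets without lattice points,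
    where one value determines a section; the permutations are read off from the ends of lifted
    segments ([transport]). At [P0], where no section exists, the tool is trapping: a connected set
    lying over a small disc cannot leave a disc-shaped neighbourhood of a preimage of the centre.
    Trapping gives the limits of sections at lattice points, the 3-cycle, and the continuity of the
    lower edge of the strip. *)

Section IterPerm.
Variable T : finType.
Implicit Types (s : {perm T}) (p q : T).

Lemma iter_mod (f : T -> T) w i p : iter w f p = p -> iter (i %% w) f p = iter i f p.
Proof.
move=> wp; rewrite {2}(divn_eq i w) addnC iterD; congr iter.
by elim: (i %/ w) => // k IH; rewrite mulSn iterD -IH.
Qed.

Lemma porbit_iterP s p q : reflect (exists i, q = iter i s p) (q \in porbit s p).
Proof.
by apply: (iffP (porbitP s p q)) => -[i ->]; exists i; rewrite permX.
Qed.

Lemma mem_porbit_iter s i p : iter i s p \in porbit s p.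
Proof. by rewrite -permX mem_porbit. Qed.

Lemma eq_porbit s p q : p \in porbit s q -> porbit s p = porbit s q.
Proof. by rewrite -eq_porbit_mem => /eqP. Qed.

Lemma porbit_step s p : porbit s (s p) = porbit s p.
Proof. exact: eq_porbit (mem_porbit_iter s 1 p). Qed.

Lemma porbit_trans s p q t : p \in porbit s q -> q \in porbit s t -> p \in porbit s t.
Proof. by rewrite -!eq_porbit_mem => /eqP -> /eqP ->. Qed.

Lemma porbit_iter_neq s p i j : i < j < #|porbit s p| -> iter i s p != iter j s p.
Proof.
move=> ij; have := uniq_traject_porbit s p.
have -> : iter i s p = nth p (traject s p #|porbit s p|) i by rewrite nth_traject//; lia.
have -> : iter j s p = nth p (traject s p #|porbit s p|) j by rewrite nth_traject//; lia.
by move=> U; rewrite nth_uniq ?size_traject//; lia.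
Qed.

Lemma card_porbit_le s p w : 0 < w -> iter w s p = p -> #|porbit s p| <= w.
Proof.
move=> w0 wp.
have /subset_leq_card h : porbit s p \subset [set iter i s p | i : 'I_w].
  apply/subsetP => _ /porbit_iterP[i ->]; apply/imsetP.
  by exists (Ordinal (ltn_pmod i w0)) => //=; rewrite iter_mod.
by apply: leq_trans h (leq_trans (leq_imset_card _ _) _); rewrite card_ord.
Qed.

Lemma perm_closed_mem s (E : {set T}) : (forall p, p \in E -> s p \in E) ->
  forall p, (s p \in E) = (p \in E).
Proof.
move=> sE p; have /eqP {1}<- : s @: E == E.
  rewrite eqEcard (card_imset _ (@perm_inj _ s)) leqnn andbT.
  by apply/subsetP => _ /imsetP[q qE ->]; exact: sE.
by rewrite mem_imset //; exact: perm_inj.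
Qed.

Lemma dvdn_card_porbits s g : (forall p, g %| #|porbit s p|) -> g %| #|T|.
Proof.
move=> gP; have P : partition (porbits s) [set: T].
  apply/and3P; split.
  - apply/eqP/setP => p; rewrite inE; apply/bigcupP; exists (porbit s p).
      exact: imset_f.
    exact: porbit_id.
  - apply/trivIsetP => _ _ /imsetP[p _ ->] /imsetP[q _ ->] pq.
    apply/pred0P => t /=; apply/negP => /andP[tp tq]; case/negP: pq.
    by rewrite -(eq_porbit tp) (eq_porbit tq).
  - apply/imsetP => -[p _ /setP/(_ p)]; by rewrite inE porbit_id.
rewrite -cardsT (card_partition P); apply: dvdn_sum => _ /imsetP[p _ ->]; exact: gP.
Qed.

Lemma card_porbits_le s m (g : nat -> T) :
  (forall p, exists2 j, j < m & p \in porbit s (g j)) -> #|porbits s| <= m.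
Proof.
move=> h; have /subset_leq_card hs : porbits s \subset [set porbit s (g j) | j : 'I_m].
  apply/subsetP => _ /imsetP[p _ ->]; have [j jm] := h p.
  rewrite -eq_porbit_mem => /eqP ->; apply/imsetP; by exists (Ordinal jm).
by apply: leq_trans hs (leq_trans (leq_imset_card _ _) _); rewrite card_ord.
Qed.

End IterPerm.

(** Modulo w the multiples of h are the multiples of the gcd of h and w, so it is enough to raise t
    to the next multiple of that gcd. In the application h is the height of a cylinder, w its
    circumference and t its twist; the bound [s <= h] is what limits the number of cycles. *)
Lemma bezout_shift (h w t : nat) : 0 < h -> 0 < w ->
  exists s k, [/\ 0 < s, s <= h, s <= w & w %| h * k + t + s].
Proof.
move=> h0 w0; set d := gcdn h w; have d0 : 0 < d by rewrite gcdn_gt0 h0.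
have [a _ wa] := Bezoutr h w0.
have dt : d %| t + (d - t %% d).
  by rewrite /dvdn -modnDml subnKC ?modnn// ltnW// ltn_pmod.
(* [Bezoutr] makes [a * h] congruent to minus the gcd modulo w, which cancels [t + s], a multiple of
   the gcd. The difference [d - t %% d] is positive even when d divides t, as required of s. *)
exists (d - t %% d), (a * ((t + (d - t %% d)) %/ d)).
have ltd := ltn_pmod t d0.
have hd : d <= h by rewrite dvdn_leq// dvdn_gcdl.
have wd : d <= w by rewrite dvdn_leq// dvdn_gcdr.
split; [lia|lia|lia|].
set m := _ %/ d; have md : m * d = t + (d - t %% d) := divnK dt.
rewrite -addnA -md.
have -> : h * (a * m) + m * d = (gcdn h w + a * h) * m by rewrite -/d; lia.
exact: dvdn_mulr.
Qed.

(** * Rows of squares and their lengths *)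

Section Descent.
Variables (T : finType) (r u : {perm T}).
Hypothesis Tpr : prime #|T|.
Hypothesis trans : forall E : {set T}, (forall p, (r p \in E) = (p \in E)) ->
  (forall p, (u p \in E) = (p \in E)) -> E = set0 \/ E = setT.

Section Sing.
Variable S : {set T}.
Hypothesis reg : forall p, p \notin S -> u (r p) = r (u p).

Lemma regular_iter m p : (forall j, j < m -> iter j r p \notin S) ->
  u (iter m r p) = iter m r (u p).
Proof.
elim: m => // m IH h; rewrite !iterS reg ?IH// => [j jm|]; last exact: h.
by apply: h; lia.
Qed.

(** An orbit of [r] is a row of squares. When it avoids [S], the commutation of [u] and [r]
    propagates all along it, and [u] maps it onto one row of the same length. *)
Definition regular_row p := [disjoint porbit r p & S].

Lemma regular_row_iter p m : regular_row p -> u (iter m r p) = iter m r (u p).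
Proof.
move=> /pred0P h; apply: regular_iter => j _.
by have /negbT := h (iter j r p); rewrite /= mem_porbit_iter.
Qed.

Lemma regular_row_porbit p : regular_row p -> porbit r (u p) = u @: porbit r p.
Proof.
move=> h; apply/setP => q; apply/porbit_iterP/imsetP => [[i ->]|[_ /porbit_iterP[i ->] ->]].
  by exists (iter i r p); rewrite ?mem_porbit_iter// regular_row_iter.
by exists i; rewrite regular_row_iter.
Qed.

Lemma regular_row_card p : regular_row p -> #|porbit r (u p)| = #|porbit r p|.
Proof. by move=> h; rewrite regular_row_porbit// card_imset//; exact: perm_inj. Qed.

Lemma regular_rows_iter p h m : (forall j, j < h -> regular_row (iter j u p)) ->
  iter h u (iter m r p) = iter m r (iter h u p).
Proof.
elim: h => // h IH hp; rewrite !iterS IH; last by move=> j jh; apply: hp; lia.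
by rewrite regular_row_iter//; apply: hp.
Qed.

Lemma regular_rows_card p h : (forall j, j < h -> regular_row (iter j u p)) ->
  #|porbit r (iter h u p)| = #|porbit r p|.
Proof.
elim: h => // h IH hp; rewrite iterS regular_row_card; last exact: hp.
by apply: IH => j jh; apply: hp; lia.
Qed.

(** Otherwise the rows of all iterates of p under [u] would form a nonempty set stable under [r] and
    [u], hence everything by transitivity, and one of these regular rows would contain x. *)
Lemma reach_singular p x : x \in S ->
  exists2 m, ~~ regular_row (iter m u p) &
             forall j, j < m -> regular_row (iter j u p).
Proof.
move=> xS; have [hex|hn] := pselect (exists m, ~~ regular_row (iter m u p)).
  exists (ex_minn hex); case: ex_minnP => // m _ mm j jm.
  by apply: contraLR jm => /mm; rewrite -leqNgt.
have {hn} hn m : regular_row (iter m u p).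
  by apply/negPn/negP => hm; apply: hn; exists m.
(* The exponent is bounded by the order of [u] only to make membership boolean. *)
pose E := [set q | [exists m : 'I_#[u]%g, q \in porbit r (iter m u p)]].
have EP q : reflect (exists m, q \in porbit r (iter m u p)) (q \in E).
  rewrite inE; apply: (iffP existsP) => -[m hm]; first by exists m.
  exists (Ordinal (ltn_pmod m (order_gt0 u))) => /=.
  by rewrite iter_mod// -permX expg_order perm1.
have [] : E = set0 \/ E = setT.
- apply: trans; apply: perm_closed_mem => q /EP[m /porbit_iterP[i ->]]; apply/EP.
    by exists m; rewrite -iterS mem_porbit_iter.
  by exists m.+1; rewrite regular_row_iter// mem_porbit_iter.
- move=> E0; have : p \in E by apply/EP; exists 0; exact: porbit_id.
  by rewrite E0 inE.
move=> ET; have /EP[m xm] : x \in E by rewrite ET inE.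
by have /pred0P/(_ x) := hn m; rewrite /= xm xS.
Qed.

(** Going up through regular rows preserves the length until a row meeting [S] is hit, so g divides
    the length of every row, and the rows partition [T]. *)
Lemma row_card_dvd g x : x \in S -> (forall q, q \in S -> g %| #|porbit r q|) ->
  g %| #|T|.
Proof.
move=> xS gS; apply: (dvdn_card_porbits (s := r)) => p.
have [m hm hj] := reach_singular p xS.
rewrite -(regular_rows_card hj).
move: hm; rewrite /regular_row => /pred0Pn[q /andP[/= qm qS]].
by rewrite -(eq_porbit qm) gS.
Qed.

(** A conservation law for lengths of rows. [S1] and its preimage [S2] under [u] have the same size.
    Outside [S0] they coincide because regular rows are translated, and [S2] does not meet [S0]; a
    point of [S0] in [S1] would thus make [S2] strictly smaller. *)
Lemma singular_card_eq e (S0 : {set T}) z :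
  (forall p, p \notin S0 -> regular_row p) ->
  (forall p, p \in S0 -> #|porbit r (u p)| != e) ->
  z \in S0 -> #|porbit r z| <> e.
Proof.
move=> hr hS zS ze.
pose S1 := [set p | #|porbit r p| == e]; pose S2 := [set p | #|porbit r (u p)| == e].
have c12 : #|S2| = #|S1|.
  rewrite -(card_imset S2 (@perm_inj _ u)); apply: eq_card => p.
  rewrite -(permKV u p) mem_imset; last exact: perm_inj.
  by rewrite !inE.
have : S2 \proper S1.
  rewrite properE; apply/andP; split.
    apply/subsetP => p; rewrite !inE; case: (boolP (p \in S0)) => [/hS/negbTE->//|pn].
    by rewrite regular_row_card// hr.
  by apply/subsetPn; exists z; rewrite inE ?ze// (negbTE (hS _ zS)).
by move=> /proper_card; rewrite c12 ltnn.
Qed.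

End Sing.

(** * Two singular rows: a long and a short cylinder *)

Section TwoRows.
Variables x y z : T.
Hypotheses (xy : x != y) (yz : y != z) (xz : x != z).
Hypotheses (ux : u (r x) = r (u y)) (uy : u (r y) = r (u z)) (uz : u (r z) = r (u x)).
Local Notation S3 := [set x; y; z].
Hypothesis reg : forall p, p \notin S3 -> u (r p) = r (u p).
Hypotheses (yrow : y \in porbit r x) (zrow : z \notin porbit r x).

Let w := #|porbit r x|.

Lemma first_return : exists2 a, 0 < a < w & iter a r x = y.
Proof.
have := yrow; rewrite porbit_traject => /trajectP[a aw yE].
exists a => //; rewrite aw andbT lt0n; apply: contraNneq xy => a0.
by rewrite yE a0.
Qed.

(* The row of x contains y but not z. The arc from x to y, of length a, is sent by
   [u] onto the row of [u (r x)], and the other arc together with the row of z onto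
   the row of [u (r z)]. *)
Section Arc.
Variables (a : nat) (aw : 0 < a < w) (ax : iter a r x = y).

Lemma iter_row i : 0 < i < w -> i != a -> iter i r x \notin S3.
Proof.
move=> iw ia; rewrite !inE !negb_or -!andbA; apply/and3P; split.
- by rewrite -[X in _ != X]/(iter 0 r x) eq_sym porbit_iter_neq//; lia.
- rewrite -ax; case: (ltngtP i a) ia => // h _; last rewrite eq_sym.
    by rewrite porbit_iter_neq//; lia.
  by rewrite porbit_iter_neq//; lia.
- by apply: contraNneq zrow => <-; exact: mem_porbit_iter.
Qed.

Lemma iter_w : iter w r x = x. Proof. exact: iter_porbit. Qed.

Lemma u_arc1 i : i < a -> u (iter i.+1 r x) = iter i r (u (r x)).
Proof.
move=> ia; rewrite iterSr (regular_iter reg)// => j ji.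
by rewrite -iterSr iter_row//; lia.
Qed.

Lemma u_arc2 i : a <= i < w -> u (iter i.+1 r x) = iter (i - a) r (u (r y)).
Proof.
move=> ia; have -> : iter i.+1 r x = iter (i - a) r (r y).
  by rewrite -iterSr -ax -iterD; have -> : (i - a).+1 + a = i.+1 by lia.
rewrite (regular_iter reg)// => j ji.
rewrite -iterSr -[in X in X \notin _]ax -iterD iter_row//; lia.
Qed.

Let e := #|porbit r z|.

Lemma u_rowz j : j < e -> u (iter j.+1 r z) = iter j r (u (r z)).
Proof.
move=> je; rewrite iterSr (regular_iter reg)// => i ij; rewrite -iterSr.
rewrite !inE !negb_or -!andbA; apply/and3P; split.
- apply: contraNneq zrow => h; rewrite -h porbit_sym; exact: mem_porbit_iter.
- apply: contraNneq zrow => h; apply: porbit_trans yrow.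
  by rewrite -h porbit_sym mem_porbit_iter.
- by rewrite -[X in _ != X]/(iter 0 r z) eq_sym porbit_iter_neq//; lia.
Qed.

Lemma e_gt0 : 0 < e. Proof. by rewrite lt0n card_porbit_neq0. Qed.

Lemma iter_e : iter e r (u (r z)) = u (r y).
Proof.
have := e_gt0; case E : e => [//|k] _; rewrite iterS -u_rowz ?E//.
by rewrite -E iter_porbit uy.
Qed.

Lemma iter_a : iter a r (u (r x)) = u (r x).
Proof.
have /andP[] := aw; case E : a => [//|k] _ _; rewrite iterS -u_arc1 ?E//.
by rewrite -E ax ux.
Qed.

Lemma card_arc1 : #|porbit r (u (r x))| = a.
Proof.
apply/eqP; rewrite eqn_leq card_porbit_le ?iter_a//=; last by case/andP: aw.
have inj : injective (fun i : 'I_a => u (iter i.+1 r x)).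
  move=> i j /perm_inj => /eqP h; apply/val_inj/eqP; move: h.
  apply: contraTT => ij; have := ltn_ord i; have := ltn_ord j.
  case: (ltngtP i j) ij => // h _ ja ia; last rewrite eq_sym.
    by rewrite porbit_iter_neq//; lia.
  by rewrite porbit_iter_neq//; lia.
rewrite -[X in X <= _](card_ord a) -(card_codom inj).
apply/subset_leq_card/subsetP => _ /codomP[i ->].
by rewrite u_arc1// mem_porbit_iter.
Qed.

(** The row of [u (r z)] contains the image of the whole row of z and, just after it, [u (r y)],
    which comes from the row of x. *)
Lemma card_arc2 : e < #|porbit r (u (r z))|.
Proof.
have h : (u (r y) |: (u @: porbit r z)) \subset porbit r (u (r z)).
  apply/subsetP => p; rewrite !inE => /orP[/eqP->|].
    by rewrite -iter_e mem_porbit_iter.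
  move=> /imsetP[q]; rewrite -porbit_step porbit_traject porbit_step.
  by move=> /trajectP[i ie ->] ->; rewrite -iterSr u_rowz// mem_porbit_iter.
move/subset_leq_card: h; rewrite cardsU1 card_imset; last exact: perm_inj.
suff -> : u (r y) \notin u @: porbit r z by [].
rewrite mem_imset; last exact: perm_inj.
apply: contraNN zrow; rewrite -eq_porbit_mem porbit_step eq_porbit_mem porbit_sym.
by move=> h; apply: porbit_trans h yrow.
Qed.

(* All other rows are translated by [u], so as many points lie in rows of length e
   after [u] as before. *)
Lemma arc_length : a = e.
Proof.
apply/eqP; apply/negPn/negP => ae.
have := @singular_card_eq S3 reg e (porbit r x :|: porbit r z) z.
case=> //; last by rewrite inE porbit_id orbT.
- move=> p; rewrite inE negb_or => /andP[px pz]; apply/pred0P => q /=.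
  apply/negP => /andP[qp]; rewrite !inE -orbA => /or3P[]/eqP qE; move: qp; rewrite qE porbit_sym.
  + exact/negP.
  + by move=> py; case/negP: px; apply: porbit_trans py yrow.
  + exact/negP.
have gtN p : p \in porbit r (u (r z)) -> #|porbit r p| != e.
  by move=> /eq_porbit ->; rewrite gtn_eqF// card_arc2.
move=> p; rewrite inE => /orP[].
  rewrite -porbit_step porbit_traject porbit_step => /trajectP[i iw ->].
  rewrite -iterSr; case: (ltnP i a) => ia.
    by rewrite u_arc1// (eq_porbit (mem_porbit_iter _ _ _)) card_arc1.
  apply: gtN; rewrite u_arc2; last by lia.
  by rewrite -iter_e -iterD mem_porbit_iter.
rewrite -porbit_step porbit_traject porbit_step => /trajectP[i iw ->].
by rewrite -iterSr u_rowz//; apply: gtN; exact: mem_porbit_iter.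
Qed.

(** The gcd divides the length of every singular row, hence the prime [#|T|]. It is at most a, which
    is less than w and so less than [#|T|]; only 1 is left. *)
Lemma coprime_rows : coprime w a.
Proof.
have xS : x \in S3 by rewrite !inE eqxx.
have : gcdn w a %| #|T|.
  apply: (row_card_dvd reg xS) => q; rewrite !inE -orbA => /or3P[]/eqP ->.
  - exact: dvdn_gcdl.
  - by rewrite (eq_porbit yrow) dvdn_gcdl.
  - by rewrite -/e -arc_length dvdn_gcdr.
move/primeP: Tpr => [_ h] /h /orP[//|/eqP gT].
have : gcdn w a <= a by apply: dvdn_leq; [case/andP: aw|exact: dvdn_gcdr].
have : w <= #|T| by exact: max_card.
rewrite gT; lia.
Qed.

Notation base := (u (r z)).
Notation sbase := (u (r x)).

Lemma iter_base_a : iter a r base = u (r y).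
Proof. by rewrite arc_length iter_e. Qed.

(** Since [a = e], positions are aligned. Counting from [r x], the point of index i goes to index i
    of the short row starting at [sbase] if [i < a], and to index i of the long row starting at
    [base] otherwise; the first a places of the long row are filled by the row of z. *)
Lemma u_rowx i : u (iter i.+1 r x) =
  if i %% w < a then iter (i %% w) r sbase else iter (i %% w) r base.
Proof.
have w0 : 0 < w by lia.
have -> : iter i.+1 r x = iter (i %% w).+1 r x.
  rewrite !iterSr iter_mod// -iterSr iterS; congr (r _); exact: iter_w.
have im := ltn_pmod i w0; case: ltnP => ia; first exact: u_arc1.
by rewrite u_arc2 ?ia// -iter_base_a -iterD subnK.
Qed.

Lemma u_rowz_mod j : u (iter j.+1 r z) = iter (j %% a) r base.
Proof.
have a0 : 0 < a by case/andP: aw.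
rewrite -u_rowz; last by rewrite -arc_length ltn_pmod.
rewrite !iterSr iter_mod// -iterSr iterS; congr (r _).
by rewrite arc_length iter_porbit.
Qed.

Lemma iter_base_w : iter w r base = base.
Proof.
have w0 : 0 < w by lia.
have h : u x = iter w.-1 r base.
  have := u_rowx w.-1; rewrite prednK// iter_w modn_small; last by rewrite ltn_predL.
  by case: ltnP => // h; exfalso; lia.
by rewrite -[in LHS](prednK w0) iterS -h -uz.
Qed.

(** Length is preserved up to the first singular row, and the row of [base] is longer than that of
    z, so this row is that of x. The long cylinder has height [m.+1], and t records its twist. *)
Lemma reach_rowx : exists m t, [/\ (forall j, j < m -> regular_row S3 (iter j u base)),
  iter m u base = iter t.+1 r x & ~~ regular_row S3 (iter m u base)].
Proof.
have xS : x \in S3 by rewrite !inE eqxx.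
have [m hm hj] := reach_singular reg base xS; exists m.
have cm := regular_rows_card reg hj.
suff : iter m u base \in porbit r (r x) by move=> /porbit_iterP[t tE]; exists t; rewrite iterSr.
rewrite porbit_step porbit_sym; move: (hm) => /pred0Pn[q /andP[/= qm]].
rewrite !inE -orbA => /or3P[]/eqP qE; rewrite qE in qm.
- by [].
- by apply: porbit_trans qm; rewrite porbit_sym.
- by have := card_arc2; rewrite -cm /e -(eq_porbit qm) ltnn.
Qed.

(** The row of [sbase] has length a, too short to arrive at the row of x and y. *)
Lemma reach_rowz : exists m t, [/\ (forall j, j < m -> regular_row S3 (iter j u sbase)),
  iter m u sbase = iter t.+1 r z & ~~ regular_row S3 (iter m u sbase)].
Proof.
have xS : x \in S3 by rewrite !inE eqxx.
have [m hm hj] := reach_singular reg sbase xS; exists m.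
have cm := regular_rows_card reg hj.
suff : iter m u sbase \in porbit r (r z) by move=> /porbit_iterP[t tE]; exists t; rewrite iterSr.
rewrite porbit_step; move: (hm) => /pred0Pn[q /andP[/= qm]].
have N : x \in porbit r (iter m u sbase) -> False.
  by move=> /eq_porbit h; move: cm; rewrite -h card_arc1 -/w; lia.
rewrite !inE -orbA => /or3P[]/eqP qE; rewrite qE in qm.
- by case: (N qm).
- by case: N; apply: porbit_trans qm; rewrite porbit_sym.
- by rewrite porbit_sym.
Qed.

Lemma U_iter k q m i : (forall j, j < m -> regular_row S3 (iter j u q)) ->
  iter m (r ^+ k * u)%g (iter i r q) = iter (m * k + i) r (iter m u q).
Proof.
elim: m => // m IH h; rewrite iterS IH; last by move=> j jm; apply: h; lia.
rewrite permM permX -iterD addnA -mulSn (regular_row_iter reg) -?iterS//.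
by apply: h.
Qed.

(** If two of these rows coincided, translating both by [m - j] further steps would identify the
    singular row at level m with a regular row at a lower level. *)
Lemma distinct_rows q m i j :
  (forall j, j < m -> regular_row S3 (iter j u q)) ->
  ~~ regular_row S3 (iter m u q) -> i < j <= m ->
  porbit r (iter i u q) <> porbit r (iter j u q).
Proof.
move=> h hm ij pij.
have : iter i u q \in porbit r (iter j u q) by rewrite -pij porbit_id.
move=> /porbit_iterP[k ijk].
have h' l : l < m - j -> regular_row S3 (iter l u (iter j u q)).
  by move=> lm; rewrite -iterD; apply: h; lia.
have : iter (m - j) u (iter i u q) = iter k r (iter m u q).
  by rewrite ijk (regular_rows_iter reg _ h') -iterD subnK//; lia.
move=> E; case/negP: hm; have : regular_row S3 (iter (m - j) u (iter i u q)).
  by rewrite -iterD; apply: h; lia.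
by rewrite E /regular_row (eq_porbit (mem_porbit_iter _ _ _)).
Qed.

(** Rows of the same cylinder are distinct, and rows of different cylinders differ in length: a in
    one, more than a in the other. *)
Lemma card_rows_ge m1 m2 :
  (forall j, j < m1 -> regular_row S3 (iter j u sbase)) ->
  ~~ regular_row S3 (iter m1 u sbase) ->
  (forall j, j < m2 -> regular_row S3 (iter j u base)) ->
  ~~ regular_row S3 (iter m2 u base) ->
  m1.+1 + m2.+1 <= #|porbits r|.
Proof.
move=> h1 n1 h2 n2.
pose g (k : 'I_m1.+1 + 'I_m2.+1) := match k with
  | inl i => porbit r (iter i u sbase) | inr i => porbit r (iter i u base) end.
have c1 (i : 'I_m1.+1) : #|porbit r (iter i u sbase)| = a.
  rewrite (@regular_rows_card S3 reg) ?card_arc1// => j ji.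
  by apply: h1; have := ltn_ord i; lia.
have c2 (i : 'I_m2.+1) : a < #|porbit r (iter i u base)|.
  rewrite (@regular_rows_card S3 reg) ?arc_length ?card_arc2// => j ji.
  by apply: h2; have := ltn_ord i; lia.
have inj : injective g.
  case=> i [] j //= ij.
  - congr inl; apply/val_inj => /=; have := ltn_ord i; have := ltn_ord j.
    case: (ltngtP i j) => // h jm im; first by case: (distinct_rows h1 n1 _ ij); lia.
    by case: (distinct_rows h1 n1 _ (esym ij)); lia.
  - by have := c1 i; have := c2 j; rewrite ij; lia.
  - by have := c1 j; have := c2 i; rewrite ij; lia.
  - congr inr; apply/val_inj => /=; have := ltn_ord i; have := ltn_ord j.
    case: (ltngtP i j) => // h jm im; first by case: (distinct_rows h2 n2 _ ij); lia.
    by case: (distinct_rows h2 n2 _ (esym ij)); lia.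
rewrite -[X in X <= _](_ : #|{: 'I_m1.+1 + 'I_m2.+1}| = _); last by rewrite card_sum !card_ord.
rewrite -(card_codom inj); apply/subset_leq_card/subsetP => _ /codomP[[] i ->] /=; exact: imset_f.
Qed.

(* With U = u r^k, the chinese remainders k2 and k1 make U^(m2+1) send the i-th point
   of the row of [base] to its (i - s)-th one, or else into the row of [sbase],
   whence U^(m1+1) leads back to the (i - v)-th point of the row of [base], or to one
   of its first a. So the first [maxn s v] points of that row meet every orbit, while s <= m2 + 1, v <= m1 + 1 and
   [r] has at least (m1 + 1) + (m2 + 1) rows. *)
Lemma fewer_cycles_arc : exists k, #|porbits (r ^+ k * u)%g| < #|porbits r|.
Proof.
have [m2 [t2 [g2 e2 n2]]] := reach_rowx; have [m1 [t1 [g1 e1 n1]]] := reach_rowz.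
have w0 : 0 < w by lia. have a0 : 0 < a by case/andP: aw.
have [s [k2 [s0 sh sw sd]]] := bezout_shift t2 (ltn0Sn m2) w0.
(* The term [a.-1 * s] stands for -s modulo a: a point that drops into the short row arrives there
   already displaced by s. *)
have [v [k1 [v0 vh va vd]]] := bezout_shift (t1 + a.-1 * s) (ltn0Sn m1) a0.
have cop := coprime_rows.
pose k := chinese w a k2 k1.
have kw : k = k2 %[mod w] by exact: chinese_modl.
have ka : k = k1 %[mod a] by exact: chinese_modr.
have {sd kw} sd : w %| m2.+1 * k + t2 + s.
  by move: sd; rewrite /dvdn -!(addnA (m2.+1 * _)) -(modnDml (m2.+1 * k2)) -modnMmr -kw modnMmr modnDml.
have {vd ka} vd : a %| m1.+1 * k + (t1 + a.-1 * s) + v.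
  by move: vd; rewrite /dvdn -!(addnA (m1.+1 * _)) -(modnDml (m1.+1 * k1)) -modnMmr -ka modnMmr modnDml.
exists k; pose U := (r ^+ k * u)%g; rewrite -/U.
have U2 i : iter m2.+1 U (iter i r base) = u (iter (m2.+1 * k + i + t2).+1 r x).
  rewrite iterS (U_iter _ _ g2) permM permX e2 -!iterD; congr (u (iter _ _ _)); lia.
have U1 i : iter m1.+1 U (iter i r sbase) = u (iter (m1.+1 * k + i + t1).+1 r z).
  rewrite iterS (U_iter _ _ g1) permM permX e1 -!iterD; congr (u (iter _ _ _)); lia.
have desc i : i < w -> maxn s v <= i -> exists2 j, j < i &
    iter j r base \in porbit U (iter i r base).
  move=> iw; rewrite geq_max => /andP[si vi].
  have := mem_porbit_iter U m2.+1 (iter i r base); rewrite U2 u_rowx.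
  have -> : (m2.+1 * k + i + t2) %% w = i - s.
    case/dvdnP: sd => q qE; have -> : m2.+1 * k + i + t2 = q * w + (i - s) by lia.
    by rewrite modnMDl modn_small//; lia.
  case: ifP => ia h; last by exists (i - s) => //; lia.
  have := mem_porbit_iter U m1.+1 (iter (i - s) r sbase); rewrite U1 u_rowz_mod => h'.
  exists ((m1.+1 * k + (i - s) + t1) %% a); last exact: porbit_trans h' h.
  case: (leqP a i) => ai; first by apply: leq_trans ai; exact: ltn_pmod.
  suff -> : (m1.+1 * k + (i - s) + t1) %% a = i - v by lia.
  rewrite -(modnMDl s); case/dvdnP: vd => q qE.
  have -> : s * a + (m1.+1 * k + (i - s) + t1) = q * a + (i - v).
    have : s * a = s + a.-1 * s by case: (a) a0 => // a' _; lia.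
    lia.
  by rewrite modnMDl modn_small//; lia.
have low i : i < w -> exists2 j, j < maxn s v & iter i r base \in porbit U (iter j r base).
  elim/ltn_ind: i => i IH iw; case: (ltnP i (maxn s v)) => [im|/(desc i iw)[j ji h]].
    by exists i => //; exact: porbit_id.
  have [l lm hl] := IH j ji (ltn_trans ji iw); exists l => //.
  by apply: porbit_trans hl; rewrite porbit_sym.
have lowi i : exists2 j, j < maxn s v & iter i r base \in porbit U (iter j r base).
  have [j jm h] := low (i %% w) (ltn_pmod i w0); exists j => //.
  by rewrite -(iter_mod i iter_base_w).
(* Adding [m * k] one time less than the length of the row amounts to subtracting it. Any point of a
   row at level m is thereby [U] applied m times to a point of the bottom row. *)
have adj m q i : exists i', iter i r q = iter (m * k + i') r q.
  have L0 : 0 < #|porbit r q| by rewrite lt0n card_porbit_neq0.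
  exists (i + (#|porbit r q|).-1 * (m * k)).
  rewrite -(iter_mod i (iter_porbit r q)) -(iter_mod (_ + _) (iter_porbit r q)).
  congr iter; rewrite -(modnMDl (m * k) i); congr modn.
  case: #|porbit r q| L0 => // l _; lia.
(* The rows of the two cylinders exhaust all labels, again by transitivity. *)
pose E := [set p | `[< exists m i, [/\ m <= m2 & p = iter i r (iter m u base)] \/
                                 [/\ m <= m1 & p = iter i r (iter m u sbase)] >]].
have ET : E = setT.
  have [] : E = set0 \/ E = setT.
  - apply: trans; apply: perm_closed_mem => p; rewrite !inE => /asboolP[m [i pE]]; apply/asboolP.
      exists m, i.+1; case: pE => -[mm ->]; [left|right] => //.
    case: pE => -[mm ->].
      move: mm; rewrite leq_eqVlt => /orP[/eqP ->|mm]; last first.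
        by exists m.+1, i; left; rewrite (regular_row_iter reg)//; exact: g2.
      rewrite e2 -iterD addnS u_rowx; case: ifP => _.
        by exists 0, ((i + t2) %% w); right.
      by exists 0, ((i + t2) %% w); left.
    move: mm; rewrite leq_eqVlt => /orP[/eqP ->|mm]; last first.
      by exists m.+1, i; right; rewrite (regular_row_iter reg)//; exact: g1.
    by rewrite e1 -iterD addnS u_rowz_mod; exists 0, ((i + t1) %% a); left.
  - move=> E0; have : base \in E by rewrite inE; apply/asboolP; exists 0, 0; left.
    by rewrite E0 inE.
  by [].
have : #|porbits U| <= maxn s v.
  apply: (card_porbits_le (g := fun j => iter j r base)) => p.
  have : p \in E by rewrite ET inE.
  rewrite inE => /asboolP[m [i [[mm ->]|[mm ->]]]].
    have gm j : j < m -> regular_row S3 (iter j u base) by move=> jm; apply: g2; lia.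
    rewrite -(regular_rows_iter reg _ gm); have [i' ->] := adj m base i.
    rewrite (regular_rows_iter reg _ gm) -U_iter// -/U.
    have [j jm h] := lowi i'; exists j => //; apply: porbit_trans h; exact: mem_porbit_iter.
  have gm j : j < m -> regular_row S3 (iter j u sbase) by move=> jm; apply: g1; lia.
  rewrite -(regular_rows_iter reg _ gm); have [i' ->] := adj m sbase i.
  rewrite (regular_rows_iter reg _ gm) -U_iter// -/U.
  rewrite -(iter_mod i' iter_a); set i1 := i' %% a; have i1a : i1 < a by exact: ltn_pmod.
  (* Modulo w this is i1 minus the shift produced by one passage through the long cylinder, so that
     passage takes index i2 of the long row to index i1 of the short one. *)
  pose i2 := i1 + w.-1 * (m2.+1 * k + t2).
  have := U2 i2; rewrite u_rowx.
  have -> : (m2.+1 * k + i2 + t2) %% w = i1.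
    have -> : m2.+1 * k + i2 + t2 = (m2.+1 * k + t2) * w + i1.
      by rewrite /i2; case: (w) w0 => // w' _ /=; lia.
    by rewrite modnMDl modn_small//; lia.
  rewrite i1a => <-; have [j jm h] := lowi i2; exists j => //.
  by apply: porbit_trans h; rewrite -iterD; exact: mem_porbit_iter.
have := card_rows_ge g1 n1 g2 n2; have : maxn s v <= maxn m1.+1 m2.+1 by lia.
rewrite -/U; lia.
Qed.

End Arc.

Lemma fewer_cycles_two_rows : exists k, #|porbits (r ^+ k * u)%g| < #|porbits r|.
Proof. by have [a aw ax] := first_return; exact: fewer_cycles_arc aw ax. Qed.

End TwoRows.

(** The hypotheses are invariant under cyclic relabelling of x, y, z, so only the number of rows
    meeting these points matters; the cases of one row and of three rows end in contradictions. *)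
Theorem fewer_cycles x y z p q :
  x != y -> y != z -> x != z ->
  u (r x) = r (u y) -> u (r y) = r (u z) -> u (r z) = r (u x) ->
  (forall t, t \notin [set x; y; z] -> u (r t) = r (u t)) ->
  q \notin porbit r p -> exists k, #|porbits (r ^+ k * u)%g| < #|porbits r|.
Proof.
move=> xy yz xz ux uy uz reg qp.
have perm3 (a b c : T) : [set a; b; c] = [set b; c; a].
  by apply/setP => t; rewrite !inE -!orbA orbC -!orbA.
case: (boolP (y \in porbit r x)) => yx; case: (boolP (z \in porbit r x)) => zx.
(* One row: its length divides a prime and is not 1, as x and y are distinct, so [r] would be a
   single cycle. *)
- case/negP: qp; have xS : x \in [set x; y; z] by rewrite !inE eqxx.
  have dv : #|porbit r x| %| #|T|.
    apply: (row_card_dvd reg xS) => t; rewrite !inE -orbA => /or3P[]/eqP -> //.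
      by rewrite (eq_porbit yx).
    by rewrite (eq_porbit zx).
  move/primeP: Tpr => [_ /(_ _ dv)] /orP[/eqP c1|/eqP cT].
    case/negP: xy; have := yx; have /cards1P[t tE] : #|porbit r x| == 1 by rewrite c1.
    by have := porbit_id r x; rewrite tE !inE => /eqP -> /eqP ->.
  have /eqP E : porbit r x == setT by rewrite eqEcard subsetT cardsT cT leqnn.
  have Ex t : porbit r t = porbit r x by apply: eq_porbit; rewrite E inE.
  by rewrite -eq_porbit_mem !Ex.
- exact: (fewer_cycles_two_rows xy yz xz).
- rewrite perm3 perm3 in reg.
  apply: (@fewer_cycles_two_rows z x y) => //; rewrite 1?eq_sym// porbit_sym//.
  by apply: contraNN yx; rewrite porbit_sym => h; apply: porbit_trans h zx.
case: (boolP (z \in porbit r y)) => zy.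
  rewrite perm3 in reg.
  by apply: (@fewer_cycles_two_rows y z x) => //; rewrite 1?eq_sym// porbit_sym.
have yz' : y \notin porbit r z by rewrite porbit_sym.
have xy' : x \notin porbit r y by rewrite porbit_sym.
have xz' : x \notin porbit r z by rewrite porbit_sym.
have row a b c i : [set a; b; c] = [set x; y; z] -> b \notin porbit r a -> c \notin porbit r a ->
    i < #|porbit r a| -> u (iter i.+1 r a) = iter i r (u (r a)).
  move=> S nb nc ia; rewrite iterSr (@regular_iter [set x; y; z])// => j ji.
  rewrite -S -iterSr !inE !negb_or -!andbA; apply/and3P; split.
  - by rewrite -[X in _ != X]/(iter 0 r a) eq_sym porbit_iter_neq//; lia.
  - by apply: contraNneq nb => <-; exact: mem_porbit_iter.
  - by apply: contraNneq nc => <-; exact: mem_porbit_iter.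
have rowS a b c t : [set a; b; c] = [set x; y; z] -> b \notin porbit r a -> c \notin porbit r a ->
    t \in porbit r a -> u t \in porbit r (u (r a)).
  move=> S nb nc; rewrite -porbit_step porbit_traject porbit_step => /trajectP[i ia ->].
  by rewrite -iterSr (row a b c)// mem_porbit_iter.
have Sy : [set y; z; x] = [set x; y; z] by rewrite -perm3.
have Sz : [set z; x; y] = [set x; y; z] by rewrite perm3.
have rx t : t \in porbit r x -> u t \in porbit r (u (r x)) by exact: (rowS x y z).
have ry t : t \in porbit r y -> u t \in porbit r (u (r y)) by exact: (rowS y z x).
have rz t : t \in porbit r z -> u t \in porbit r (u (r z)) by exact: (rowS z x y).
(* Three rows: their images all lie in one common row, longer than the row of x. No point of the
   three rows is then sent into a row of that length, against the conservation law. *)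
have exy : porbit r (u (r x)) = porbit r (u (r y)).
  by rewrite ux porbit_step; apply: eq_porbit; apply: ry; exact: porbit_id.
have eyz : porbit r (u (r y)) = porbit r (u (r z)).
  by rewrite uy porbit_step; apply: eq_porbit; apply: rz; exact: porbit_id.
have big : #|porbit r x| < #|porbit r (u (r x))|.
  have h : (u y |: (u @: porbit r x)) \subset porbit r (u (r x)).
    apply/subsetP => t; rewrite !inE => /orP[/eqP->|/imsetP[t' /rx h ->]//].
    by rewrite exy; apply: ry; exact: porbit_id.
  move/subset_leq_card: h; rewrite cardsU1 card_imset; last exact: perm_inj.
  by rewrite mem_imset ?yx//; exact: perm_inj.
have := @singular_card_eq [set x; y; z] reg #|porbit r x| (porbit r x :|: porbit r y :|: porbit r z) x.
case=> //; last by rewrite !inE porbit_id.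
- move=> t; rewrite !inE !negb_or -andbA => /and3P[tx ty tz]; apply/pred0P => t' /=.
  apply/negP => /andP[tt]; rewrite !inE -orbA => /or3P[]/eqP tE; move: tt; rewrite tE porbit_sym; exact/negP.
move=> t; rewrite !inE -orbA => /or3P[/rx|/ry|/rz] /eq_porbit ->; rewrite ?exy -?eyz -?exy; by rewrite gtn_eqF.
Qed.

End Descent.

From mathcomp Require Import all_order all_algebra all_classical all_reals.
From mathcomp Require Import topology normedtype derive realfun complex.
From mathcomp Require Import ring lra.
Require Import Defs.

Import Order.TTheory GRing.Theory Num.Theory.
Import numFieldNormedType.Exports.

Local Open Scope classical_set_scope.
Local Open Scope ring_scope.

(** * Calculus in the complex plane *)

Section ComplexModulus.
Variable R : realType.
Local Notation C := (cplx R).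
Implicit Types (z w a : C) (x y e : R).

(** The norm of [C] takes its values in [C]; this is the same modulus as a real number, for which
    order reasoning over [R] is available. *)
Definition cabs z : R := Num.sqrt (complex.Re z ^+ 2 + complex.Im z ^+ 2).

Lemma cabsE z : `|z| = rcplx (cabs z). Proof. by rewrite normc_def. Qed.

Lemma rcplx_inj : injective (@rcplx R). Proof. by move=> x y []. Qed.

Lemma rcplxB x y : rcplx (x - y) = rcplx x - rcplx y. Proof. by rewrite /rcplx rmorphB. Qed.
Lemma rcplxD x y : rcplx (x + y) = rcplx x + rcplx y. Proof. by rewrite /rcplx rmorphD. Qed.
Lemma rcplxM x y : rcplx (x * y) = rcplx x * rcplx y. Proof. by rewrite /rcplx rmorphM. Qed.

Lemma cabs_ge0 z : 0 <= cabs z. Proof. exact: sqrtr_ge0. Qed.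

Lemma cabs0 : cabs 0 = 0. Proof. by apply: rcplx_inj; rewrite -cabsE normr0. Qed.

Lemma cabs1 : cabs 1 = 1. Proof. by apply: rcplx_inj; rewrite -cabsE normr1. Qed.

Lemma cabs_eq0 z : (cabs z == 0) = (z == 0).
Proof. by rewrite -(inj_eq rcplx_inj) -cabsE normr_eq0. Qed.

Lemma cabs_gt0 z : (0 < cabs z) = (z != 0).
Proof. by rewrite lt_def cabs_eq0 cabs_ge0 andbT. Qed.

Lemma cabsM z w : cabs (z * w) = cabs z * cabs w.
Proof. by apply: rcplx_inj; rewrite -cabsE normrM !cabsE /rcplx rmorphM. Qed.

Lemma cabsN z : cabs (- z) = cabs z.
Proof. by apply: rcplx_inj; rewrite -!cabsE normrN. Qed.

Lemma cabsB z w : cabs (z - w) = cabs (w - z).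
Proof. by rewrite -cabsN opprB. Qed.

Lemma cabsX z n : cabs (z ^+ n) = cabs z ^+ n.
Proof. by elim: n => [|n IH]; rewrite ?expr0 ?cabs1// !exprS cabsM IH. Qed.

Lemma cabsV z : cabs z^-1 = (cabs z)^-1.
Proof. by apply: rcplx_inj; rewrite -cabsE normfV cabsE /rcplx fmorphV. Qed.

Lemma cabs_rcplx x : cabs (rcplx x) = `|x|.
Proof. by rewrite /cabs /= expr0n addr0 sqrtr_sqr. Qed.

Lemma cabsD z w : cabs (z + w) <= cabs z + cabs w.
Proof. by have := ler_normD z w; rewrite !cabsE -rcplxD lecR. Qed.

Lemma cabs_sub_le z w a : cabs (z - w) <= cabs (z - a) + cabs (a - w).
Proof. by have := cabsD (z - a) (a - w); rewrite addrA subrK. Qed.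

Lemma Re_le_cabs z : `|complex.Re z| <= cabs z.
Proof. by rewrite -lecR -[X in _ <= X]/(rcplx _) -cabsE; exact: normc_ge_Re. Qed.

Lemma Im_le_cabs z : `|complex.Im z| <= cabs z.
Proof.
rewrite /cabs -sqrtr_sqr ler_sqrt; first by rewrite lerDr sqr_ge0.
by rewrite addr_ge0 ?sqr_ge0.
Qed.

Lemma cabs_le_ReIm z : cabs z <= `|complex.Re z| + `|complex.Im z|.
Proof.
rewrite -[X in _ <= X]ger0_norm ?addr_ge0//.
rewrite /cabs -[leRHS]sqrtr_sqr ler_sqrt ?sqr_ge0//.
rewrite sqrrD !real_normK ?num_real//.
by rewrite addrAC lerDl mulrn_wge0// mulr_ge0.
Qed.

Definition disc a e : set C := [set z | cabs (z - a) < e].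

Lemma disc_center a e : 0 < e -> disc a e a.
Proof. by rewrite /disc /= subrr cabs0. Qed.

Lemma disc_subset a e e' : e <= e' -> disc a e `<=` disc a e'.
Proof. by move=> ee z /lt_le_trans; apply. Qed.

Lemma ball_disc a e : ball a (rcplx e) = disc a e.
Proof.
apply/seteqP; split => z; rewrite -ball_normE /ball_ /disc /= cabsE ltcR cabsB//.
Qed.

Lemma open_disc a e : open (disc a e).
Proof.
case: (ltP 0 e) => e0; first by rewrite -ball_disc; apply: ball_open; exact: rcplx_gt0.
suff -> : disc a e = set0 by exact: open0.
apply/seteqP; split => // z; rewrite /disc /= => h.
by have := cabs_ge0 (z - a); rewrite leNgt (lt_le_trans h e0).
Qed.

Lemma nbhs_disc a e : 0 < e -> nbhs a (disc a e).
Proof. by move=> e0; apply: open_nbhs_nbhs; split; [exact: open_disc|exact: disc_center]. Qed.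

Lemma gt0_cplx (e : C) : 0 < e -> exists2 x : R, 0 < x & e = rcplx x.
Proof.
case: e => x y; rewrite ltcE /= => /andP[/eqP y0 x0]; exists x => //.
by rewrite y0.
Qed.

Lemma nbhs_discP a (A : set C) : nbhs a A <-> exists2 e, 0 < e & disc a e `<=` A.
Proof.
split=> [/nbhs_ballP[_ /gt0_cplx[e e0 ->]]|[e e0 h]].
  by rewrite ball_disc => h; exists e.
by apply: filterS (nbhs_disc a e0).
Qed.

Lemma cvg_cabsP (T : Type) (F : set_system T) (g : T -> C) a : Filter F ->
  g @ F --> a <-> forall e, 0 < e -> \forall t \near F, cabs (g t - a) < e.
Proof.
move=> FF; split => [h e e0|h A /nbhs_discP[e e0 eA]].
  by have := h _ (nbhs_disc a e0).
by apply: filterS (h e e0) => t /eA.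
Qed.

Lemma near_cabs (X : topologicalType) (g : X -> C) (p : X) (e : R) :
  {for p, continuous g} -> 0 < e -> \forall q \near p, cabs (g q - g p) < e.
Proof. by move=> /cvg_cabsP h e0; exact: h. Qed.

Lemma continuous_for_cabs (X : topologicalType) (g : X -> C) (p : X) :
  (forall e, 0 < e -> \forall q \near p, cabs (g q - g p) < e) -> {for p, continuous g}.
Proof. by move=> h; apply/cvg_cabsP. Qed.

Lemma rcplx_continuous : continuous (@rcplx R).
Proof.
move=> x; apply/cvg_cabsP => e e0.
apply: filterS (nbhsx_ballx x e e0) => y; rewrite -ball_normE /= => h.
by rewrite -rcplxB cabs_rcplx distrC.
Qed.

Lemma continuous_for_dist (X : topologicalType) (g : X -> R) (p : X) :
  (forall e, 0 < e -> \forall q \near p, `|g p - g q| < e) -> {for p, continuous g}.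
Proof. by move=> h; apply/cvgrPdist_lt. Qed.

Lemma Re_continuous : continuous (@complex.Re R : C -> R).
Proof.
move=> z; apply: continuous_for_dist => e e0; apply: filterS (nbhs_disc z e0) => w.
by rewrite /disc /= cabsB -ReB; apply: le_lt_trans; exact: Re_le_cabs.
Qed.

Lemma Im_continuous : continuous (@complex.Im R : C -> R).
Proof.
move=> z; apply: continuous_for_dist => e e0; apply: filterS (nbhs_disc z e0) => w.
by rewrite /disc /= cabsB -ImB; apply: le_lt_trans; exact: Im_le_cabs.
Qed.

Lemma cabs_continuous : continuous cabs.
Proof.
move=> z; apply: continuous_for_dist => e e0; apply: filterS (nbhs_disc z e0) => w.
rewrite /disc /= => h; apply: le_lt_trans h.
have h1 := cabsD (w - z) z; have h2 := cabsD (z - w) w.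
rewrite !subrK (cabsB z w) in h1 h2; rewrite ler_norml; lra.
Qed.

Lemma ReD z w : complex.Re (z + w) = complex.Re z + complex.Re w.
Proof. by case: z; case: w. Qed.
Lemma ImD z w : complex.Im (z + w) = complex.Im z + complex.Im w.
Proof. by case: z; case: w. Qed.
Lemma ReM z w : complex.Re (z * w) = complex.Re z * complex.Re w - complex.Im z * complex.Im w.
Proof. by case: z; case: w. Qed.
Lemma ImM z w : complex.Im (z * w) = complex.Re z * complex.Im w + complex.Im z * complex.Re w.
Proof. by case: z; case: w => a b c d /=; rewrite addrC. Qed.
Lemma ReZ x w : complex.Re (rcplx x * w) = x * complex.Re w.
Proof. by rewrite ReM mul0r subr0. Qed.
Lemma ImZ x w : complex.Im (rcplx x * w) = x * complex.Im w.
Proof. by rewrite ImM mul0r addr0. Qed.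

Lemma ReIm_inj z w : complex.Re z = complex.Re w -> complex.Im z = complex.Im w -> z = w.
Proof. by case: z; case: w => a b c d /= -> ->. Qed.

Definition convexC (D : set C) := forall z w t, D z -> D w -> 0 <= t <= 1 ->
  D (z + rcplx t * (w - z)).

Lemma convexCI D E : convexC D -> convexC E -> convexC (D `&` E).
Proof. by move=> hD hE z w t [Dz Ez] [Dw Ew] t01; split; [exact: hD|exact: hE]. Qed.

Lemma convexC_disc a e : convexC (disc a e).
Proof.
move=> z w t; rewrite /disc /= => za wa /andP[t0 t1].
have -> : z + rcplx t * (w - z) - a = rcplx (1 - t) * (z - a) + rcplx t * (w - a).
  rewrite rcplxB (_ : rcplx 1 = 1 :> C)//; ring.
apply: le_lt_trans (cabsD _ _) _; rewrite !cabsM !cabs_rcplx !ger0_norm//; last by lra.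
have [->|t0'] := eqVneq t 0; first by rewrite subr0 mul1r mul0r addr0.
have tp : 0 < t by rewrite lt_def t0'.
have h1 : (1 - t) * cabs (z - a) <= (1 - t) * e by rewrite ler_wpM2l ?(ltW za)//; lra.
have h2 : t * cabs (w - a) < t * e by rewrite ltr_pM2l.
by have := ler_ltD h1 h2; rewrite -mulrDl subrK mul1r.
Qed.

Lemma line_continuous z v : continuous (fun t : R => z + rcplx t * v).
Proof.
move=> t; apply: (@continuousD _ _ _ (fun=> z) (fun t => rcplx t * v)); first exact: cst_continuous.
apply: (@continuousM _ _ (@rcplx R) (fun=> v)); [exact: rcplx_continuous|exact: cst_continuous].
Qed.

Lemma convexC_connected D : convexC D -> connected D.
Proof.
move=> cD; have [->|] := eqVneq D set0; first exact: connected0.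
case/set0P => z0 Dz0.
have -> : D = \bigcup_(w in D) ((fun t : R => z0 + rcplx t * (w - z0)) @` `[0, 1]).
  apply/seteqP; split => [w Dw|_ [w Dw [t /= t01 <-]]].
    exists w => //; exists 1; first by rewrite /= in_itv /= lexx ler01.
    by rewrite (_ : rcplx 1 = 1 :> C)// mul1r addrC subrK.
  by apply: cD => //; move: t01; rewrite in_itv.
apply: bigcup_connected => [|w Dw].
  exists z0 => w Dw; exists 0; first by rewrite /= in_itv /= lexx ler01.
  by rewrite (_ : rcplx 0 = 0 :> C)// mul0r addr0.
apply: connected_continuous_connected; first exact: segment_connected.
by apply: continuous_subspaceT => t; exact: line_continuous.
Qed.

End ComplexModulus.

(** * Derivatives without quotients and mean value inequalities *)

Section LinApprox.
Variable R : realType.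
Local Notation C := (cplx R).

(* dF = l du at x, as [has_deriv_wrt] but without quotients. *)
Definition lin_approx (X : topologicalType) (u F : X -> C) (x : X) (l : C) :=
  forall e : R, 0 < e ->
  \forall y \near x, cabs (F y - F x - l * (u y - u x)) <= e * cabs (u y - u x).

(** Needed to compare with the quotient form of the derivative, where a vanishing denominator gives
    the default value 0. *)
Definition separates (X : topologicalType) (u : X -> C) (x : X) :=
  \forall y \near x, y <> x -> u y <> u x.

Section OneSpace.
Variable X : topologicalType.
Implicit Types (u v F G : X -> C) (x : X) (l m : C).

Lemma cabs_lin_quot (d D l : C) (e : R) : d != 0 ->
  (cabs (D / d - l) <= e) = (cabs (D - l * d) <= e * cabs d).
Proof.
move=> d0; have -> : D - l * d = (D / d - l) * d by rewrite mulrBl divfK.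
by rewrite cabsM ler_pM2r ?cabs_gt0.
Qed.

Lemma deriv_lin_approx u F x l : separates u x -> has_deriv_wrt u F x l -> lin_approx u F x l.
Proof.
move=> su /cvg_cabsP h e e0; have := h e e0; rewrite /dnbhs near_withinE => he.
apply: filterS2 su he => y uy hy.
have [->|yx] := pselect (y = x); first by rewrite !subrr mulr0 subrr cabs0 mulr0.
rewrite -cabs_lin_quot; first by apply/ltW/hy/eqP.
by rewrite subr_eq0; apply/eqP/uy.
Qed.

Lemma lin_approx_deriv u F x l : separates u x -> lin_approx u F x l -> has_deriv_wrt u F x l.
Proof.
move=> su h; apply/cvg_cabsP => e e0; rewrite /dnbhs near_withinE.
have e2 : 0 < e / 2 by rewrite divr_gt0.
apply: filterS2 su (h _ e2) => y uy hy /eqP yx; apply: le_lt_trans (_ : e / 2 < e); last by lra.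
rewrite cabs_lin_quot// subr_eq0; exact/eqP/uy.
Qed.

Lemma lin_approx_continuous u F x l : lin_approx u F x l -> {for x, continuous u} ->
  {for x, continuous F}.
Proof.
move=> h cu; apply/cvg_cabsP => e e0.
have d0 : 0 < e / (cabs l + 1 + 1) by have := cabs_ge0 l; move=> ?; rewrite divr_gt0//; lra.
apply: filterS2 (h 1 ltr01) (near_cabs cu d0) => y; rewrite mul1r => h1 h2.
have -> : F y - F x = (F y - F x - l * (u y - u x)) + l * (u y - u x) by rewrite subrK.
apply: le_lt_trans (cabsD _ _) _; rewrite cabsM.
apply: (@le_lt_trans _ _ ((cabs l + 1) * cabs (u y - u x))); first by lra.
have l0 := cabs_ge0 l.
apply: (@le_lt_trans _ _ ((cabs l + 1 + 1) * cabs (u y - u x))).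
  by rewrite ler_wpM2r ?cabs_ge0//; lra.
by rewrite mulrC -ltr_pdivlMr//; lra.
Qed.

Lemma lin_approx_cst u (c : C) x : lin_approx u (fun=> c) x 0.
Proof. by move=> e e0; near=> y; rewrite subrr mul0r subr0 cabs0 mulr_ge0 ?cabs_ge0// ltW.
Unshelve. all: by end_near. Qed.

Lemma lin_approx_id u x : lin_approx u u x 1.
Proof. by move=> e e0; near=> y; rewrite mul1r subrr cabs0 mulr_ge0 ?cabs_ge0// ltW.
Unshelve. all: by end_near. Qed.

Lemma lin_approxD u F G x l m : lin_approx u F x l -> lin_approx u G x m ->
  lin_approx u (fun y => F y + G y) x (l + m).
Proof.
move=> hF hG e e0; have e2 : 0 < e / 2 by rewrite divr_gt0.
apply: filterS2 (hF _ e2) (hG _ e2) => y h1 h2.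
have -> : F y + G y - (F x + G x) - (l + m) * (u y - u x) =
  (F y - F x - l * (u y - u x)) + (G y - G x - m * (u y - u x)) by ring.
by apply: le_trans (cabsD _ _) _; lra.
Qed.

Lemma lin_approxZ u F x l (c : C) : lin_approx u F x l ->
  lin_approx u (fun y => c * F y) x (c * l).
Proof.
move=> hF e e0; have c0 : 0 < cabs c + 1 by rewrite ltr_wpDl ?cabs_ge0.
have e2 : 0 < e / (cabs c + 1) by rewrite divr_gt0.
apply: filterS (hF _ e2) => y h1.
have -> : c * F y - c * F x - c * l * (u y - u x) =
  c * (F y - F x - l * (u y - u x)) by ring.
rewrite cabsM; apply: (@le_trans _ _ ((cabs c + 1) * cabs (F y - F x - l * (u y - u x)))).
  by rewrite ler_wpM2r ?cabs_ge0//; lra.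
by rewrite mulrC -ler_pdivlMr// mulrAC.
Qed.

(** The chain rule, seen as a change of the reference function. *)
Lemma lin_approx_trans u v F x l m : lin_approx u F x l -> lin_approx v u x m ->
  lin_approx v F x (l * m).
Proof.
move=> hF hu e e0.
have m0 : 0 < cabs m + 1 by rewrite ltr_wpDl ?cabs_ge0.
have l0 : 0 < cabs l + 1 by rewrite ltr_wpDl ?cabs_ge0.
have e1 : 0 < e / 2 / (cabs m + 1) by rewrite !divr_gt0.
have e2 : 0 < e / 2 / (cabs l + 1) by rewrite !divr_gt0.
near=> y.
have h1 : cabs (F y - F x - l * (u y - u x)) <= e / 2 / (cabs m + 1) * cabs (u y - u x).
  by near: y; exact: hF.
have h2 : cabs (u y - u x - m * (v y - v x)) <= 1 * cabs (v y - v x).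
  by near: y; exact: hu.
have h3 : cabs (u y - u x - m * (v y - v x)) <= e / 2 / (cabs l + 1) * cabs (v y - v x).
  by near: y; exact: hu.
have -> : F y - F x - l * m * (v y - v x) =
  (F y - F x - l * (u y - u x)) + l * (u y - u x - m * (v y - v x)) by ring.
apply: le_trans (cabsD _ _) _; rewrite cabsM.
set V := cabs (v y - v x) in h2 h3 *; set U := cabs (u y - u x) in h1 *.
have hU : U <= (cabs m + 1) * V.
  rewrite /U -[u y - u x](subrK (m * (v y - v x))).
  by apply: le_trans (cabsD _ _) _; rewrite cabsM -/V; lra.
have -> : e * V = e / 2 * V + e / 2 * V by rewrite -mulrDl -splitr.
apply: lerD.
  apply: le_trans h1 _; have -> : e / 2 / (cabs m + 1) * U = e / 2 * (U / (cabs m + 1)) by ring.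
  by rewrite ler_wpM2l ?divr_ge0 ?(ltW e0)// ler_pdivrMr// mulrC.
apply: (@le_trans _ _ ((cabs l + 1) * cabs (u y - u x - m * (v y - v x)))).
  by rewrite ler_wpM2r ?cabs_ge0//; lra.
by rewrite mulrC -ler_pdivlMr// mulrAC.
Unshelve. all: by end_near.
Qed.

(** Near x the increment of u is at most 2 / |l| times that of F, so an error small compared with
    the one is small compared with the other. The roles of u and F are exchanged without
    constructing an inverse function. *)
Lemma lin_approx_inv u F x l : l != 0 -> lin_approx u F x l -> lin_approx F u x l^-1.
Proof.
rewrite -cabs_gt0 => l0 hF e e0.
have e1 : 0 < cabs l / 2 by rewrite divr_gt0.
have e2 : 0 < e * (cabs l * cabs l) / 2 by rewrite divr_gt0// !mulr_gt0.
apply: filterS2 (hF _ e1) (hF _ e2) => y h1 h2.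
have lN : l != 0 by rewrite -cabs_gt0.
set V := cabs (F y - F x); set U := cabs (u y - u x) in h1 h2.
have hU : cabs l * U <= 2 * V.
  have : cabs l * U <= cabs (F y - F x - l * (u y - u x)) + V.
    rewrite /U -cabsM cabsB; have := cabsD (l * (u y - u x) - (F y - F x)) (F y - F x).
    by rewrite subrK.
  by lra.
have -> : u y - u x - l^-1 * (F y - F x) = - l^-1 * (F y - F x - l * (u y - u x)) by field.
rewrite cabsM cabsN cabsV ler_pdivrMl//.
apply: le_trans h2 _.
have -> : e * (cabs l * cabs l) / 2 * U = e * cabs l / 2 * (cabs l * U) by ring.
have -> : cabs l * (e * V) = e * cabs l / 2 * (2 * V) by field.
by rewrite ler_wpM2l// divr_ge0// mulr_ge0// ltW.
Qed.

Lemma lin_approx_near u F G x l : (\forall y \near x, F y = G y) ->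
  lin_approx u F x l -> lin_approx u G x l.
Proof.
move=> FG h e e0; have Gx := nbhs_singleton FG.
by apply: filterS2 FG (h e e0) => y <-; rewrite -Gx.
Qed.

End OneSpace.

Lemma lin_approx_comp (X Y : topologicalType) (u F : X -> C) (g : Y -> X) y l :
  {for y, continuous g} -> lin_approx u F (g y) l -> lin_approx (u \o g) (F \o g) y l.
Proof. by move=> cg h e e0; exact: (cg _ (h e e0)). Qed.

Lemma separates_id (z : C) : separates id z. Proof. by near=> y. Unshelve. all: by end_near. Qed.

Lemma separates_rcplx (t : R) : separates (@rcplx R) t.
Proof. by near=> y; move=> yt /rcplx_inj. Unshelve. all: by end_near. Qed.

(** A plane curve has no mean value point. The real mean value theorem is applied to its scalar
    product p with the total increment v, and Cauchy-Schwarz gives back the modulus. *)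
Lemma curve_mvt (K K' : R -> C) (a b M : R) : a <= b ->
  (forall t, a <= t <= b -> lin_approx (@rcplx R) K t (K' t)) ->
  (forall t, a <= t <= b -> cabs (K' t) <= M) ->
  cabs (K b - K a) <= M * (b - a).
Proof.
move=> ab hK hM.
set v := K b - K a.
pose p (w : C) : R := complex.Re v * complex.Re w + complex.Im v * complex.Im w.
have pB w w' : p w - p w' = p (w - w') by rewrite /p ReB ImB; ring.
have pZ t w : p (w * rcplx t) = p w * t by rewrite /p (mulrC w) ReZ ImZ; ring.
have pvv : p v = cabs v ^+ 2.
  by rewrite /cabs sqr_sqrtr ?addr_ge0 ?sqr_ge0// /p !expr2.
have pM w : `|p w| <= 2 * cabs v * cabs w.
  apply: le_trans (ler_normD _ _) _; rewrite !normrM mulrDl mul1r mulrDl.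
  by apply: lerD; apply: ler_pM; rewrite ?normr_ge0 ?Re_le_cabs ?Im_le_cabs.
have pCS w : p w <= cabs v * cabs w.
  have h0 : 0 <= cabs v * cabs w by rewrite mulr_ge0 ?cabs_ge0.
  rewrite real_leNgt ?num_real//; apply/negP => h.
  have : (cabs v * cabs w) ^+ 2 < p w ^+ 2 by rewrite ltr_sqr ?nnegrE// ltW// (le_lt_trans h0).
  rewrite exprMn /cabs !sqr_sqrtr ?addr_ge0 ?sqr_ge0// /p.
  set A := complex.Re v; set B := complex.Im v; set D := complex.Re w; set E := complex.Im w.
  have : 0 <= (A * E - B * D) ^+ 2 by exact: sqr_ge0.
  nra.
have kd (t : R) : a <= t <= b -> is_derive t 1 (p \o K) (p (K' t)).
  move=> tab.
  suff : h^-1 *: (((p \o K) \o shift t) (h *: (1 : R)) - (p \o K) t) @[h --> (0 : R)^'] --> p (K' t).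
    by move=> h; apply: DeriveDef; [apply: cvgP h|apply: (cvg_lim _ h)].
  apply/cvgrPdist_le => e e0.
  have e1 : 0 < e / (2 * cabs v + 1).
    by rewrite divr_gt0// ltr_wpDl// mulr_ge0// cabs_ge0.
  have := hK t tab _ e1 => /nbhs_ballP[d d0 hd].
  rewrite /dnbhs near_withinE; apply/nbhs_ballP; exists d => // h.
  rewrite -ball_normE /= sub0r normrN => hd' h0.
  have := hd (h + t); rewrite -ball_normE /= opprD addrCA subrr addr0 normrN => /(_ hd').
  rewrite -rcplxB addrK cabs_rcplx => hh.
  have -> : h *: (1 : R) = h by rewrite /GRing.scale /= mulr1.
  rewrite /= -[p (K' t)](mulKf h0) -[h^-1 *: _]/(h^-1 * _) -mulrBr pB normrM normfV.
  rewrite ler_pdivrMl ?normr_gt0// (mulrC h) -pZ pB.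
  apply: le_trans (pM _) _; rewrite cabsB.
  have P1 : 0 < 2 * cabs v + 1 by rewrite ltr_wpDl// mulr_ge0// cabs_ge0.
  apply: (@le_trans _ _ ((2 * cabs v + 1) * cabs (K (h + t) - K t - K' t * rcplx h))).
    by rewrite ler_wpM2r ?cabs_ge0//; lra.
  by rewrite mulrC -ler_pdivlMr// (mulrC `|h|) mulrAC.
have [c cab E0] : exists2 c, c \in `[a, b]%R & (p \o K) b - (p \o K) a = p (K' c) * (b - a).
  apply: (MVT_segment ab) => [x|].
    by rewrite in_itv /= => /andP[h1 h2]; apply: kd; rewrite !ltW.
  by apply: derivable_within_continuous => x; rewrite in_itv /= => /kd[].
have E : cabs v ^+ 2 = p (K' c) * (b - a) by rewrite -pvv /v -pB.
move: cab; rewrite in_itv /= => cab.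
have [v0|v0] := eqVneq (cabs v) 0.
  by rewrite v0 mulr_ge0 ?subr_ge0// (le_trans _ (hM c cab))// cabs_ge0.
have vp : 0 < cabs v by rewrite lt_def v0 cabs_ge0.
rewrite -(ler_pM2l vp) -expr2 E mulrA ler_wpM2r ?subr_ge0//.
by apply: le_trans (pCS _) _; rewrite ler_wpM2l ?(ltW vp)//; exact: hM.
Qed.

(** The previous inequality on the segment from w to z, for g minus the linear map of slope l. *)
Lemma disc_mvt (g g' : C -> C) (a l : C) (rho e : R) :
  (forall z, disc a rho z -> lin_approx id g z (g' z)) ->
  (forall z, disc a rho z -> cabs (g' z - l) <= e) ->
  forall z w, disc a rho z -> disc a rho w ->
  cabs (g z - g w - l * (z - w)) <= e * cabs (z - w).
Proof.
move=> hg he z w Dz Dw.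
pose ga t := w + rcplx t * (z - w).
have gaD t : 0 <= t <= 1 -> disc a rho (ga t) by move=> t01; exact: convexC_disc.
pose K t := g (ga t) - l * ga t.
have := @curve_mvt K (fun t => (g' (ga t) - l) * (z - w)) 0 1 (e * cabs (z - w)) ler01.
have -> : K 1 - K 0 = g z - g w - l * (z - w).
  have g1 : ga 1 = z by rewrite /ga (_ : rcplx 1 = 1 :> C)// mul1r addrC subrK.
  have g0 : ga 0 = w by rewrite /ga (_ : rcplx 0 = 0 :> C)// mul0r addr0.
  rewrite /K g1 g0; ring.
rewrite subr0 mulr1; apply=> t t01; last first.
  by rewrite cabsM ler_wpM2r ?cabs_ge0//; apply: he; exact: gaD.
rewrite mulrC.
rewrite mulrC; apply: (@lin_approx_trans _ ga).
  apply: lin_approxD.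
    by apply: (@lin_approx_comp _ _ id g ga t _ _ (hg _ (gaD t t01))); exact: line_continuous.
  rewrite -mulrN1; have := @lin_approxZ _ ga (fun y => l * ga y) t (l * 1) (-1).
  rewrite mulN1r mulr1 mulrN1 => h.
  have : lin_approx ga (fun y => -1 * (l * ga y)) t (- l).
    by apply: h; rewrite -[X in lin_approx _ _ _ X]mulr1; apply: lin_approxZ; exact: lin_approx_id.
  by under eq_fun do rewrite mulN1r.
have : lin_approx (@rcplx R) (fun y => (z - w) * rcplx y) t ((z - w) * 1) by apply: lin_approxZ; exact: lin_approx_id.
move=> h; have := lin_approxD (lin_approx_cst (@rcplx R) w t) h.
rewrite add0r mulr1; under eq_fun do rewrite mulrC -/(ga _).
by [].
Qed.

End LinApprox.

(** * Local inversion of a map with nearly constant derivative *)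

Section LocalInverse.
Variable R : realType.
Local Notation C := (cplx R).
Implicit Types (a z w l : C) (e rho delta : R).

Lemma continuousD_cplx (X : topologicalType) (F G : X -> C) (x : X) :
  {for x, continuous F} -> {for x, continuous G} ->
  {for x, continuous (fun y => F y + G y)}.
Proof. exact: (@continuousD _ _ _ F G). Qed.

Lemma continuousM_cplx (X : topologicalType) (F G : X -> C) (x : X) :
  {for x, continuous F} -> {for x, continuous G} ->
  {for x, continuous (fun y => F y * G y)}.
Proof. exact: (@continuousM _ _ F G). Qed.

Lemma continuousX_cplx (X : topologicalType) (F : X -> C) (x : X) n :
  {for x, continuous F} -> {for x, continuous (fun y => F y ^+ n)}.
Proof.
move=> cF; elim: n => [|n IH]; first exact: cst_continuous.
rewrite (_ : (fun y => F y ^+ n.+1) = (fun y => F y * F y ^+ n)); first exact: continuousM_cplx.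
by apply/funext => y; rewrite exprS.
Qed.

Lemma cplx_ReIm_sub z a :
  a + rcplx (complex.Re (z - a)) + 'i%C * rcplx (complex.Im (z - a)) = z.
Proof. by case: z; case: a => a b c d; apply: ReIm_inj => /=; ring. Qed.

Lemma compact_cdisc a e : compact [set z : C | cabs (z - a) <= e].
Proof.
pose g (p : R * R) : C := a + rcplx p.1 + 'i%C * rcplx p.2.
have cg : continuous g.
  move=> p; apply: (@continuousD_cplx _ (fun p => a + rcplx p.1) (fun p => 'i%C * rcplx p.2)).
    apply: (@continuousD_cplx _ (fun=> a) (fun p : R * R => rcplx p.1)); first exact: cst_continuous.
    by apply: continuous_comp; [exact: cvg_fst|exact: rcplx_continuous].
  apply: (@continuousM_cplx _ (fun=> 'i%C) (fun p : R * R => rcplx p.2)); first exact: cst_continuous.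
  by apply: continuous_comp; [exact: cvg_snd|exact: rcplx_continuous].
apply: (@subclosed_compact _ _ (g @` (`[-e, e] `*` `[-e, e]))).
- rewrite (_ : [set z | _] = (fun z => cabs (z - a)) @^-1` [set x | x <= e])//.
  apply: closed_comp; last exact: closed_le.
  move=> z _; apply: continuous_comp; last exact: cabs_continuous.
  by apply: (@continuousD_cplx _ id); last exact: cst_continuous.
- apply: continuous_compact; first by apply: continuous_subspaceT.
  by apply: compact_setX; exact: segment_compact.
move=> z /= za; exists (complex.Re (z - a), complex.Im (z - a)).
  split => /=; rewrite in_itv /= -ler_norml; apply: le_trans za.
    exact: Re_le_cabs.
  exact: Im_le_cabs.
exact: cplx_ReIm_sub.
Qed.

Section Plane.
Variables (g g' : C -> C) (a l : C) (rho : R).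
Hypotheses (l0 : l != 0) (rho0 : 0 < rho).
Hypothesis dg : forall z, disc a rho z -> lin_approx id g z (g' z).
Hypothesis g'l : forall z, disc a rho z -> cabs (g' z - l) <= cabs l / 2.

Lemma expansive z w : disc a rho z -> disc a rho w ->
  cabs l / 2 * cabs (z - w) <= cabs (g z - g w).
Proof.
move=> Dz Dw; have := disc_mvt dg g'l Dz Dw.
have := cabsD (l * (z - w) - (g z - g w)) (g z - g w).
rewrite subrK cabsM (cabsB (l * _)); lra.
Qed.

Lemma expansive_inj z w : disc a rho z -> disc a rho w -> g z = g w -> z = w.
Proof.
move=> Dz Dw gzw; have := expansive Dz Dw; rewrite gzw subrr cabs0 => h.
have lp : 0 < cabs l / 2 by rewrite divr_gt0// cabs_gt0.
apply/eqP; rewrite -subr_eq0 -cabs_eq0 eq_le cabs_ge0 andbT.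
by rewrite -(pmulr_rle0 _ lp).
Qed.

(** The error |g - y| is minimised on the closed disc of radius delta. On the bounding circle g is
    at least |l| delta / 2 away from g a, so the error there exceeds its value at the centre: this
    is the origin of the constant 4. At an interior minimiser with nonzero error E, a damped Newton
    step along -E / l would lower the error. *)
Lemma disc_image_surj delta y : 0 < delta < rho ->
  cabs (y - g a) < cabs l * delta / 4 -> exists2 z, disc a delta z & g z = y.
Proof.
move=> /andP[d0 dr] hy; pose K := [set z : C | cabs (z - a) <= delta].
have lp : 0 < cabs l by rewrite cabs_gt0.
have KD z : K z -> disc a rho z by move=> /le_lt_trans; apply.
have Ka : K a by rewrite /K /= subrr cabs0 ltW.
have Da : disc a rho a by exact: KD.
have cg : {within K, continuous (fun z => cabs (g z - y))}.
  apply: continuous_in_subspaceT => z; rewrite inE => /KD Dz.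
  apply: continuous_comp; last exact: cabs_continuous.
  apply: (@continuousD_cplx _ g); last exact: cst_continuous.
  by apply: lin_approx_continuous (dg Dz) _.
have [z] := compact_EVT_min (ex_intro _ a Ka) (@compact_cdisc a delta) cg.
rewrite inE => Kz zmin; have Dz := KD z Kz.
have za : disc a delta z.
  have h1 := zmin a; rewrite inE in h1; have {h1} h1 := h1 Ka.
  have h2 := expansive Dz Da.
  rewrite /disc /=; rewrite (cabsB y) in hy; rewrite ltNge; apply/negP => hd.
  have : cabs l / 2 * delta <= cabs l / 2 * cabs (z - a) by rewrite ler_wpM2l// divr_ge0 ?cabs_ge0.
  have h3 := cabs_sub_le (g z) (g a) y; rewrite (cabsB y) in h3.
  lra.
exists z => //; apply/eqP; rewrite -subr_eq0 -cabs_eq0; apply/negPn/negP => ne.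
set E := g z - y in ne.
have Ep : 0 < cabs E by rewrite lt_def ne cabs_ge0.
(* The damping keeps the new point in the closed disc. The new error is at most (1 - t / 2) times
   the old one. *)
pose t : R := Num.min 1 ((delta - cabs (z - a)) * cabs l / cabs E).
have t0 : 0 < t by rewrite lt_min ltr01 divr_gt0// mulr_gt0// subr_gt0.
have t1 : t <= 1 by rewrite ge_min lexx.
have tE : t * cabs E / cabs l <= delta - cabs (z - a).
  rewrite ler_pdivrMr// -ler_pdivlMr//; by rewrite ge_min lexx orbT.
pose z' := z - rcplx t * (E / l).
have dzz : cabs (z' - z) = t * cabs E / cabs l.
  rewrite /z' addrAC subrr add0r cabsN !cabsM cabsV cabs_rcplx ger0_norm ?ltW//; ring.
have Kz' : K z'.
  by rewrite /K /=; have := cabs_sub_le z' a z; rewrite dzz; lra.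
have h := zmin z'; rewrite inE in h; have {h} := h Kz'.
have := disc_mvt dg g'l (KD _ Kz') Dz; rewrite dzz.
have -> : l * (z' - z) = - (rcplx t * E).
  by rewrite /z' addrAC subrr add0r; field.
rewrite opprK => h1.
have : cabs (g z' - y) <= cabs (g z' - g z + rcplx t * E) + cabs (rcplx (1 - t) * E).
  apply: le_trans (cabsD _ _); rewrite rcplxB (_ : rcplx 1 = 1 :> C)// /E.
  by rewrite le_eqVlt; apply/orP; left; apply/eqP; congr cabs; ring.
rewrite cabsM cabs_rcplx ger0_norm; last by lra.
rewrite -/E => h2 h3.
have h4 : cabs l / 2 * (t * cabs E / cabs l) = t * cabs E / 2 by field; rewrite gt_eqF.
rewrite h4 in h1; have : 0 < t * cabs E by rewrite mulr_gt0.
lra.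
Qed.

Lemma plane_inverse : exists delta e (h : C -> C),
  [/\ 0 < delta < rho, 0 < e,
      forall w, disc (g a) e w -> [/\ disc a delta (h w), g (h w) = w & {for w, continuous h}] &
      forall z, disc a delta z -> disc (g a) e (g z) -> h (g z) = z].
Proof.
have lp : 0 < cabs l by rewrite cabs_gt0.
pose delta := rho / 2; have dr : 0 < delta < rho by move: rho0; rewrite /delta; lra.
have DD : disc a delta `<=` disc a rho by apply: disc_subset; rewrite /delta; lra.
pose e := cabs l * delta / 4; have e0 : 0 < e by rewrite divr_gt0// mulr_gt0//; case/andP: dr.
pose h w := xget a [set z | disc a delta z /\ g z = w].
have hP w : disc (g a) e w -> disc a delta (h w) /\ g (h w) = w.
  move=> we; rewrite /h; case: xgetP => [y _ //|].
  by have [z Dz gz] := disc_image_surj dr we => /(_ z)[].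
exists delta, e, h; split => // [w we|z Dz gz]; last first.
  by have [Dh gh] := hP _ gz; apply: expansive_inj => //; exact: DD.
have [Dh gh] := hP w we; split => //; apply: continuous_for_cabs => b b0.
have ow : nbhs w (disc (g a) e) by apply: open_nbhs_nbhs; split => //; exact: open_disc.
have c0 : 0 < cabs l / 2 * b by rewrite mulr_gt0// divr_gt0.
apply: filterS2 ow (nbhs_disc w c0) => w' we' ww'.
have [Dh' gh'] := hP w' we'.
have := expansive (DD _ Dh') (DD _ Dh); rewrite gh gh' => ex.
have := le_lt_trans ex ww'; rewrite ltr_pM2l// divr_gt0//.
Qed.

End Plane.
End LocalInverse.

(** * Extracting a cube root at a triple zero *)

Section CubeRoot.
Variable R : realType.
Local Notation C := (cplx R).
Implicit Types (z w l : C) (e rho delta : R).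

Lemma cplx_root z m : (0 < m)%N -> exists w : C, w ^+ m = z.
Proof. by move=> m0; exists (m.-root (z : R[i])); rewrite rootCK. Qed.

Lemma continuousV_cplx (X : topologicalType) (F : X -> C) (x : X) :
  F x != 0 -> {for x, continuous F} -> {for x, continuous (fun y => (F y)^-1)}.
Proof. exact: (@continuousV _ _ F). Qed.

Lemma lin_approx_id_continuous (g : C -> C) z l : lin_approx id g z l -> {for z, continuous g}.
Proof. by move=> h; apply: lin_approx_continuous h _; exact: cvg_id. Qed.

Lemma lin_approx_cube z : lin_approx id (fun w : C => w ^+ 3) z (3 * z ^+ 2).
Proof.
move=> e e0; set M := 3 * cabs z + 1.
have M0 : 0 < M by rewrite ltr_wpDl// mulr_ge0// cabs_ge0.
have d0 : 0 < Num.min 1 (e / M) by rewrite lt_min ltr01 divr_gt0.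
apply: filterS (nbhs_disc z d0) => w; rewrite /disc /= lt_min => /andP[h1 h2].
have -> : w ^+ 3 - z ^+ 3 - 3 * z ^+ 2 * (w - z) = ((w - z) + 3 * z) * (w - z) * (w - z) by ring.
rewrite !cabsM ler_wpM2r ?cabs_ge0//.
have c3 : cabs (3 * z) = 3 * cabs z.
  by rewrite cabsM; congr (_ * _); rewrite -[3](rmorph_nat (@real_complex R)) -/(rcplx _) cabs_rcplx ger0_norm.
apply: (@le_trans _ _ (M * cabs (w - z))).
  by rewrite ler_wpM2r ?cabs_ge0//; have := cabsD (w - z) (3 * z); rewrite c3 /M; lra.
by rewrite mulrC -ler_pdivlMr// ltW.
Qed.

(** Continuity selects the branch; the derivative then follows from that of the cube, inverted where
    phi does not vanish. *)
Lemma lin_approx_cube_root (phi g : C -> C) z d : {for z, continuous phi} ->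
  (\forall w \near z, phi w ^+ 3 = g w) -> phi z != 0 -> lin_approx id g z d ->
  lin_approx id phi z ((3 * phi z ^+ 2)^-1 * d).
Proof.
move=> cphi pg p0 dg.
have n0 : 3 * phi z ^+ 2 != 0 by rewrite mulf_neq0 ?expf_neq0// pnatr_eq0.
have h : lin_approx phi (fun w => phi w ^+ 3) z (3 * phi z ^+ 2).
  exact: (@lin_approx_comp _ _ _ id (fun w => w ^+ 3) phi z _ cphi (lin_approx_cube (phi z))).
exact: lin_approx_trans (lin_approx_inv n0 (lin_approx_near pg h)) dg.
Qed.

Lemma cube_root_branch (k0 K : C) : k0 != 0 -> k0 ^+ 3 = K -> exists e (kap : C -> C),
  [/\ 0 < e, kap K = k0 &
   forall w, disc K e w -> kap w ^+ 3 = w /\ {for w, continuous kap}].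
Proof.
move=> k00 <-; pose l := 3 * k0 ^+ 2.
have l0 : l != 0 by rewrite mulf_neq0 ?expf_neq0// pnatr_eq0.
have l2 : 0 < cabs l / 2 by rewrite divr_gt0// cabs_gt0.
have cd : {for k0, continuous (fun w : C => 3 * w ^+ 2)}.
  apply: (@continuousM_cplx _ _ (fun=> 3)); first exact: cst_continuous.
  exact: (@continuousX_cplx _ _ id).
have /nbhs_discP[rho rho0 hr] := near_cabs cd l2.
have [||delta [e [h [/andP[d0 dr] e0 hw hz]]]] := @plane_inverse R (fun w => w ^+ 3) (fun w => 3 * w ^+ 2) k0 l rho l0 rho0.
- by move=> z _; exact: lin_approx_cube.
- by move=> z /hr /ltW.
exists e, h; split; first exact: e0.
  exact: (hz k0 (disc_center k0 d0) (disc_center (k0 ^+ 3) e0)).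
by move=> w we; have [_ h1 h2] := hw w we; split; [exact: h1|exact: h2].
Qed.

(** A triple zero without power series. A mean value estimate shows that [g z / z ^+ 3] tends to
    [K = h 0 / 3]; composing with a branch of the cube root near K gives [phi z = z * kap (Q z)]. At
    0 its derivative is read off from the continuity of [kap] and [Q], elsewhere from phi being a
    cube root of g, and it stays close to [k0], which is the form required by [plane_inverse]. *)
Lemma cube_coordinate (g h : C -> C) rho : 0 < rho -> g 0 = 0 ->
  (forall z, disc 0 rho z -> lin_approx id g z (z ^+ 2 * h z)) ->
  {for 0, continuous h} -> h 0 != 0 ->
  exists rho' (phi phi' : C -> C) l,
   [/\ 0 < rho' <= rho, l != 0, phi 0 = 0 &
    forall z, disc 0 rho' z ->
      [/\ lin_approx id phi z (phi' z), cabs (phi' z - l) <= cabs l / 2 & g z = phi z ^+ 3]].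
Proof.
move=> rho0 g0 dg ch h0.
have n3 : (3 : C) != 0 by rewrite pnatr_eq0.
have [K KE] : exists K, K = h 0 / 3 by exists (h 0 / 3).
have [k0 k0E] := cplx_root K (isT : 0 < 3)%N.
have K0 : K != 0 by rewrite KE mulf_neq0// invr_eq0.
have k00 : k0 != 0.
  by apply: contraNneq K0 => k00; rewrite -k0E k00 expr0n.
have [e1 [kap [e10 kap0 kapP]]] := cube_root_branch k00 k0E.
have est e : 0 < e -> \forall z \near (0 : C), cabs (g z - K * z ^+ 3) <= e * cabs z ^+ 3.
  move=> e0; have e4 : 0 < e / 4 by rewrite divr_gt0.
  have /nbhs_discP[r r0 hr] := near_cabs ch e4.
  have m0 : 0 < Num.min r rho / 2 by rewrite divr_gt0// lt_min r0.
  apply: filterS (nbhs_disc 0 m0) => z; rewrite /disc /= subr0 => zm.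
  have [->|z0] := eqVneq z 0; first by rewrite g0 !expr0n !mulr0 subrr cabs0 expr0n /= mulr0.
  have zp : 0 < cabs z by rewrite cabs_gt0.
  have D2 w : disc 0 (2 * cabs z) w -> disc 0 r w /\ disc 0 rho w.
    rewrite /disc /= => wz; have : cabs (w - 0) < Num.min r rho by lra.
    by rewrite lt_min => /andP[].
  (* On the disc of radius 2 |z|, which contains 0 and z, the derivative of G is w^2 (h w - h 0), at
     most (2 |z|)^2 (e / 4) = e |z|^2. *)
  pose G w := g w + (- K) * w ^+ 3.
  have H1 w : disc 0 (2 * cabs z) w -> lin_approx id G w (w ^+ 2 * (h w - h 0)).
    move=> /D2[_ /dg dw].
    have -> : w ^+ 2 * (h w - h 0) = w ^+ 2 * h w + (- K) * (3 * w ^+ 2) by rewrite KE; field.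
    by apply: lin_approxD => //; apply: lin_approxZ; exact: lin_approx_cube.
  have H2 w : disc 0 (2 * cabs z) w -> cabs (w ^+ 2 * (h w - h 0) - 0) <= e * cabs z ^+ 2.
    move=> Dw; have [/hr /= hw _] := D2 w Dw; rewrite subr0 cabsM cabsX.
    move: Dw; rewrite /disc /= subr0 => Dw.
    have -> : e * cabs z ^+ 2 = (2 * cabs z) ^+ 2 * (e / 4) by field.
    apply: ler_pM; rewrite ?exprn_ge0 ?cabs_ge0 ?(ltW hw)//.
    by rewrite lerXn2r ?nnegrE ?cabs_ge0 ?mulr_ge0 ?cabs_ge0 ?(ltW Dw).
  have H3 : disc 0 (2 * cabs z) z by rewrite /disc /= subr0; lra.
  have H4 : disc (0 : C) (2 * cabs z) 0 by apply: disc_center; lra.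
  have := disc_mvt H1 H2 H3 H4.
  by rewrite /G g0 expr0n /= mulr0 addr0 mul0r !subr0 mulNr -mulrA -exprSr.
pose Q z := if z == 0 then K else g z / z ^+ 3.
have Qd z b : 0 < b -> cabs (g z - K * z ^+ 3) <= b * cabs z ^+ 3 -> cabs (Q z - K) <= b.
  move=> b0; rewrite /Q; case: eqVneq => [_ _|z0]; first by rewrite subrr cabs0 ltW.
  by rewrite -cabsX -cabs_lin_quot// expf_neq0.
have cQ : {for 0, continuous Q}.
  apply: continuous_for_cabs => e e0; have e2 : 0 < e / 2 by rewrite divr_gt0.
  apply: filterS (est _ e2) => z hz; rewrite {2}/Q eqxx.
  by have := Qd z _ e2 hz; lra.
have Q0 : Q 0 = K by rewrite /Q eqxx.
pose phi z := z * kap (Q z).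
have ck : {for 0, continuous (fun z => kap (Q z))}.
  have cK : {for Q 0, continuous kap} by rewrite Q0; exact: (proj2 (kapP _ (disc_center K e10))).
  exact: (@continuous_comp _ _ _ Q kap 0 cQ cK).
(* The derivative of phi away from 0 after cancelling [z ^+ 2]; in this form it is continuous at
   0. *)
pose psi z := h z * (3 * kap (Q z) ^+ 2)^-1.
have kk0 : 3 * k0 ^+ 2 != 0 by rewrite mulf_neq0 ?expf_neq0.
have psi0 : psi 0 = k0 by rewrite /psi Q0 kap0 -[h 0](divfK n3) -KE -k0E; field.
have c1 : {for 0, continuous (fun z => 3 * kap (Q z) ^+ 2)}.
  apply: (@continuousM_cplx _ _ (fun=> 3) (fun z => kap (Q z) ^+ 2) 0); first exact: cst_continuous.
  exact: (@continuousX_cplx _ _ (fun z => kap (Q z)) 0 2 ck).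
have n1 : 3 * kap (Q 0) ^+ 2 != 0 by rewrite Q0 kap0.
have c2 : {for 0, continuous (fun z => (3 * kap (Q z) ^+ 2)^-1)} 
  := @continuousV_cplx _ (fun z => 3 * kap (Q z) ^+ 2) 0 n1 c1.
have cpsi : {for 0, continuous psi} 
  := @continuousM_cplx _ _ h (fun z => (3 * kap (Q z) ^+ 2)^-1) 0 ch c2.
have k3 : 0 < cabs K by rewrite cabs_gt0.
have k2 : 0 < cabs k0 / 2 by rewrite divr_gt0// cabs_gt0.
have /nbhs_discP[r r0 hr] : \forall z \near (0 : C),
    [/\ disc K e1 (Q z), cabs (Q z - K) < cabs K & cabs (psi z - k0) < cabs k0 / 2].
  have h1 := near_cabs cQ e10; have h2 := near_cabs cQ k3; have h3 := near_cabs cpsi k2.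
  rewrite Q0 psi0 in h1 h2 h3; apply: filterS3 h1 h2 h3 => z; exact: And3.
pose rho' := Num.min r rho.
have D z : disc 0 rho' z -> disc 0 r z /\ disc 0 rho z by rewrite /disc /= lt_min => /andP.
pose phi' z := if z == 0 then k0 else (3 * phi z ^+ 2)^-1 * (z ^+ 2 * h z).
exists rho', phi, phi', k0; split => //.
- by rewrite lt_min r0 rho0 ge_min lexx orbT.
- by rewrite /phi mul0r.
have cube z : disc 0 rho' z -> phi z ^+ 3 = g z.
  move=> /D[/hr[h1 h2 h3] _]; rewrite /phi exprMn; have [-> _] := kapP _ h1.
  rewrite /Q; case: eqVneq => [->|z0]; first by rewrite expr0n mul0r g0.
  by rewrite mulrC divfK// expf_neq0.
move=> z Dz; have [/hr[h1 h2 h3] zrho] := D _ Dz.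
split; last by rewrite cube.
  rewrite /phi'; case: eqVneq => [->|z0].
    move=> e e0; apply: filterS (near_cabs ck e0) => w hw.
    rewrite /phi mul0r !subr0 mulrC -mulrBl cabsM.
    by rewrite ler_wpM2r ?cabs_ge0//; move: hw; rewrite Q0 kap0 => /ltW.
  have cQz : {for z, continuous Q}.
    have cg : {for z, continuous g} := lin_approx_id_continuous (dg z zrho).
    have c3 : {for z, continuous (fun w : C => w ^+ 3)} := lin_approx_id_continuous (lin_approx_cube z).
    have cq : {for z, continuous (fun w => g w * (w ^+ 3)^-1)}.
      exact: (@continuousM_cplx _ _ g (fun w => (w ^+ 3)^-1) z cg (@continuousV_cplx _ (fun w => w ^+ 3) z (expf_neq0 3 z0) c3)).
    have zQ : \forall w \near z, g w * (w ^+ 3)^-1 = Q w.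
      have zp : 0 < cabs z by rewrite cabs_gt0.
      apply: filterS (nbhs_disc z zp) => w; rewrite /Q; case: eqVneq => // ->.
      by rewrite /disc /= sub0r cabsN ltxx.
    apply: continuous_for_cabs => b b0.
    have zQ0 : g z * (z ^+ 3)^-1 = Q z := nbhs_singleton zQ.
    apply: filterS2 zQ (near_cabs cq b0) => w wQ; by rewrite wQ zQ0.
  have [k3Q ckz] := kapP _ h1.
  apply: (@lin_approx_cube_root phi g z (z ^+ 2 * h z)).
  - apply: (@continuousM_cplx _ _ id (fun z => kap (Q z)) z); first exact: cvg_id.
    exact: (@continuous_comp _ _ _ Q kap z cQz ckz).
  - by apply: filterS (open_nbhs_nbhs (conj (@open_disc R 0 rho') Dz)) => w; exact: cube.
  - rewrite mulf_neq0//; apply: contraTneq h2 => k0'; move: k3Q; rewrite k0' expr0n /= => <-.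
    by rewrite sub0r cabsN ltxx.
  - exact: dg.
rewrite /phi'; case: eqVneq => [_|z0]; first by rewrite subrr cabs0 ltW.
suff -> : (3 * phi z ^+ 2)^-1 * (z ^+ 2 * h z) = psi z by exact: ltW.
rewrite /phi /psi exprMn; have [->|kz] := eqVneq (kap (Q z)) 0.
  by rewrite expr0n /= !mulr0 invr0 mul0r mulr0.
by field; rewrite z0 kz.
Qed.

End CubeRoot.

(** * Local coordinates in which the map to the torus is a power *)

Section ChartInverse.
Variable R : realType.
Local Notation C := (cplx R).

Lemma lin_approx_eqdiff (X : topologicalType) (u v F G : X -> C) x l :
  (\forall y \near x, u y - u x = v y - v x /\ F y - F x = G y - G x) ->
  lin_approx u F x l -> lin_approx v G x l.
Proof. by move=> h H e e0; apply: filterS2 h (H e e0) => y [<- <-]. Qed.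

Lemma continuous_sub_cst (X : topologicalType) (F : X -> C) (a : C) (x : X) :
  {for x, continuous F} -> {for x, continuous (fun y => F y - a)}.
Proof.
by move=> cF; apply: (@continuousD_cplx _ _ F (fun=> - a) x cF); exact: cst_continuous.
Qed.

Lemma chart_inverse (S : topologicalType) (c : chart R S) (q : S) (O : set S) :
  is_chart c -> dom c q -> open O -> O q -> exists rho (kap : C -> S),
  [/\ 0 < rho, kap 0 = q,
     (forall z, disc 0 rho z -> [/\ dom c (kap z), O (kap z),
        coord c (kap z) - coord c q = z & {for z, continuous kap}]) &
     forall x, dom c x -> disc 0 rho (coord c x - coord c q) ->
        kap (coord c x - coord c q) = x].
Proof.
move=> [oc cc ic oi] cq oO Oq.
have im W : open W -> W `<=` dom c -> forall x, W x ->
    exists2 e : R, 0 < e & disc (coord c x) e `<=` coord c @` W.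
  move=> oW Wc x Wx; apply/nbhs_discP; apply: open_nbhs_nbhs; split; first exact: oi.
  by exists x.
have [rho rho0 hr] : exists2 e : R, 0 < e & disc (coord c q) e `<=` coord c @` (O `&` dom c).
  apply: im; [exact: openI|by move=> x []|by []].
pose kap z := xget q [set x | dom c x /\ coord c x - coord c q = z].
have kK x : dom c x -> kap (coord c x - coord c q) = x.
  move=> cx; rewrite /kap; case: xgetP => [y _ [cy]|/(_ x) []//].
  by move/subIr => /ic; apply.
have kP z : disc 0 rho z -> [/\ dom c (kap z), O (kap z) & coord c (kap z) - coord c q = z].
  move=> zr; have [x [Ox cx] xz] : (coord c @` (O `&` dom c)) (coord c q + z).
    by apply: hr; move: zr; rewrite /disc /= subr0 addrAC subrr add0r.
  have -> : z = coord c x - coord c q by rewrite xz addrAC subrr add0r.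
  by rewrite kK.
exists rho, kap; split => //.
- by rewrite -(subrr (coord c q)) kK.
- move=> z zr; have [cz Oz zE] := kP z zr; split => // A kA.
  have : nbhs (kap z) A by [].
  rewrite nbhsE => -[W [oW Wz] WA].
  have [e e0 he] : exists2 e : R, 0 < e & disc (coord c (kap z)) e `<=` coord c @` (W `&` dom c).
    apply: im; [exact: openI|by move=> x []|by []].
  suff : nbhs z (kap @^-1` A) by [].
  apply: filterS (nbhs_disc z e0) => w wz; apply: WA.
  have [x [Wx cx] xw] : (coord c @` (W `&` dom c)) (coord c q + w).
    apply: he; rewrite /disc /=.
    have -> : coord c q + w - coord c (kap z) = w - z by rewrite -[in RHS]zE; ring.
    exact: wz.
  have -> : w = coord c x - coord c q by rewrite xw addrAC subrr add0r.
  by rewrite kK.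
by move=> x cx _; exact: kK.
Qed.

Lemma separates_chart (S : topologicalType) (c : chart R S) (x : S) :
  is_chart c -> dom c x -> separates (coord c) x.
Proof.
move=> [oc _ ic _] cx; apply: filterS (open_nbhs_nbhs (conj oc cx)) => y cy yx /ic yE.
by apply: yx; exact: yE.
Qed.

End ChartInverse.

(** [Phi] and [Psi] are inverse homeomorphisms between V and a disc, and f reads there as w going to
    z0 + w^m: m is the local degree of f at q. *)
Definition local_coordinate (R : realType) (S : topologicalType) (f : S -> torus R)
    (q : S) (m : nat) (V : set S) (Phi : S -> cplx R) (Psi : cplx R -> S) (e : R) (z0 : cplx R) :=
  [/\ 0 < e,
      open V /\ V q,
      forall x, V x -> [/\ disc 0 e (Phi x), Psi (Phi x) = x & {for x, continuous Phi}],
      forall w, disc 0 e w -> [/\ V (Psi w), Phi (Psi w) = w & {for w, continuous Psi}] &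
      Phi q = 0 /\ forall x, V x -> f x = torus_proj (z0 + Phi x ^+ m)].

Section LocalModel.
Variables (R : realType) (X : translationSurface R) (f : X -> torus R).
Local Notation C := (cplx R).
Local Notation omega := (ts_form X).
Hypothesis holf : holomorphic f.
Hypothesis pullf : is_pullback f (torus_dz R) omega.

Lemma coord_continuous (S : riemannSurface R) (c : chart R S) p : chart_at p c -> {for p, continuous (coord c)}.
Proof. by move=> [/atlas_chart[_ cc _ _] cp]; exact: cc. Qed.

Lemma lin_approx_pullback (x : X) c d : chart_at x c -> chart_at (f x) d ->
  lin_approx (coord c) (coord d \o f) x (coef omega c x).
Proof.
move=> xc xd; have [l lder ->] := pullf xc xd; rewrite /= mul1r.
by apply: deriv_lin_approx lder; case: xc => /atlas_chart; exact: separates_chart.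
Qed.

Lemma coef_continuous (x : X) c : chart_at x c -> {for x, continuous (coef omega c)}.
Proof.
move=> xc; have [l lder] := coef_holomorphic omega xc.
apply: lin_approx_continuous (coord_continuous xc).
by apply: deriv_lin_approx lder; case: xc => /atlas_chart; exact: separates_chart.
Qed.

(** The planar function phi is an m-th root of f read in charts. Its derivative stays close to l, so
    [plane_inverse] inverts it, and composing with the chart gives the coordinate. *)
Lemma local_coordinate_of_plane (q : X) c d m rho0 (kap : C -> X) :
  chart_at q c -> chart_at (f q) d -> (0 < m)%N -> 0 < rho0 ->
  (forall z, disc 0 rho0 z -> [/\ dom c (kap z), dom d (f (kap z)),
        coord c (kap z) - coord c q = z & {for z, continuous kap}]) ->
  (forall x, dom c x -> disc 0 rho0 (coord c x - coord c q) ->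
        kap (coord c x - coord c q) = x) ->
  forall rho' (phi phi' : C -> C) l,
  0 < rho' <= rho0 -> l != 0 -> phi 0 = 0 ->
  (forall z, disc 0 rho' z ->
     [/\ lin_approx id phi z (phi' z), cabs (phi' z - l) <= cabs l / 2 &
         coord d (f (kap z)) - coord d (f q) = phi z ^+ m]) ->
  exists V Phi Psi e, local_coordinate f q m V Phi Psi e (coord d (f q)) /\
    (forall x, V x -> [/\ dom c x, dom d (f x), disc 0 rho' (coord c x - coord c q) & Phi x = phi (coord c x - coord c q)]).
Proof.
move=> qc qd m0 rho00 kP kK rho' phi phi' l /andP[r0 rr] l0 phi0 hphi.
have D' : disc 0 rho' `<=` disc 0 rho0 by exact: disc_subset.
have [||delta [e [h [/andP[d0 dr] e0 hP hK]]]] := @plane_inverse R phi phi' 0 l rho' l0 r0.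
- by move=> z /hphi[].
- by move=> z /hphi[].
have Dd : disc 0 delta `<=` disc 0 rho' by apply: disc_subset; exact: ltW.
rewrite phi0 in hP hK.
pose zeta (x : X) := coord c x - coord c q.
have [oc cc _ _] := atlas_chart qc.1.
have czeta x : dom c x -> {for x, continuous zeta} by move=> cx; apply: continuous_sub_cst; exact: cc.
have cphi z : disc 0 rho' z -> {for z, continuous phi}.
  by move=> /hphi[h1 _ _]; apply: lin_approx_continuous h1 _.
pose V := [set x | [/\ dom c x, disc 0 delta (zeta x) & disc 0 e (phi (zeta x))]].
exists V, (phi \o zeta), (kap \o h), e; split; last first.
  move=> x [cx zx px]; have z0 := D' _ (Dd _ zx).
  by split => //; [have [_] := kP _ z0; rewrite kK|exact: Dd].
have cPhi x : V x -> {for x, continuous (phi \o zeta)}.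
  by move=> [cx zx _]; apply: continuous_comp; [exact: czeta|apply: cphi; exact: Dd].
split => //.
- split; last first.
    by split; [exact: qc.2|rewrite /zeta subrr; exact: disc_center|rewrite /zeta subrr phi0; exact: disc_center].
  rewrite openE => x Vx; have [cx zx px] := Vx; rewrite /interior /=.
  have h1 : nbhs x (dom c) by apply: open_nbhs_nbhs.
  have h2 : nbhs x (zeta @^-1` disc 0 delta).
    by apply: (czeta x cx); apply: open_nbhs_nbhs; split => //; exact: open_disc.
  have h3 : nbhs x ((phi \o zeta) @^-1` disc 0 e).
    by apply: (cPhi x Vx); apply: open_nbhs_nbhs; split => //; exact: open_disc.
  by apply: filterS3 h1 h2 h3 => y; exact: And3.
- move=> x Vx; have [cx zx px] := Vx; split => //; last exact: cPhi.
  by rewrite /= hK// kK//; apply/D'/Dd.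
- move=> w we; have [hw hE ch] := hP w we; have [h1 h2 h3 h4] := kP _ (D' _ (Dd _ hw)).
  by split; [split => //=; rewrite /zeta h3 ?hE|rewrite /= /zeta h3|apply: continuous_comp].
split; first by rewrite /= /zeta subrr.
move=> x [cx zx px]; have z0 := D' _ (Dd _ zx); have [_ _ E] := hphi _ (Dd _ zx).
have [_] := kP _ z0; rewrite kK// => dx _ _.
rewrite /= -E kK// addrC subrK; by have [] := qd; case=> _ sd; rewrite sd.
Qed.

Lemma chart_pair (q : X) c d : chart_at q c -> chart_at (f q) d ->
  exists rho (kap : C -> X),
  [/\ 0 < rho, kap 0 = q,
     (forall z, disc 0 rho z -> [/\ dom c (kap z), dom d (f (kap z)),
        coord c (kap z) - coord c q = z & {for z, continuous kap}]),
     (forall x, dom c x -> disc 0 rho (coord c x - coord c q) ->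
        kap (coord c x - coord c q) = x) &
     forall z, disc 0 rho z ->
       lin_approx id (fun z => coord d (f (kap z)) - coord d (f q)) z (coef omega c (kap z))].
Proof.
move=> qc qd; have cf : continuous f := holf.1.
have [od _ _ _] := atlas_chart qd.1.
have oO : open (f @^-1` dom d) by apply: open_comp => // x _; exact: cf.
have [rho [kap [r0 k0 kP kK]]] := chart_inverse (atlas_chart qc.1) qc.2 oO qd.2.
exists rho, kap; split => // z zr; have [h1 h2 h3 h4] := kP z zr.
have := lin_approx_comp h4 (lin_approx_pullback (conj qc.1 h1) (conj qd.1 h2)).
apply: lin_approx_eqdiff.
apply: filterS (open_nbhs_nbhs (conj (@open_disc R 0 rho) zr)) => w wr.
have [_ _ h5 _] := kP w wr; split; last by rewrite /=; ring.
by rewrite /= -[in RHS]h3 -[in RHS]h5; ring.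
Qed.

(** The coordinate is f itself read in a chart of the torus. Its derivative is the coefficient of
    the form because f pulls dz back to it; the second clause is what later differentiates curves
    drawn on the surface. *)
Lemma regular_coordinate (q : X) : ~ form_zero omega q ->
  exists V Phi Psi e z0, local_coordinate f q 1 V Phi Psi e z0 /\
   (forall x c, V x -> chart_at x c -> coef omega c x != 0 /\ lin_approx (coord c) Phi x (coef omega c x)).
Proof.
move=> nz; have [c ac cq] := atlas_cover q; have [d ad dq] := atlas_cover (f q).
have qc : chart_at q c by []. have qd : chart_at (f q) d by [].
have [rho [kap [r0 k0 kP kK dk]]] := chart_pair qc qd.
set l := coef omega c q.
have l0 : l != 0 by apply/eqP => l0; apply: nz; exists c.
have ck : {for 0, continuous (fun z => coef omega c (kap z))}.
  apply: continuous_comp; last by rewrite k0; exact: coef_continuous.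
  by have [] := kP _ (disc_center 0 r0).
have l2 : 0 < cabs l / 2 by rewrite divr_gt0// cabs_gt0.
have /nbhs_discP[r1 r10 hr1] := near_cabs ck l2; rewrite k0 -/l in hr1.
have rr : 0 < Num.min r1 rho <= rho by rewrite lt_min r10 r0 ge_min lexx orbT.
have Dm z : disc 0 (Num.min r1 rho) z -> disc 0 r1 z /\ disc 0 rho z by rewrite /disc /= lt_min => /andP.
have [] := @local_coordinate_of_plane q c d 1 rho kap qc qd isT r0 kP kK (Num.min r1 rho)
  (fun z => coord d (f (kap z)) - coord d (f q)) (fun z => coef omega c (kap z)) l rr l0.
- by rewrite k0 subrr.
- move=> z /Dm[z1 zr]; split; first exact: dk.
    by apply/ltW; exact: hr1.
  by rewrite expr1.
move=> V [Phi [Psi [e [lc hV]]]]; exists V, Phi, Psi, e, (coord d (f q)); split => // x c' Vx xc'.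
have [cx dx zx PE] := hV x Vx; have [z1 zr] := Dm _ zx.
have [h1 h2 h3 h4] := kP _ zr.
have xx := kK x cx zr.
have cx0 : coef omega c x != 0.
  have := hr1 _ z1; rewrite /= xx => h; apply: contraTneq h => ->.
  by rewrite sub0r cabsN -leNgt; have := cabs_ge0 l; lra.
split.
  have [m mder] := atlas_compat qc.1 xc'.1 cx xc'.2.
  apply: contraNneq cx0 => c'0; apply/eqP.
  by rewrite (coef_compat omega (conj qc.1 cx : chart_at x c) xc' mder) c'0 mul0r.
have := lin_approx_pullback xc' (conj qd.1 dx : chart_at (f x) d).
have [_ [oV _] _ _ _] := lc.
apply: lin_approx_eqdiff; apply: filterS (open_nbhs_nbhs (conj oV Vx)) => y Vy; split => //=.
have [cy dy zy ->] := hV y Vy; have [_ zyr] := Dm _ zy.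
by rewrite PE (kK _ cy zyr) xx; ring.
Qed.

(** Read in charts, f has derivative z^2 h with h nonzero at the zero of the form, exactly the input
    of [cube_coordinate]. *)
Lemma zero_coordinate (q : X) : form_zero_of_order omega q 2 ->
  exists V Phi Psi e z0, local_coordinate f q 3 V Phi Psi e z0.
Proof.
move=> [c [h [qc hol hq hE]]]; have [d ad dq] := atlas_cover (f q).
have qd : chart_at (f q) d by [].
have [rho [kap [r0 k0 kP kK dk]]] := chart_pair qc qd.
have ch : {for q, continuous h}.
  have [l lder] := nbhs_singleton hol.
  apply: lin_approx_continuous (coord_continuous qc).
  by apply: deriv_lin_approx lder; case: qc => /atlas_chart; exact: separates_chart.
have ck : {for 0, continuous kap} by have [] := kP _ (disc_center 0 r0).
have ck' : {for 0, continuous (fun z => h (kap z))}.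
  have chk : {for kap 0, continuous h} by rewrite k0; exact: ch.
  exact: (@continuous_comp _ _ _ kap h 0 ck chk).
have : nbhs (kap 0) [set x | coef omega c x = (coord c x - coord c q) ^+ 2 * h x] by rewrite k0.
move=> /ck /nbhs_discP[r1 r10 hr1].
have mr : 0 < Num.min r1 rho by rewrite lt_min r10.
have Dm z : disc 0 (Num.min r1 rho) z -> disc 0 r1 z /\ disc 0 rho z by rewrite /disc /= lt_min => /andP.
have [] := @cube_coordinate R (fun z => coord d (f (kap z)) - coord d (f q)) (fun z => h (kap z)) (Num.min r1 rho) mr.
- by rewrite k0 subrr.
- move=> z /Dm[z1 zr]; have := dk z zr; have := hr1 _ z1; rewrite /= => ->.
  by have [_ _ ->] := kP z zr.
- exact: ck'.
- by rewrite k0.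
move=> rho' [phi [phi' [l [/andP[r'0 r'm] l0 phi0 hphi]]]].
have rr : 0 < rho' <= rho by rewrite r'0 (le_trans r'm)// ge_min lexx orbT.
have [V [Phi [Psi [e [lc _]]]]] := @local_coordinate_of_plane q c d 3 rho kap qc qd isT r0 kP kK rho' phi phi' l rr l0 phi0 hphi.
by exists V, Phi, Psi, e, (coord d (f q)).
Qed.

End LocalModel.

(** * Lifting to a branched covering *)

Section Connected.

Lemma connected_pred (T : topologicalType) (D : set T) (P : T -> Prop) :
  connected D -> (forall z, D z -> P z -> \forall w \near z, D w -> P w) ->
  (forall z, D z -> ~ P z -> \forall w \near z, D w -> ~ P w) ->
  forall z w, D z -> D w -> P z -> P w.
Proof.
move=> cD oP cP z w Dz Dw Pz.
suff : D `&` P = D by move=> E; have : D w by []; rewrite -E => -[].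
apply: cD; first by exists z.
- exists (interior [set z | D z -> P z]); first exact: open_interior.
  apply/seteqP; split => x [Dx]; first by move=> Px; split => //; exact: oP.
  by move=> /interior_subset/(_ Dx).
exists (~` interior [set z | D z -> ~ P z]).
  by rewrite closedC; exact: open_interior.
apply/seteqP; split => x [Dx].
  by move=> Px; split => // /interior_subset/(_ Dx).
by move=> h; split => //; apply: contrapT => nP; apply: h; exact: cP.
Qed.

(** Continuation of a property known only piecewise: on each [U i] it is expressed by [P i], it is
    locally constant there, and the expressions agree on overlaps. It serves for turning around a
    lattice point. *)
Lemma connected_pred_family (T : topologicalType) (I : Type) (D : set T)
    (U : I -> set T) (P : I -> T -> Prop) :
  connected D -> (forall x, D x -> exists i, U i x) ->
  (forall i x, D x -> U i x -> \forall y \near x, U i y /\ (P i y <-> P i x)) ->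
  (forall i j x, D x -> U i x -> U j x -> P i x -> P j x) ->
  forall i j x y, D x -> D y -> U i x -> U j y -> P i x -> P j y.
Proof.
move=> cD cov loc agr i j x y Dx Dy Ux Uy Px.
pose Q x := exists2 i, U i x & P i x.
have h1 z : D z -> Q z -> \forall w \near z, D w -> Q w.
  move=> Dz [k Uz Pz]; apply: filterS (loc k z Dz Uz) => w [Uw Pw] Dw.
  by exists k => //; exact/Pw.
have h2 z : D z -> ~ Q z -> \forall w \near z, D w -> ~ Q w.
  move=> Dz nz; have [k Uz] := cov z Dz.
  apply: filterS (loc k z Dz Uz) => w [Uw Pw] Dw [l Ul Pl].
  by apply: nz; exists k => //; apply/Pw; exact: agr Pl.
have [k Uk Pk] := connected_pred cD h1 h2 Dx Dy (ex_intro2 _ _ i Ux Px).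
exact: agr Pk.
Qed.

End Connected.

Definition ram_index (S : Type) (P0 q : S) : nat := if `[< q = P0 >] then 3 else 1.

(** What remains of f once the complex structure is forgotten: local power models, and n points over
    every point other than the origin. The construction of the strip rests on these fields alone. *)
Record branched_cover (R : realType) (S : topologicalType) (f : S -> torus R)
    (P0 : S) (n : nat) : Prop := BranchedCover {
  cover_hausdorff : hausdorff_space S ;
  cover_compact : compact [set: S] ;
  cover_connected : connected [set: S] ;
  cover_continuous : continuous f ;
  cover_origin : f P0 = torus_proj 0 ;
  cover_model : forall q, exists V Phi Psi e z0,
    local_coordinate f q (ram_index P0 q) V Phi Psi e z0 ;
  cover_fibre : forall t, t <> torus_proj 0 -> exists g : 'I_n -> S,
    injective g /\ forall p, f p = t <-> exists i, p = g i }.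
Existing Class branched_cover.

(** * Sections of the covering over convex sets *)

Section Covering.
Variables (R : realType) (S : topologicalType) (f : S -> torus R) (P0 : S) (n : nat).
Context {H : branched_cover f P0 n}.
Local Notation C := (cplx R).
Local Notation pi := (@torus_proj R).
Local Notation mult := (@ram_index S P0).
Let hS := cover_hausdorff H.
Let fP0 := cover_origin H.
Let model := cover_model H.
Let fibre := cover_fibre H.

Definition regular_pt (z : C) := pi z <> pi 0.

Lemma open_regular_pt : open regular_pt.
Proof.
have -> : regular_pt = pi @^-1` (~` [set pi 0]) by [].
apply: open_comp; first by move=> x _; exact: torus_proj_continuous.
rewrite openC; apply: accessible_closed_set1; apply: hausdorff_accessible.
exact: torus_hausdorff.
Qed.

Lemma regular_neq x z : regular_pt z -> f x = pi z -> x <> P0.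
Proof. by move=> hz fx xP; apply: hz; rewrite -fx xP; exact: fP0. Qed.

Lemma mult_neq x : x <> P0 -> mult x = 1%N.
Proof. by move=> xP; rewrite /ram_index; case: asboolP. Qed.

Lemma mult_gt0 x : (0 < mult x)%N. Proof. by rewrite /ram_index; case: ifP. Qed.

Lemma proj_small (z w : C) : pi z = pi w -> cabs (z - w) < 1 -> z = w.
Proof.
by move=> /torus_projP h zw; apply: gauss_small h _; rewrite cabsE ltcR.
Qed.

Lemma proj_eqD (z w v : C) : pi z = pi w -> pi (z + v) = pi (w + v).
Proof.
move=> /torus_projP h; apply/torus_projP; move: h; rewrite /= /gauss_rel.
by have -> : z + v - (w + v) = z - w by ring.
Qed.

(** The model is recentred at any z above [f q], and its disc shrunk to radius at most 1/2, so that
    points of the disc around z are told apart by the projection. *)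
Lemma model_at q z e1 : f q = pi z -> 0 < e1 -> exists V Phi Psi e,
  [/\ e <= e1, e <= 2^-1 & local_coordinate f q (mult q) V Phi Psi e z].
Proof.
move=> fq e10; have [V [Phi [Psi [e [z0 [e0 [oV Vq] h1 h2 [h3 h4]]]]]]] := model q.
have h5 x : V x -> f x = pi (z + Phi x ^+ mult q).
  move=> /h4 ->; apply: proj_eqD; rewrite -fq h4// h3 expr0n.
  by have := mult_gt0 q; case: (mult q) => // m _; rewrite addr0.
pose e' := Num.min e (Num.min e1 2^-1).
have e'0 : 0 < e' by rewrite !lt_min e0 e10 invr_gt0 ltr0n.
have ee : e' <= e by rewrite ge_min lexx.
exists (V `&` Phi @^-1` disc 0 e'), Phi, Psi, e'; split.
- by rewrite !ge_min lexx orbT.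
- by rewrite !ge_min lexx !orbT.
split => //.
- split; last by split => //=; rewrite h3; exact: disc_center.
  rewrite openE => x [Vx Px]; rewrite /interior /=; apply: filterI.
    exact: open_nbhs_nbhs.
  have [_ _ cP] := h1 x Vx; apply: (cP); apply: open_nbhs_nbhs; split => //.
  exact: open_disc.
- by move=> x [/h1[? ? ?] Px].
- move=> w we; have [Vw Pw cw] := h2 w (disc_subset ee we).
  by split => //; split => //=; rewrite Pw.
by split => // x [/h5].
Qed.

(** Both sides are within 1/2 of z and congruent modulo the lattice, hence equal. *)
Lemma model_lift q V Phi Psi e z x w : e <= 2^-1 ->
  local_coordinate f q (mult q) V Phi Psi e z -> V x -> f x = pi w ->
  cabs (w - z) < 2^-1 -> w = z + Phi x ^+ mult q.
Proof.
move=> e2 [e0 _ h1 _ [_ h4]] Vx fx wz; apply: proj_small; first by rewrite -fx h4.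
have [Px _ _] := h1 x Vx; move: Px; rewrite /disc /= subr0 => Px.
have P2 : cabs (Phi x ^+ mult q) < 2^-1.
  have p0 := cabs_ge0 (Phi x); rewrite cabsX; apply: le_lt_trans (_ : cabs (Phi x) < _); last by lra.
  have := mult_gt0 q; case: (mult q) => // m _; rewrite exprSr ler_piMl// exprn_ile1//; lra.
have := cabs_sub_le w (z + Phi x ^+ mult q) z.
have -> : z - (z + Phi x ^+ mult q) = - Phi x ^+ mult q by ring.
rewrite cabsN; lra.
Qed.

Lemma separated (x y : S) : x <> y -> exists A B,
  [/\ A x, B y, open A, open B & forall p, A p -> B p -> False].
Proof.
move=> /eqP xy; have := hS; rewrite open_hausdorff => /(_ _ _ xy) [[A B] /=].
rewrite !inE => -[Ax By] [oA oB AB]; exists A, B; split => // p Ap Bp.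
have ABp : (A `&` B) p by split.
by rewrite AB in ABp.
Qed.

Lemma locally_injective x : x <> P0 -> exists V,
  [/\ open V, V x & forall p q, V p -> V q -> f p = f q -> p = q].
Proof.
move=> xP; have m1 := mult_neq xP; have [z0 fz] := torus_proj_surj (f x).
have [V [Phi [Psi [e [_ e2 lc]]]]] := model_at (esym fz) ltr01.
have [e0 [oV Vq] h1 h2 [h3 h4]] := lc; rewrite m1 in h4.
exists V; split => // p q Vp Vq'; rewrite (h4 _ Vp) (h4 _ Vq') !expr1 => fpq.
have [P1 K1 _] := h1 _ Vp; have [P2 K2 _] := h1 _ Vq'.
rewrite -K1 -K2; congr Psi; apply: (addrI z0); apply: proj_small fpq _.
have -> : z0 + Phi p - (z0 + Phi q) = Phi p - Phi q by ring.
move: P1 P2; rewrite /disc /= !subr0 => P1 P2.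
have := cabsD (Phi p) (- Phi q); rewrite cabsN; lra.
Qed.

(** The coincidence set is open because f is injective near any point other than [P0], and closed
    because the surface is Hausdorff. *)
Lemma lift_unique (T : topologicalType) (D : set T) (g1 g2 : T -> S) :
  connected D -> (forall z, D z -> {for z, continuous g1}) ->
  (forall z, D z -> {for z, continuous g2}) ->
  (forall z, D z -> f (g1 z) = f (g2 z)) ->
  (forall z, D z -> g1 z = g2 z -> g1 z <> P0) ->
  forall z w, D z -> D w -> g1 z = g2 z -> g1 w = g2 w.
Proof.
move=> cD c1 c2 fg nP; apply: connected_pred => // z Dz g12.
  have [V [oV V1 iV]] := locally_injective (nP z Dz g12).
  have n1 : \forall w \near z, V (g1 w) by apply: c1 => //; exact: open_nbhs_nbhs.
  have n2 : \forall w \near z, V (g2 w) by apply: c2 => //; rewrite -g12; exact: open_nbhs_nbhs.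
  by apply: filterS2 n1 n2 => w w1 w2 Dw; apply: iV => //; exact: fg.
have [A [B [A1 B2 oA oB AB]]] := separated g12.
have n1 : \forall w \near z, A (g1 w) by apply: c1 => //; exact: open_nbhs_nbhs.
have n2 : \forall w \near z, B (g2 w) by apply: c2 => //; exact: open_nbhs_nbhs.
by apply: filterS2 n1 n2 => w Aw Bw _ E; apply: (AB (g1 w)) => //; rewrite E.
Qed.

Definition section_on (D : set C) (s : C -> S) :=
  forall z, D z -> f (s z) = pi z /\ {for z, continuous s}.

Definition liftable (D : set C) := forall z x, D z -> f x = pi z ->
  exists2 s, section_on D s & s z = x.

Lemma section_subset D E s : D `<=` E -> section_on E s -> section_on D s.
Proof. by move=> DE h z /DE/h. Qed.

Lemma liftable_subset D E : D `<=` E -> liftable E -> liftable D.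
Proof.
move=> DE h z x Dz fx; have [s sE sz] := h z x (DE _ Dz) fx.
by exists s => //; exact: section_subset sE.
Qed.

Lemma section_unique D s1 s2 : convexC D -> (forall z, D z -> regular_pt z) ->
  section_on D s1 -> section_on D s2 ->
  forall z w, D z -> D w -> s1 z = s2 z -> s1 w = s2 w.
Proof.
move=> cD rD h1 h2; apply: lift_unique; first exact: convexC_connected.
- by move=> z /h1[].
- by move=> z /h2[].
- by move=> z Dz; have [-> _] := h1 z Dz; have [-> _] := h2 z Dz.
by move=> z Dz _; apply: (regular_neq (rD z Dz)); have [] := h1 z Dz.
Qed.

(** Two sections that agree at [z0] agree on the whole convex intersection, hence glue. *)
Lemma liftableU D E : open D -> open E -> convexC D -> convexC E ->
  (forall z, D z -> regular_pt z) -> D `&` E !=set0 ->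
  liftable D -> liftable E -> liftable (D `|` E).
Proof.
move=> oD oE cD cE rD [z0 [Dz0 Ez0]] lD lE.
suff glue s1 s2 : section_on D s1 -> section_on E s2 -> s1 z0 = s2 z0 ->
    exists s, [/\ section_on (D `|` E) s, forall z, D z -> s z = s1 z & forall z, E z -> s z = s2 z].
  move=> z x [Dz|Ez] fx.
    have [s1 h1 s1z] := lD z x Dz fx; have [s2 h2 s2z] := lE z0 (s1 z0) Ez0 (h1 z0 Dz0).1.
    by have [s [hs hD hE]] := glue s1 s2 h1 h2 (esym s2z); exists s => //; rewrite hD.
  have [s2 h2 s2z] := lE z x Ez fx; have [s1 h1 s1z] := lD z0 (s2 z0) Dz0 (h2 z0 Ez0).1.
  by have [s [hs hD hE]] := glue s1 s2 h1 h2 s1z; exists s => //; rewrite hE.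
move=> h1 h2 s12; pose s z := if `[< D z >] then s1 z else s2 z.
have sD z : D z -> s z = s1 z by move=> Dz; rewrite /s asboolT.
have sE z : E z -> s z = s2 z.
  move=> Ez; rewrite /s; case: asboolP => // Dz.
  apply: (@section_unique (D `&` E) s1 s2 _ _ _ _ z0 z) => //.
  - exact: convexCI.
  - by move=> w [/rD].
  - by apply: section_subset h1 => w [].
  - by apply: section_subset h2 => w [].
have cont (W : set C) (s' : C -> S) (y : C) : open W -> (forall v, W v -> s v = s' v) -> W y ->
    {for y, continuous s'} -> {for y, continuous s}.
  move=> oW hW Wz cs A; rewrite (hW y Wz) => /cs h.
  have {}h : nbhs y (s' @^-1` A) by exact: h.
  suff : nbhs y (s @^-1` A) by [].
  apply: filterS2 h (open_nbhs_nbhs (conj oW Wz)) => w As' Ww.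
  by rewrite /preimage /= hW.
exists s; split => // z [Dz|Ez].
  by have [fz cz] := h1 z Dz; split; [rewrite sD|exact: (cont D s1)].
by have [fz cz] := h2 z Ez; split; [rewrite sE|exact: (cont E s2)].
Qed.

(** The n points above z extend to n local sections, which stay distinct near z by Hausdorff
    separation. A nearby fibre has n points too, so these sections exhaust it. *)
Lemma evenly_covered z : regular_pt z -> exists2 e : R, 0 < e &
  disc z e `<=` regular_pt /\ liftable (disc z e).
Proof.
move=> hz; have [g [gi gP]] := fibre hz.
have fg i : f (g i) = pi z by apply/gP; exists i.
have /choice[M hM] : forall i, exists M : set S * (S -> C) * (C -> S) * R,
    local_coordinate f (g i) 1 M.1.1.1 M.1.1.2 M.1.2 M.2 z.
  move=> i; have [V [Phi [Psi [e [_ _ lc]]]]] := model_at (fg i) ltr01.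
  by exists (V, Phi, Psi, e); rewrite mult_neq// in lc; exact: regular_neq (fg i).
pose s i w := (M i).1.2 (w - z).
have sz i : s i z = g i.
  rewrite /s subrr; have [_ [_ Vq] h1 _ [h3 _]] := hM i.
  by have [_ <- _] := h1 _ Vq; rewrite h3.
have sD i w : disc z (M i).2 w -> f (s i w) = pi w /\ {for w, continuous (s i)}.
  move=> wD; have wD' : disc 0 (M i).2 (w - z) by move: wD; rewrite /disc /= subr0.
  have [_ _ _ h2 [_ h4]] := hM i; have [Vw Pw cw] := h2 _ wD'.
  split; first by rewrite h4// Pw expr1 addrC subrK.
  apply: (@continuous_comp _ _ _ (fun w => w - z) (M i).1.2 w _ cw).
  by apply: continuous_sub_cst; exact: cvg_id.
have n1 : \forall w \near z, forall i, disc z (M i).2 w.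
  apply: (@filter_forall _ _ (fun i w => disc z (M i).2 w) (nbhs z) (nbhs_filter z)) => i.
  by apply: (@nbhs_disc R z (M i).2); have [] := hM i.
have n2 : \forall w \near z, forall i j, i != j -> s i w != s j w.
  apply: (@filter_forall _ _ (fun i w => forall j, i != j -> s i w != s j w) (nbhs z) (nbhs_filter z)) => i.
  apply: (@filter_forall _ _ (fun j w => i != j -> s i w != s j w) (nbhs z) (nbhs_filter z)) => j.
  have [->|ij] := eqVneq i j; first by near=> w.
  have gij : s i z <> s j z by rewrite !sz => /gi ij'; rewrite ij' eqxx in ij.
  have [A [B [A1 B2 oA oB AB]]] := separated gij.
  have [_ ci] := sD i z (nbhs_singleton n1 i); have [_ cj] := sD j z (nbhs_singleton n1 j).
  have m1 : \forall w \near z, A (s i w) by apply: ci; exact: open_nbhs_nbhs.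
  have m2 : \forall w \near z, B (s j w) by apply: cj; exact: open_nbhs_nbhs.
  by apply: filterS2 m1 m2 => w Aw Bw _; apply/eqP => E; apply: (AB (s i w)) => //; rewrite E.
have n3 : \forall w \near z, regular_pt w by apply: open_nbhs_nbhs; split => //; exact: open_regular_pt.
have /nbhs_discP[e e0 he] : \forall w \near z, [/\ forall i, disc z (M i).2 w,
    forall i j, i != j -> s i w != s j w & regular_pt w].
  by apply: filterS3 n1 n2 n3 => w; exact: And3.
exists e => //; split; first by move=> w /he[].
move=> w x wD fx; have [w1 w2 w3] := he w wD.
have [g' [g'i g'P]] := fibre w3.
have /choice[t tP] : forall i, exists j, s i w = g' j by move=> i; apply/g'P; have [] := sD i w (w1 i).
have ti : injective t.
  by move=> i j ij; apply/eqP; apply/negPn/negP => /w2; rewrite !tP ij eqxx.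
have [j xj] : exists j, x = g' j by apply/g'P.
exists (s (invF ti j)); last by rewrite tP f_invF.
by move=> v /he[v1 _ _]; exact: sD.
Unshelve. all: by end_near.
Qed.

Definition segment_nbhd (a v : C) (t0 t1 eta : R) : set C :=
  \bigcup_(t in `[t0, t1]) disc (a + rcplx t * v) eta.

Lemma open_segment_nbhd a v t0 t1 eta : open (segment_nbhd a v t0 t1 eta).
Proof. by apply: bigcup_open => t _; exact: open_disc. Qed.

Lemma convex_segment_nbhd a v t0 t1 eta : convexC (segment_nbhd a v t0 t1 eta).
Proof.
move=> z w s [t /= tI zt] [t' /= t'I wt] s01; exists (t + s * (t' - t)).
  move: tI t'I s01; rewrite /= !in_itv /= => /andP[h1 h2] /andP[h3 h4] /andP[h5 h6].
  apply/andP; split; nra.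
have zt0 : disc 0 eta (z - (a + rcplx t * v)) by rewrite /disc /= subr0.
have wt0 : disc 0 eta (w - (a + rcplx t' * v)) by rewrite /disc /= subr0.
have := convexC_disc zt0 wt0 s01; rewrite /disc /= subr0.
by congr (cabs _ < _); rewrite rcplxD rcplxM rcplxB; ring.
Qed.

Lemma segment_nbhdU a v t0 t1 t2 eta : t0 <= t1 <= t2 ->
  segment_nbhd a v t0 t2 eta = segment_nbhd a v t0 t1 eta `|` segment_nbhd a v t1 t2 eta.
Proof.
move=> /andP[t01 t12]; apply/seteqP; split => [z [t /= tI zt]|z [[t /= tI zt]|[t /= tI zt]]].
- move: tI; rewrite in_itv /= => /andP[h1 h2].
  case: (leP t t1) => h; [left|right]; exists t => //=; rewrite in_itv /=.
    by rewrite h1.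
  by rewrite h2 ltW.
- exists t => //=; move: tI; rewrite !in_itv /= => /andP[h1 h2]; apply/andP; split; lra.
- exists t => //=; move: tI; rewrite !in_itv /= => /andP[h1 h2]; apply/andP; split; lra.
Qed.

(** A Lebesgue number for the covering of a compact segment by evenly covered discs. *)
Lemma segment_uniform a v : (forall t : R, 0 <= t <= 1 -> regular_pt (a + rcplx t * v)) ->
  exists2 d : R, 0 < d & forall t, 0 <= t <= 1 ->
    disc (a + rcplx t * v) d `<=` regular_pt /\ liftable (disc (a + rcplx t * v) d).
Proof.
move=> reg; pose Q d (t : R) := disc (a + rcplx t * v) d `<=` regular_pt /\ liftable (disc (a + rcplx t * v) d).
have : \forall d \near 0^'+, `[0, 1] `<=` Q d.
  have /compact_near_coveringP K := @segment_compact R 0 1; apply: K => t.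
  rewrite /= in_itv /= => tI; have [e e0 [h1 h2]] := evenly_covered (reg t tI).
  have e2 : 0 < e / 2 by rewrite divr_gt0.
  have sub t' d : cabs (a + rcplx t' * v - (a + rcplx t * v)) < e / 2 -> d < e / 2 ->
      disc (a + rcplx t' * v) d `<=` disc (a + rcplx t * v) e.
    move=> h3 h4 z; rewrite /disc /= => hz.
    by have := cabs_sub_le z (a + rcplx t * v) (a + rcplx t' * v); lra.
  have n1 : \forall t' \near t, cabs (a + rcplx t' * v - (a + rcplx t * v)) < e / 2.
    exact: (near_cabs (@line_continuous R a v t) e2).
  have n2 : \forall d \near 0^'+, d < e / 2 by exact: nbhs_right_lt.
  exists ([set t' | cabs (a + rcplx t' * v - (a + rcplx t * v)) < e / 2], [set d | d < e / 2]) => //.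
  move=> [t' d] /= [h3 h4]; have s := sub _ _ h3 h4; split; last exact: liftable_subset s h2.
  by move=> z /s/h1.
move=> h; have h0 : \forall d \near 0^'+, (0 : R) < d by exact: nbhs_right_gt.
have [d [hd d0]] := @filter_ex _ _ (at_right_proper_filter (0 : R)) _ (filterI h h0).
exists d; first exact: d0.
by move=> t t01; apply: (hd t); rewrite /= in_itv.
Qed.

(** The segment is cut into m pieces shorter than d / 2, so that the d / 2 neighbourhood of each
    piece lies in an evenly covered disc of radius d; the pieces are glued one at a time. *)
Lemma liftable_segment a v : (forall t : R, 0 <= t <= 1 -> regular_pt (a + rcplx t * v)) ->
  exists2 eta : R, 0 < eta & liftable (segment_nbhd a v 0 1 eta).
Proof.
move=> reg; have [d d0 hd] := segment_uniform reg.
have cv : 0 <= cabs v := cabs_ge0 v.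
pose m := (Num.bound (2 * cabs v / d)).+1.
have mR : 0 < m%:R :> R by rewrite ltr0n.
have md : cabs v / m%:R < d / 2.
  rewrite ltr_pdivrMr// mulrC -ltr_pdivrMr ?divr_gt0//.
  have -> : cabs v / (d / 2) = 2 * cabs v / d by field; rewrite gt_eqF.
  apply: lt_le_trans (archi_boundP _) _; first by rewrite divr_ge0 ?mulr_ge0// ltW.
  by rewrite ler_nat.
exists (d / 2); first by rewrite divr_gt0.
have step (k : nat) : (k < m)%N -> segment_nbhd a v (k%:R / m%:R) (k.+1%:R / m%:R) (d / 2) `<=`
    disc (a + rcplx (k%:R / m%:R) * v) d.
  move=> km z [t]; rewrite /= in_itv /= => /andP[t1 t2]; rewrite /disc /= => zt.
  have := cabs_sub_le z (a + rcplx (k%:R / m%:R) * v) (a + rcplx t * v).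
  have -> : a + rcplx t * v - (a + rcplx (k%:R / m%:R) * v) = rcplx (t - k%:R / m%:R) * v.
    by rewrite rcplxB; ring.
  rewrite cabsM cabs_rcplx ger0_norm ?subr_ge0// => h.
  have : (t - k%:R / m%:R) * cabs v <= m%:R^-1 * cabs v.
    rewrite ler_wpM2r// lerBlDr (le_trans t2)// -natr1 mulrDl mul1r addrC//.
  by rewrite (mulrC _^-1); lra.
have k01 (k : nat) : (k <= m)%N -> 0 <= (k%:R / m%:R : R) <= 1.
  by move=> km; rewrite divr_ge0//= ler_pdivrMr// mul1r ler_nat.
suff : forall k : nat, (k <= m)%N -> liftable (segment_nbhd a v 0 (k%:R / m%:R) (d / 2)).
  by move=> /(_ m (leqnn m)); rewrite divff ?gt_eqF.
elim=> [_|k IH km].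
  rewrite mul0r; have [|_ h] := hd 0; first by rewrite lexx ler01.
  apply: liftable_subset h => z [t]; rewrite /= in_itv /= => t0.
  have -> : t = 0 by apply/eqP; rewrite eq_le andbC.
  rewrite /disc /=; lra.
have kk : 0 <= (k%:R / m%:R : R) <= k.+1%:R / m%:R.
  have /andP[-> _] := k01 k (ltnW km); rewrite /= ler_wpM2r ?invr_ge0 ?(ltW mR)// ler_nat//.
rewrite (segment_nbhdU _ _ _ kk); have [hr hl] := hd _ (k01 k (ltnW km)).
have sub z : segment_nbhd a v 0 (k%:R / m%:R) (d / 2) z -> regular_pt z.
  move=> [t]; rewrite /= in_itv /= => /andP[t0 tk] zt.
  have [|h _] := hd t; first by rewrite t0 (le_trans tk)//; have /andP[] := k01 k (ltnW km).
  by apply: h; move: zt; rewrite /disc /=; lra.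
apply: liftableU => //; try exact: open_segment_nbhd; try exact: convex_segment_nbhd.
- have d2 : 0 < d / 2 by rewrite divr_gt0.
  exists (a + rcplx (k%:R / m%:R) * v); split; exists (k%:R / m%:R); rewrite /= ?in_itv /=.
  + by have /andP[-> _] := kk; rewrite lexx.
  + exact: disc_center.
  + by have /andP[_ ->] := kk; rewrite lexx.
  + exact: disc_center.
- exact: IH (ltnW km).
exact: liftable_subset (step k km) hl.
Qed.

(** Continuation along rays from [z0]: the value at z comes from a section on a neighbourhood of the
    segment to z. Nearby values come from one and the same section, because two such neighbourhoods
    meet in a convex set containing [z0]. *)
Theorem liftable_convex (D : set C) : open D -> convexC D ->
  (forall z, D z -> regular_pt z) -> liftable D.
Proof.
move=> oD cD rD z0 x0 Dz0 fx0.
have /choice[N hN] : forall z, exists N : set C, D z ->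
    [/\ open N /\ convexC N, N `<=` D, N z0, N z & liftable N].
  move=> z; have [Dz|nDz] := pselect (D z); last by exists setT.
  have seg t : 0 <= t <= 1 -> D (z0 + rcplx t * (z - z0)) by move=> t01; exact: cD.
  have [eta eta0 hl] := @liftable_segment z0 (z - z0) (fun t t01 => rD _ (seg t t01)).
  exists (D `&` segment_nbhd z0 (z - z0) 0 1 eta) => _; split.
  - split; first by apply: openI => //; exact: open_segment_nbhd.
    by apply: convexCI => //; exact: convex_segment_nbhd.
  - by move=> w [].
  - split => //; exists 0; first by rewrite /= in_itv /= lexx ler01.
    by rewrite (_ : rcplx 0 = 0 :> C)// mul0r addr0; exact: disc_center.
  - split => //; exists 1; first by rewrite /= in_itv /= lexx ler01.
    by rewrite (_ : rcplx 1 = 1 :> C)// mul1r addrC subrK; exact: disc_center.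
  by apply: liftable_subset hl => w [].
have /choice[sec hsec] : forall z, exists s : C -> S, D z -> section_on (N z) s /\ s z0 = x0.
  move=> z; have [Dz|nDz] := pselect (D z); last by exists (fun=> x0).
  have [_ _ N0 _ Nl] := hN z Dz; have [s hs sz] := Nl z0 x0 N0 fx0.
  by exists s.
have agree z w : D z -> N z w -> sec w w = sec z w.
  move=> Dz Nw; have [[oN cN] ND N0 _ _] := hN z Dz; have Dw := ND w Nw.
  have [[oN' cN'] ND' N0' Nw' _] := hN w Dw.
  have [h1 h2] := hsec w Dw; have [h3 h4] := hsec z Dz.
  apply: (@section_unique (N z `&` N w) (sec w) (sec z) _ _ _ _ z0 w) => //.
  - exact: convexCI.
  - by move=> y [/ND/rD].
  - by apply: section_subset h1 => y [].
  - by apply: section_subset h3 => y [].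
  - by rewrite h2 h4.
exists (fun z => sec z z); last by have [_] := hsec z0 Dz0.
move=> z Dz; have [[oN cN] ND N0 Nz _] := hN z Dz; have [h1 _] := hsec z Dz.
have [fz cz] := h1 z Nz; split => // A /cz h.
have {}h : nbhs z (sec z @^-1` A) by exact: h.
suff : nbhs z ((fun z => sec z z) @^-1` A) by [].
apply: filterS2 h (open_nbhs_nbhs (conj oN Nz)) => w As Nw.
by rewrite /preimage /= (agree z).
Qed.

End Covering.

(** * Half planes and punctured discs *)

Section PuncturedDisc.
Variable R : realType.
Local Notation C := (cplx R).

Definition affine (l : C -> R) := continuous l /\
  forall z w t, l (z + rcplx t * (w - z)) = l z + t * (l w - l z).

Lemma open_affine_lt (l : C -> R) (t : R) : affine l -> open [set z | l z < t].
Proof.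
move=> [cl _]; rewrite (_ : [set z | l z < t] = l @^-1` [set x | x < t])//.
by apply: open_comp; [move=> z _; exact: cl|exact: open_lt].
Qed.

Lemma convex_affine_lt (l : C -> R) (t : R) : affine l -> convexC [set z | l z < t].
Proof.
move=> [_ al] z w s /= zt wt /andP[s0 s1]; rewrite al.
case: (leP (l z) (l w)) => h.
  have : s * (l w - l z) <= l w - l z by rewrite ler_piMl// subr_ge0.
  lra.
have : s * (l w - l z) <= 0 by rewrite mulr_ge0_le0// subr_le0 ltW.
lra.
Qed.

Lemma open_affine_gt (l : C -> R) (t : R) : affine l -> open [set z | t < l z].
Proof.
move=> [cl _]; rewrite (_ : [set z | t < l z] = l @^-1` [set x | t < x])//.
by apply: open_comp; [move=> z _; exact: cl|exact: open_gt].
Qed.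

Lemma convex_affine_gt (l : C -> R) (t : R) : affine l -> convexC [set z | t < l z].
Proof.
move=> [_ al] z w s /= zt wt /andP[s0 s1]; rewrite al.
case: (leP (l z) (l w)) => h.
  have : 0 <= s * (l w - l z) by rewrite mulr_ge0// subr_ge0.
  lra.
have : s * (l z - l w) <= l z - l w by rewrite ler_piMl// subr_ge0 ltW.
lra.
Qed.

Lemma affine_Re : affine (@complex.Re R).
Proof. by split; [exact: Re_continuous|move=> z w t; rewrite ReD ReZ ReB]. Qed.

Lemma affine_Im : affine (@complex.Im R).
Proof. by split; [exact: Im_continuous|move=> z w t; rewrite ImD ImZ ImB]. Qed.

(** A chain of four convex half discs, each meeting the next. *)
Lemma connected_punctured_disc (e : R) : 0 < e -> connected (disc (0 : C) e `\ 0).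
Proof.
move=> e0; pose A := disc (0 : C) e `&` [set z | 0 < complex.Re z].
pose B := disc (0 : C) e `&` [set z | 0 < complex.Im z].
pose D := disc (0 : C) e `&` [set z | complex.Re z < 0].
pose E := disc (0 : C) e `&` [set z | complex.Im z < 0].
have e2 : 0 < e / 4 by rewrite divr_gt0.
have [pt ptR ptI] : exists2 pt : R -> R -> C, forall a b, complex.Re (pt a b) = a * (e / 4) &
    forall a b, complex.Im (pt a b) = b * (e / 4).
  by exists (fun a b => Complex (a * (e / 4)) (b * (e / 4))).
have ptD a b : `|a| <= 1 -> `|b| <= 1 -> disc 0 e (pt a b).
  move=> a1 b1; rewrite /disc /= subr0; apply: le_lt_trans (cabs_le_ReIm _) _.
  rewrite ptR ptI (normrM a) (normrM b) (ger0_norm (ltW e2)).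
  have : `|a| * (e / 4) <= 1 * (e / 4) by rewrite ler_wpM2r// ltW.
  have : `|b| * (e / 4) <= 1 * (e / 4) by rewrite ler_wpM2r// ltW.
  lra.
have n1 : `|1 : R| <= 1 by rewrite normr1.
have m1 : `|-1 : R| <= 1 by rewrite normrN1.
have cA : connected A by apply: convexC_connected; apply: convexCI; [exact: convexC_disc|exact: (@convex_affine_gt (@complex.Re R) 0 affine_Re)].
have cB : connected B by apply: convexC_connected; apply: convexCI; [exact: convexC_disc|exact: (@convex_affine_gt (@complex.Im R) 0 affine_Im)].
have cD : connected D by apply: convexC_connected; apply: convexCI; [exact: convexC_disc|exact: (@convex_affine_lt (@complex.Re R) 0 affine_Re)].
have cE : connected E by apply: convexC_connected; apply: convexCI; [exact: convexC_disc|exact: (@convex_affine_lt (@complex.Im R) 0 affine_Im)].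
have -> : disc (0 : C) e `\ 0 = A `|` B `|` D `|` E.
  apply/seteqP; split => [z [zD z0]|z].
    case: (ltgtP (complex.Re z) 0) => hr; first by left; right.
      by left; left; left.
    case: (ltgtP (complex.Im z) 0) => hi; first by right.
      by left; left; right.
    by exfalso; apply: z0; apply: ReIm_inj.
  by move=> [[[[zD /= h]|[zD /= h]]|[zD /= h]]|[zD /= h]]; split => // z0; move: h; rewrite z0 /= ltxx.
have P1 : (A `&` B) (pt 1 1) by split; split; [exact: (ptD _ _ n1 n1)|rewrite /= ptR mul1r|exact: (ptD _ _ n1 n1)|rewrite /= ptI mul1r].
have P2 : (B `&` D) (pt (-1) 1) by split; split; [exact: (ptD _ _ m1 n1)|rewrite /= ptI mul1r|exact: (ptD _ _ m1 n1)|rewrite /= ptR mulN1r oppr_lt0].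
have P3 : (D `&` E) (pt (-1) (-1)) by split; split; [exact: (ptD _ _ m1 m1)|rewrite /= ptR mulN1r oppr_lt0|exact: (ptD _ _ m1 m1)|rewrite /= ptI mulN1r oppr_lt0].
apply: connectedU => //; first by exists (pt (-1) (-1)); split; [right; exact: P3.1|exact: P3.2].
apply: connectedU => //; first by exists (pt (-1) 1); split; [right; exact: P2.1|exact: P2.2].
by apply: connectedU => //; exists (pt 1 1).
Qed.

End PuncturedDisc.

(** * Lifted segments, trapping, limits of sections *)

Section Transport.
Variables (R : realType) (S : topologicalType) (f : S -> torus R) (P0 : S) (n : nat).
Context {H : branched_cover f P0 n}.
Local Notation C := (cplx R).
Local Notation pi := (@torus_proj R).
Local Notation mult := (@ram_index S P0).

Definition clean (D : set C) := [/\ open D, convexC D & forall z, D z -> regular_pt z].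

(* x and y are the ends of a lift of the segment [z, w]. *)
Definition transport (z w : C) (x y : S) := exists D s,
  [/\ clean D, section_on f D s, D z /\ D w, s z = x & s w = y].

Lemma transport_section D s z w : clean D -> section_on f D s -> D z -> D w ->
  transport z w (s z) (s w).
Proof. by exists D, s. Qed.

Lemma transport_fun z w x y y' : transport z w x y -> transport z w x y' -> y = y'.
Proof.
move=> [D [s [[_ cD rD] sD [Dz Dw] <- <-]]] [E [s' [[_ cE rE] sE [Ez Ew] h <-]]].
apply: (section_unique (H := H) (D := D `&` E) _ _ _ _ (z := z) (w := w)) => //.
- exact: convexCI.
- by move=> v [/rD].
- by apply: section_subset sD => v [].
- by apply: section_subset sE => v [].
Qed.

Lemma transport_sym z w x y : transport z w x y -> transport w z y x.
Proof. by move=> [D [s [cD sD [Dz Dw] sz sw]]]; exists D, s; split. Qed.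

Lemma transport_fibre z w x y : transport z w x y -> f x = pi z /\ f y = pi w.
Proof.
by move=> [D [s [cD sD [Dz Dw] <- <-]]]; split; [have [] := sD z Dz|have [] := sD w Dw].
Qed.

Lemma transport_ex D z x : clean D -> D z -> f x = pi z -> exists s,
  [/\ section_on f D s, s z = x & forall w, D w -> transport z w x (s w)].
Proof.
move=> cD Dz fx; have [oD vD rD] := cD.
have [s sD sz] := liftable_convex (H := H) oD vD rD Dz fx.
exists s; split => // w Dw; rewrite -sz.
exact: (transport_section cD sD Dz Dw).
Qed.

(** The substitute for homotopy of paths: two sides of a triangle may be replaced by the third when
    the triangle lies in a convex set without lattice points. *)
Lemma transport_trans D z1 z2 z3 x1 x2 x3 : clean D -> D z1 -> D z2 -> D z3 ->
  transport z1 z2 x1 x2 -> transport z2 z3 x2 x3 -> transport z1 z3 x1 x3.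
Proof.
move=> cD D1 D2 D3 t12 t23; have [f1 _] := transport_fibre t12.
have [s [sD s1 st]] := transport_ex cD D1 f1.
have s2 : s z2 = x2 := transport_fun (st _ D2) t12.
have s3 : s z3 = x3.
  by apply: transport_fun t23; rewrite -s2; exact: (transport_section cD sD D2 D3).
by rewrite -s3; exact: st.
Qed.

Lemma transport_shift v z w x y : gauss_rel v 0 -> transport z w x y ->
  transport (z + v) (w + v) x y.
Proof.
move=> v0 [D [s [[oD cD rD] sD [Dz Dw] <- <-]]].
have pv u : pi (u - v) = pi u.
  apply/torus_projP; move: v0; rewrite /= /gauss_rel subr0 addrAC subrr add0r.
  by case: v => a b /=; rewrite !rpredN.
have cv u : {for u, continuous (fun u => u - v)} by apply: continuous_sub_cst; exact: cvg_id.
exists (fun u => D (u - v)), (fun u => s (u - v)); split.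
- split.
  + by apply: (open_comp _ oD) => u _; exact: cv.
  + move=> u u' t Du Du' t01; have := cD _ _ _ Du Du' t01.
    by congr D; ring.
  + by move=> u /rD; rewrite /regular_pt pv.
- move=> u Du; have [fu cu] := sD _ Du; split; first by rewrite fu pv.
  exact: (@continuous_comp _ _ _ (fun u => u - v) s u (cv u) cu).
- by rewrite !addrK.
- by rewrite addrK.
- by rewrite addrK.
Qed.

Definition enumerates (e : 'I_n -> S) (z : C) :=
  injective e /\ forall p, f p = pi z <-> exists i, p = e i.

Lemma enumeration z : regular_pt z -> exists e, enumerates e z.
Proof. by move=> hz; exact: (cover_fibre H hz). Qed.

Lemma enumerates_proj e z w : pi z = pi w -> enumerates e z -> enumerates e w.
Proof. by move=> zw [ei eP]; split => // p; rewrite -zw. Qed.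

Lemma transport_perm D z w e e' : clean D -> D z -> D w -> enumerates e z ->
  enumerates e' w -> exists g : {perm 'I_n}, forall i, transport z w (e i) (e' (g i)).
Proof.
move=> cD Dz Dw [ei eP] [e'i e'P].
have /choice[g gP] : forall i, exists j, transport z w (e i) (e' j).
  move=> i; have fi : f (e i) = pi z by apply/eP; exists i.
  have [s [sD sz st]] := transport_ex cD Dz fi.
  have [j sj] : exists j, s w = e' j by apply/e'P; have [] := sD w Dw.
  by exists j; rewrite -sj; exact: st.
have gi : injective g.
  move=> i j gij; apply: ei; apply: transport_fun (transport_sym (gP i)) _.
  by rewrite gij; exact/transport_sym.
by exists (perm gi) => i; rewrite permE.
Qed.

Section Trap.
Variables (q : S) (z : C) (V : set S) (Phi : S -> C) (Psi : C -> S) (e : R).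
Hypotheses (e2 : e <= 2^-1) (lc : local_coordinate f q (mult q) V Phi Psi e z).

(** A concentric part of the model disc. Taking [delta < e] leaves room for the corresponding closed
    disc, whose image in the surface is compact. *)
Definition core (delta : R) : set S := [set x | V x /\ disc 0 delta (Phi x)].

Lemma coreP delta x : delta <= e -> core delta x <-> exists2 w, disc 0 delta w & x = Psi w.
Proof.
move=> de; have [e0 [oV Vq] h1 h2 [h3 h4]] := lc; split => [[Vx Px]|[w wd ->]].
  by exists (Phi x) => //; have [] := h1 x Vx.
by have [Vw Pw _] := h2 w (disc_subset de wd); split => //; rewrite Pw.
Qed.

Lemma open_core delta : open (core delta).
Proof.
have [e0 [oV Vq] h1 h2 [h3 h4]] := lc.
rewrite openE => x [Vx Px]; rewrite /interior /=; apply: filterI; first exact: open_nbhs_nbhs.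
have [_ _ cP] := h1 x Vx; apply: (cP); apply: open_nbhs_nbhs; split => //; exact: open_disc.
Qed.

Lemma core_center delta : 0 < delta -> core delta q.
Proof. by move=> d0; have [e0 [oV Vq] h1 h2 [h3 h4]] := lc; split => //; rewrite h3; exact: disc_center. Qed.

Lemma Psi0 : Psi 0 = q.
Proof. by have [e0 [oV Vq] h1 h2 [h3 h4]] := lc; have [_ <- _] := h1 _ Vq; rewrite h3. Qed.

Lemma core_basis A : nbhs q A -> exists2 delta, 0 < delta < e & core delta `<=` A.
Proof.
move=> qA; have [e0 [oV Vq] h1 h2 [h3 h4]] := lc.
have [_ _ c0] := h2 0 (disc_center 0 e0).
have nA : nbhs (Psi 0) A by rewrite Psi0.
have /nbhs_discP[d d0 hd] : nbhs (0 : C) (Psi @^-1` A) by apply: c0.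
pose delta := Num.min d (e / 2); have de : 0 < delta < e.
  by rewrite lt_min d0 divr_gt0//= gt_min; apply/orP; right; lra.
exists delta => // x; rewrite coreP; last by case/andP: de => _ /ltW.
move=> [w wd ->]; apply: hd; apply: disc_subset wd; by rewrite ge_min lexx.
Qed.

(** A point of V with |Phi| = delta lies over a point at distance exactly delta^m from z, outside
    the disc over which K lives. So K misses that circle, and is separated by the core and the
    complement of the closed core. *)
Lemma trapped delta (K : set S) : 0 < delta < e -> connected K ->
  (forall x, K x -> exists2 w, disc z (delta ^+ mult q) w & f x = pi w) ->
  forall x y, K x -> K y -> core delta x -> core delta y.
Proof.
move=> /andP[d0 de] cK fK; have [e0 [oV Vq] h1 h2 [h3 h4]] := lc.
have h2' w : cabs w <= delta -> [/\ V (Psi w), Phi (Psi w) = w & {for w, continuous Psi}].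
  by move=> wd; apply: h2; rewrite /disc /= subr0; exact: le_lt_trans de.
have clo : closed (Psi @` [set w | cabs (w - 0) <= delta]).
  apply: compact_closed; first exact: cover_hausdorff H.
  apply: continuous_compact; last exact: compact_cdisc.
  apply: continuous_in_subspaceT => w; rewrite inE /= subr0 => wd; by have [] := h2' w wd.
apply: connected_pred => // x Kx cx; first by apply: filterS (open_nbhs_nbhs (conj (@open_core delta) cx)).
suff nx : (~` (Psi @` [set w | cabs (w - 0) <= delta])) x.
  have on : open (~` (Psi @` [set w | cabs (w - 0) <= delta])) by rewrite openC.
  apply: filterS (open_nbhs_nbhs (conj on nx)) => y ny _; rewrite coreP ?ltW// => -[w wd yw].
  by apply: ny; exists w => //=; exact: ltW.
move=> [w /=]; rewrite subr0 => wd xw; apply: cx; have [Vw Pw _] := h2' w wd.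
rewrite -xw; split => //; rewrite Pw /disc /= subr0.
have [w' w'd fx] := fK x Kx.
have dm : delta ^+ mult q <= delta.
  have d1 : delta <= 1 by move: e2; lra.
  have := mult_gt0 P0 q; case: (mult q) => // m _; rewrite exprSr ler_piMl ?(ltW d0)//.
  by rewrite exprn_ile1 ?(ltW d0).
have w'z : cabs (w' - z) < 2^-1 by move: w'd e2; rewrite /disc /=; lra.
rewrite -xw in fx; have := model_lift e2 lc Vw fx w'z; rewrite Pw => E.
move: w'd; rewrite /disc /= E addrAC subrr add0r cabsX.
by rewrite ltr_pXn2r ?nnegrE ?cabs_ge0 ?(ltW d0)//; exact: mult_gt0.
Qed.

Lemma trapped_transport delta T w w' x y : 0 < delta < e -> clean T -> T w -> T w' ->
  disc z (delta ^+ mult q) w -> disc z (delta ^+ mult q) w' ->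
  transport w w' x y -> core delta x -> core delta y.
Proof.
move=> de cT Tw Tw' Bw Bw' t; have [fx _] := transport_fibre t.
have [s [sT sw st]] := transport_ex cT Tw fx; rewrite -sw (transport_fun t (st _ Tw')).
have [oT vT rT] := cT; set B := disc z (delta ^+ mult q) in Bw Bw' *.
apply: (@trapped delta (s @` (T `&` B))) => //.
- apply: connected_continuous_connected.
    by apply: convexC_connected; apply: convexCI => //; exact: convexC_disc.
  by apply: continuous_in_subspaceT => v; rewrite inE => -[Tv _]; have [] := sT v Tv.
- by move=> _ [v [Tv Bv] <-]; exists v => //; have [] := sT v Tv.
- by exists w.
- by exists w'.
Qed.

Lemma connected_punctured_core delta : 0 < delta < e -> connected (core delta `\ q).
Proof.
move=> /andP[d0 de]; have [e0 [oV Vq] h1 h2 [h3 h4]] := lc.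
have -> : core delta `\ q = Psi @` (disc 0 delta `\ 0).
  apply/seteqP; split => [x [cx xq]|_ [w [wd w0] <-]].
    have /(coreP _ (ltW de))[w wd xw] := cx; exists w => //; split => // w0.
    by apply: xq; rewrite xw w0 Psi0.
  split; first by apply/(coreP _ (ltW de)); exists w.
  have [_ Pw _] := h2 w (disc_subset (ltW de) wd).
  by move=> /(congr1 Phi); rewrite Pw h3.
apply: connected_continuous_connected; first exact: connected_punctured_disc.
apply: continuous_in_subspaceT => w; rewrite inE => -[wd _].
by have [] := h2 w (disc_subset (ltW de) wd).
Qed.

End Trap.

Lemma section_limit D s p : clean D -> section_on f D s ->
  (forall rho : R, 0 < rho -> D `&` disc p rho !=set0) ->
  exists q, f q = pi p /\ forall A, nbhs q A -> exists2 rho, 0 < rho &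
    forall w, D w -> disc p rho w -> A (s w).
Proof.
move=> cD sD pD; pose F := s @ (within D (nbhs p)).
have PF : ProperFilter F.
  apply: fmap_proper_filter; split; last exact: within_filter.
  rewrite /within /= => /nbhs_discP[rho rho0 h]; have [w [Dw wp]] := pD rho rho0.
  exact: h wp Dw.
have [q [_ qF]] := cover_compact H PF (filterT : F setT).
have mem rho A : 0 < rho -> nbhs q A -> exists w, [/\ D w, disc p rho w & A (s w)].
  move=> rho0 qA; have : F (s @` (D `&` disc p rho)).
    rewrite /F /= /within /=; apply: filterS (nbhs_disc p rho0) => w wp Dw; by exists w.
  by move=> /qF/(_ qA)[_ [[w [Dw wp] <-] Aw]]; exists w.
have fq : f q = pi p.
  apply: contrapT => /eqP ne; have := @torus_hausdorff R; rewrite open_hausdorff => /(_ _ _ ne).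
  case=> -[A B] /=; rewrite !inE => -[Aq Bp] [oA oB AB].
  have nA : nbhs q (f @^-1` A) by apply: (cover_continuous H); exact: open_nbhs_nbhs.
  have /nbhs_discP[rho rho0 hB] : nbhs p (pi @^-1` B) by apply: torus_proj_continuous; exact: open_nbhs_nbhs.
  have [w [Dw wp Aw]] := mem _ _ rho0 nA; have [fw _] := sD w Dw.
  have ABw : (A `&` B) (pi w) by split; [rewrite -fw; exact: Aw|exact: hB].
  by rewrite AB in ABw.
exists q; split => // A qA.
have [V [Phi [Psi [e [_ e2 lc]]]]] := model_at fq ltr01.
have [delta de cA] := core_basis lc qA; have /andP[d0 _] := de.
have qc : nbhs q (core V Phi delta).
  by apply: open_nbhs_nbhs; split; [exact: (open_core lc delta)|exact: (core_center lc d0)].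
have rho0 : 0 < delta ^+ mult q by rewrite exprn_gt0.
have [w0 [Dw0 w0p cw0]] := mem _ _ rho0 qc.
exists (delta ^+ mult q) => // w Dw wp; apply: cA.
apply: (trapped_transport e2 lc de cD Dw0 Dw w0p wp _ cw0).
exact: (transport_section cD sD Dw0 Dw).
Qed.

(** Near x both y and [s (zeta y)] lie in an open set on which f is injective, and they have the
    same image. *)
Lemma section_near x (zeta : S -> C) D s : x <> P0 -> {for x, continuous zeta} ->
  (\forall y \near x, f y = pi (zeta y)) -> open D -> section_on f D s -> D (zeta x) ->
  s (zeta x) = x -> \forall y \near x, D (zeta y) /\ s (zeta y) = y.
Proof.
move=> xP cz fz oD sD Dx sx; have [V [oV Vx iV]] := locally_injective xP.
have [_ cs] := sD _ Dx.
have n1 : \forall y \near x, V y by exact: open_nbhs_nbhs.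
have n2 : \forall y \near x, D (zeta y) by apply: cz; exact: open_nbhs_nbhs.
have n3 : \forall y \near x, V (s (zeta y)).
  apply: (@continuous_comp _ _ _ zeta s x cz cs); apply: open_nbhs_nbhs; split => //.
  by rewrite /= sx.
near=> y; have Dy : D (zeta y) by near: y.
split => //; apply: iV.
- by near: y.
- by near: y.
have [-> _] := sD _ Dy; apply/esym; near: y; exact: fz.
Unshelve. all: by end_near.
Qed.

End Transport.

(** * Monodromy in a basis of the lattice *)

Section Lattice.
Variable R : realType.
Local Notation C := (cplx R).
Implicit Types z w v : C.

(** The determinant. In a basis (v1, v2) of determinant 1 the coordinates of z are [cross z v2] and
    [cross v1 z]. *)
Definition cross z w : R := complex.Re z * complex.Im w - complex.Im z * complex.Re w.

Lemma crossDl z z' w : cross (z + z') w = cross z w + cross z' w.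
Proof. by rewrite /cross ReD ImD; ring. Qed.
Lemma crossDr z w w' : cross z (w + w') = cross z w + cross z w'.
Proof. by rewrite /cross ReD ImD; ring. Qed.
Lemma crossZl t z w : cross (rcplx t * z) w = t * cross z w.
Proof. by rewrite /cross ReZ ImZ; ring. Qed.
Lemma crossZr t z w : cross z (rcplx t * w) = t * cross z w.
Proof. by rewrite /cross ReZ ImZ; ring. Qed.
Lemma crossNl z w : cross (- z) w = - cross z w.
Proof. by rewrite /cross; case: z => a b /=; ring. Qed.
Lemma crossNr z w : cross z (- w) = - cross z w.
Proof. by rewrite /cross; case: w => a b /=; ring. Qed.
Lemma crossBl z z' w : cross (z - z') w = cross z w - cross z' w.
Proof. by rewrite crossDl crossNl. Qed.
Lemma crossBr z w w' : cross z (w - w') = cross z w - cross z w'.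
Proof. by rewrite crossDr crossNr. Qed.
Lemma crossC z w : cross z w = - cross w z. Proof. rewrite /cross; ring. Qed.
Lemma crossvv z : cross z z = 0. Proof. rewrite /cross; ring. Qed.

Lemma continuous_cross w : continuous (fun z => cross z w).
Proof.
move=> z; rewrite /cross.
apply: (@continuousB _ _ _ (fun z : C => complex.Re z * complex.Im w) (fun z : C => complex.Im z * complex.Re w)).
  apply: (@continuousM _ _ (fun z : C => complex.Re z) (fun=> complex.Im w)); first exact: Re_continuous.
  exact: cst_continuous.
apply: (@continuousM _ _ (fun z : C => complex.Im z) (fun=> complex.Re w)); first exact: Im_continuous.
exact: cst_continuous.
Qed.

Lemma affine_crossl w : affine (fun z => cross z w).
Proof. by split; [exact: continuous_cross|move=> z z' t; rewrite crossDl crossZl crossBl]. Qed.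

Lemma affine_crossr w : affine (fun z => cross w z).
Proof.
split; last by move=> z z' t; rewrite crossDr crossZr crossBr.
have -> : (fun z => cross w z) = (fun z => cross z (- w)).
  by apply/funext => z; rewrite crossNr -crossC.
exact: continuous_cross.
Qed.

Definition lattice z := gauss_rel z 0.

Lemma latticeE z : lattice z = (complex.Re z \is a Num.int) && (complex.Im z \is a Num.int).
Proof. by rewrite /lattice /gauss_rel subr0. Qed.

Lemma lattice_cross z w : lattice z -> lattice w -> cross z w \is a Num.int.
Proof. by rewrite !latticeE => /andP[a b] /andP[c d]; rewrite rpredB// rpredM. Qed.

Lemma latticeD z w : lattice z -> lattice w -> lattice (z + w).
Proof. by rewrite !latticeE => /andP[a b] /andP[c d]; rewrite ReD ImD !rpredD. Qed.

Lemma latticeN z : lattice z -> lattice (- z).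
Proof. by rewrite !latticeE; case: z => a b /= /andP[ha hb]; rewrite !rpredN ha. Qed.

Lemma lattice0 : lattice 0. Proof. by rewrite latticeE /= rpred0. Qed.

Lemma latticeMn z k : lattice z -> lattice (z *+ k).
Proof. by move=> hz; elim: k => [|k IH]; rewrite ?lattice0// mulrS; exact: latticeD. Qed.

Lemma latticeZ (t : R) z : t \is a Num.int -> lattice z -> lattice (rcplx t * z).
Proof. by move=> ti; rewrite !latticeE ReZ ImZ => /andP[a b]; rewrite !rpredM. Qed.

Lemma proj_lattice z w : torus_proj z = torus_proj w <-> lattice (z - w).
Proof. by rewrite /lattice torus_projP /gauss_rel subr0. Qed.

Lemma regular_lattice z : regular_pt z <-> ~~ lattice z.
Proof.
rewrite /regular_pt proj_lattice subr0; split => [h|/negP h //].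
exact/negP.
Qed.

Lemma int_between (x k : R) : x \is a Num.int -> k \is a Num.int -> k < x < k + 1 -> False.
Proof.
move=> xi ki /andP[h1 h2]; have : x - k = 0.
  by apply: int_small; [exact: rpredB|rewrite ger0_norm; lra].
lra.
Qed.

Lemma int_diff (x y : R) : x - y \is a Num.int -> exists k : nat, x = y + k%:R \/ y = x + k%:R.
Proof.
case/intrP => [[k|k]] E; [exists k; left|exists k.+1; right].
  by move: E; rewrite -pmulrn => E; lra.
by move: E; rewrite NegzE mulrNz -pmulrn => E; lra.
Qed.

Definition unimodular v1 v2 := [/\ lattice v1, lattice v2 & cross v1 v2 = 1].

Section Basis.
Variables v1 v2 : C.
Hypothesis uni : unimodular v1 v2.

Lemma cross12 : cross v1 v2 = 1. Proof. by case: uni. Qed.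

Lemma basis_decomp z : z = rcplx (cross z v2) * v1 + rcplx (cross v1 z) * v2.
Proof.
have := cross12; rewrite /cross => E; apply: ReIm_inj.
  rewrite ReD !ReZ -[LHS]mul1r -E; ring.
rewrite ImD !ImZ -[LHS]mul1r -E; ring.
Qed.

Lemma cross_inj z w : cross z v2 = cross w v2 -> cross v1 z = cross v1 w -> z = w.
Proof. by move=> h1 h2; rewrite (basis_decomp z) h1 h2 -basis_decomp. Qed.

Lemma lattice_coord z : lattice z <-> (cross z v2 \is a Num.int /\ cross v1 z \is a Num.int).
Proof.
have [l1 l2 _] := uni; split => [lz|[h1 h2]]; first by split; exact: lattice_cross.
by rewrite (basis_decomp z); apply: latticeD; exact: latticeZ.
Qed.

Definition slabX (k : R) : set C := [set z | k < cross z v2] `&` [set z | cross z v2 < k + 1].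
Definition slabY (k : R) : set C := [set z | k < cross v1 z] `&` [set z | cross v1 z < k + 1].

Lemma clean_slabX k : k \is a Num.int -> clean (slabX k).
Proof.
move=> ki; split.
- by apply: openI; [exact: (@open_affine_gt R (fun z => cross z v2) k (affine_crossl v2))|exact: (@open_affine_lt R (fun z => cross z v2) (k + 1) (affine_crossl v2))].
- by apply: convexCI; [exact: (@convex_affine_gt R (fun z => cross z v2) k (affine_crossl v2))|exact: (@convex_affine_lt R (fun z => cross z v2) (k + 1) (affine_crossl v2))].
move=> z [/= h1 h2]; apply/regular_lattice/negP => /lattice_coord[xi _].
by apply: (int_between xi ki); rewrite h1.
Qed.

Lemma clean_slabY k : k \is a Num.int -> clean (slabY k).
Proof.
move=> ki; split.
- by apply: openI; [exact: (@open_affine_gt R (fun z => cross v1 z) k (affine_crossr v1))|exact: (@open_affine_lt R (fun z => cross v1 z) (k + 1) (affine_crossr v1))].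
- by apply: convexCI; [exact: (@convex_affine_gt R (fun z => cross v1 z) k (affine_crossr v1))|exact: (@convex_affine_lt R (fun z => cross v1 z) (k + 1) (affine_crossr v1))].
move=> z [/= h1 h2]; apply/regular_lattice/negP => /lattice_coord[_ xi].
by apply: (int_between xi ki); rewrite h1.
Qed.

Definition center : C := rcplx 2^-1 * v1 + rcplx 2^-1 * v2.

Lemma centerX : cross center v2 = 2^-1.
Proof. by rewrite crossDl !crossZl cross12 crossvv mulr1 mulr0 addr0. Qed.
Lemma centerY : cross v1 center = 2^-1.
Proof. by rewrite crossDr !crossZr cross12 crossvv mulr1 mulr0 add0r. Qed.

Lemma half01 : 0 < 2^-1 :> R /\ 2^-1 < 0 + 1 :> R. Proof. by split; lra. Qed.

Lemma center_slabX : slabX 0 center.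
Proof. by rewrite /slabX /= centerX; split; apply half01. Qed.
Lemma center_slabY : slabY 0 center.
Proof. by rewrite /slabY /= centerY; split; apply half01. Qed.

Lemma crossMnl z w k : cross (z *+ k) w = k%:R * cross z w.
Proof.
elim: k => [|k IH]; first by rewrite mulr0n /cross /= !mul0r subrr.
by rewrite mulrS crossDl IH -natr1; ring.
Qed.
Lemma crossMnr z w k : cross z (w *+ k) = k%:R * cross z w.
Proof. by rewrite crossC crossMnl crossC mulrN opprK. Qed.

End Basis.
End Lattice.

(** * Labels transported along a strip *)

Section Monodromy.
Variables (R : realType) (S : topologicalType) (f : S -> torus R) (P0 : S) (n : nat).
Context {H : branched_cover f P0 n}.
Local Notation C := (cplx R).
Local Notation pi := (@torus_proj R).
Local Notation mult := (@ram_index S P0).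
Local Notation transport := (transport f).

Section Translation.
Variables (D : set C) (b v : C) (e : 'I_n -> S) (g : {perm 'I_n}).
Hypotheses (cD : clean D) (Dv : forall z, D z -> D (z + v)) (Db : D b) (vL : lattice v).
Hypothesis eb : enumerates f e b.
Hypothesis ge : forall i, transport b (b + v) (e i) (e (g i)).

Lemma DMn z k : D z -> D (z + v *+ k).
Proof. by move=> Dz; elim: k => [|k IH]; rewrite ?addr0// mulrSr addrA; exact: Dv. Qed.

Lemma transport_iter k i : transport b (b + v *+ k) (e i) (e (iter k g i)).
Proof.
elim: k => [|k IH].
  rewrite mulr0n addr0; have fi : f (e i) = pi b by apply/(eb.2); exists i.
  have [s [sD sb st]] := transport_ex cD Db fi; rewrite /= -{2}sb; exact: st.
apply: (transport_trans (H := H) cD Db (DMn k Db) (DMn k.+1 Db) IH).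
have := transport_shift (latticeMn k vL) (ge (iter k g i)).
by rewrite mulrS -!addrA.
Qed.

Lemma transport_unshift w k i y : D w -> transport b (w + v *+ k) (e i) y ->
  transport b w (e (iter k g i)) y.
Proof.
move=> Dw t.
have t' := transport_trans (H := H) cD (DMn k Db) Db (DMn k Dw) (transport_sym (transport_iter k i)) t.
have := transport_shift (latticeN (latticeMn k vL)) t'.
by rewrite !addrK.
Qed.

Lemma iter_invariant (E : {set 'I_n}) : (forall i, (g i \in E) = (i \in E)) ->
  forall k i, (iter k g i \in E) = (i \in E).
Proof. by move=> gE; elim=> // k IH i; rewrite iterS gE. Qed.

(** Over two points differing by k v the labels of y differ by the k-th power of g, which preserves
    E. *)
Lemma transport_label (E : {set 'I_n}) w w' k i j y :
  (forall i, (g i \in E) = (i \in E)) -> D w -> D w' ->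
  w = w' + v *+ k \/ w' = w + v *+ k ->
  transport b w (e i) y -> transport b w' (e j) y -> (i \in E) = (j \in E).
Proof.
move=> gE Dw Dw' [wE|wE] ti tj.
  rewrite wE in ti; have ti' := transport_unshift Dw' ti.
  rewrite -(iter_invariant gE k i); congr (_ \in E); apply: (proj1 eb).
  exact: (transport_fun (H := H) (transport_sym ti') (transport_sym tj)).
rewrite wE in tj; have tj' := transport_unshift Dw tj.
rewrite -(iter_invariant gE k j); congr (_ \in E); apply: (proj1 eb).
exact: (transport_fun (H := H) (transport_sym ti) (transport_sym tj')).
Qed.

End Translation.
End Monodromy.

(** * Transitivity of the monodromy *)

Section Perms.
Variables (R : realType) (S : topologicalType) (f : S -> torus R) (P0 : S) (n : nat).
Context {H : branched_cover f P0 n}.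
Local Notation C := (cplx R).
Local Notation pi := (@torus_proj R).
Local Notation mult := (@ram_index S P0).
Local Notation transport := (transport f).
Variables (v1 v2 : C) (uni : unimodular v1 v2).
Local Notation X z := (cross z v2).
Local Notation Y z := (cross v1 z).
Local Notation b := (center v1 v2).
Variables (e : 'I_n -> S) (r u : {perm 'I_n}).
Hypothesis eb : enumerates f e b.
Hypothesis hr : forall i, transport b (b + v1) (e i) (e (r i)).
Hypothesis hu : forall i, transport b (b + v2) (e i) (e (u i)).

Let lat1 : lattice v1. Proof. by case: uni. Qed.
Let lat2 : lattice v2. Proof. by case: uni. Qed.
Let c12 : cross v1 v2 = 1. Proof. by case: uni. Qed.

Lemma XD1 z : X (z + v1) = X z + 1. Proof. by rewrite crossDl c12. Qed.
Lemma YD1 z : Y (z + v1) = Y z. Proof. by rewrite crossDr crossvv addr0. Qed.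
Lemma XD2 z : X (z + v2) = X z. Proof. by rewrite crossDl crossvv addr0. Qed.
Lemma YD2 z : Y (z + v2) = Y z + 1. Proof. by rewrite crossDr c12. Qed.

Lemma slabY_shift k z : slabY v1 k z -> slabY v1 k (z + v1).
Proof. by move=> [/= h1 h2]; split; rewrite /= YD1. Qed.
Lemma slabX_shift k z : slabX v2 k z -> slabX v2 k (z + v2).
Proof. by move=> [/= h1 h2]; split; rewrite /= XD2. Qed.

Let Hs := slabY v1 0.
Let Vs := slabX v2 0.
Let cH : clean Hs. Proof. exact: (clean_slabY uni (rpred0 _)). Qed.
Let cV : clean Vs. Proof. exact: (clean_slabX uni (rpred0 _)). Qed.
Let bH : Hs b. Proof. exact: center_slabY. Qed.
Let bV : Vs b. Proof. exact: center_slabX. Qed.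

Lemma same_slabY w w' : Hs w -> Hs w' -> pi w = pi w' ->
  exists k : nat, w = w' + v1 *+ k \/ w' = w + v1 *+ k.
Proof.
move=> [/= h1 h2] [/= h3 h4] /proj_lattice /(lattice_coord uni)[xi yi].
have Y0 : Y w = Y w'.
  have := int_small yi; rewrite crossBr => /(_ _); rewrite ltr_norml => E.
  by apply/eqP; rewrite -subr_eq0; apply/eqP/E; apply/andP; split; lra.
rewrite crossBl in xi; have [k [E|E]] := int_diff xi; exists k; [left|right].
  apply: (cross_inj uni); first by rewrite crossDl crossMnl c12 mulr1.
  by rewrite crossDr crossMnr crossvv mulr0 addr0.
apply: (cross_inj uni); first by rewrite crossDl crossMnl c12 mulr1.
by rewrite crossDr crossMnr crossvv mulr0 addr0.
Qed.

Lemma same_slabX w w' : Vs w -> Vs w' -> pi w = pi w' ->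
  exists k : nat, w = w' + v2 *+ k \/ w' = w + v2 *+ k.
Proof.
move=> [/= h1 h2] [/= h3 h4] /proj_lattice /(lattice_coord uni)[xi yi].
have X0 : X w = X w'.
  have := int_small xi; rewrite crossBl => /(_ _); rewrite ltr_norml => E.
  by apply/eqP; rewrite -subr_eq0; apply/eqP/E; apply/andP; split; lra.
rewrite crossBr in yi; have [k [E|E]] := int_diff yi; exists k; [left|right].
  apply: (cross_inj uni); last by rewrite crossDr crossMnr c12 mulr1.
  by rewrite crossDl crossMnl crossvv mulr0 addr0.
apply: (cross_inj uni); last by rewrite crossDr crossMnr c12 mulr1.
by rewrite crossDl crossMnl crossvv mulr0 addr0.
Qed.

Lemma frac_between (x : R) : x \isn't a Num.int ->
  0 < x - (Num.floor x)%:~R < 1.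
Proof.
move=> xN; have /andP[h1 h2] := floor_itv x; rewrite intrD in h2.
apply/andP; split; last lra.
rewrite subr_gt0 lt_neqAle h1 andbT; apply: contraNneq xN => <-; exact: intr_int.
Qed.

Lemma slabX_reduce w : X w \isn't a Num.int -> exists w0, [/\ Vs w0, Y w0 = Y w & pi w = pi w0].
Proof.
move=> /frac_between h; exists (w - rcplx (Num.floor (X w))%:~R * v1).
split.
- by rewrite /Vs /slabX; split; rewrite /= crossBl crossZl c12 mulr1; lra.
- by rewrite crossBr crossZr crossvv mulr0 subr0.
by apply/proj_lattice; rewrite opprB addrC subrK; apply: latticeZ => //; exact: intr_int.
Qed.

Lemma slabY_reduce w : Y w \isn't a Num.int -> exists w0, [/\ Hs w0, X w0 = X w & pi w = pi w0].
Proof.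
move=> /frac_between h; exists (w - rcplx (Num.floor (Y w))%:~R * v2).
split.
- by rewrite /Hs /slabY; split; rewrite /= crossBr crossZr c12 mulr1; lra.
- by rewrite crossBl crossZl crossvv mulr0 subr0.
by apply/proj_lattice; rewrite opprB addrC subrK; apply: latticeZ => //; exact: intr_int.
Qed.

(** Off the lattice at least one coordinate is not an integer. *)
Lemma slab_cover z : regular_pt z -> exists2 w, Hs w \/ Vs w & pi z = pi w.
Proof.
move=> /regular_lattice hz.
have [yi|yn] := boolP (Y z \is a Num.int); last first.
  by have [w [h1 _ h2]] := slabY_reduce yn; exists w => //; left.
have [xi|xn] := boolP (X z \is a Num.int); last first.
  by have [w [h1 _ h2]] := slabX_reduce xn; exists w => //; right.
by case/negP: hz; apply/(lattice_coord uni).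
Qed.

Lemma transport_center D w x : clean D -> D b -> D w -> f x = pi w ->
  exists i, transport b w (e i) x.
Proof.
move=> cD Db Dw fx; have [s [sD sw st]] := transport_ex cD Dw fx.
have [i si] : exists i, s b = e i by apply/(eb.2); have [] := sD b Db.
by exists i; rewrite -si; apply: transport_sym; exact: st.
Qed.

Section Invariant.
Variable E : {set 'I_n}.
Hypotheses (rE : forall i, (r i \in E) = (i \in E)) (uE : forall i, (u i \in E) = (i \in E)).

Lemma labelH w w' i j y : Hs w -> Hs w' ->
  transport b w (e i) y -> transport b w' (e j) y -> (i \in E) = (j \in E).
Proof.
move=> Hw Hw' ti tj; have [_ fi] := transport_fibre ti; have [_ fj] := transport_fibre tj.
have [k wE] : exists k : nat, w = w' + v1 *+ k \/ w' = w + v1 *+ k.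
  by apply: same_slabY => //; rewrite -fi -fj.
by apply: (transport_label cH _ bH lat1 eb hr rE Hw Hw' wE ti tj); exact: slabY_shift.
Qed.

Lemma labelV w w' i j y : Vs w -> Vs w' ->
  transport b w (e i) y -> transport b w' (e j) y -> (i \in E) = (j \in E).
Proof.
move=> Hw Hw' ti tj; have [_ fi] := transport_fibre ti; have [_ fj] := transport_fibre tj.
have [k wE] : exists k : nat, w = w' + v2 *+ k \/ w' = w + v2 *+ k.
  by apply: same_slabX => //; rewrite -fi -fj.
by apply: (transport_label cV _ bV lat2 eb hu uE Hw Hw' wE ti tj); exact: slabX_shift.
Qed.

(** The two strips cross in the unit parallelogram. A multiple of [v1] moves w into it, and a label
    there can be compared with both sides. *)
Lemma labelHV w w' i j y : Hs w -> Vs w' ->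
  transport b w (e i) y -> transport b w' (e j) y -> (i \in E) = (j \in E).
Proof.
move=> Hw Vw' ti tj; have [_ fi] := transport_fibre ti; have [_ fj] := transport_fibre tj.
have [xi yi] : X (w - w') \is a Num.int /\ Y (w - w') \is a Num.int.
  by apply/(lattice_coord uni)/proj_lattice; rewrite -fi -fj.
have xn : X w \isn't a Num.int.
  apply/negP => wi; have w'i : X w' \is a Num.int.
    by rewrite -(subKr (X w) (X w')) -crossBl rpredB.
  by case: Vw' => /= h1 h2; apply: (int_between w'i (rpred0 _)); rewrite h1.
have [w0 [V0 Y0 p0]] := slabX_reduce xn.
have H0 : Hs w0 by move: Hw; rewrite /Hs /slabY /= => -[/= h1 h2]; split; rewrite /= Y0.
have [k tk] : exists k, transport b w0 (e k) y.
  by apply: (transport_center cH bH H0); rewrite fi p0.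
by rewrite (labelH Hw H0 ti tk) (labelV V0 Vw' tk tj).
Qed.

(** Turns an invariant set of labels into a set of points of the surface; by the comparisons above,
    membership does not depend on the strip or on the lift. *)
Definition reached (y : S) := exists w i, [/\ Hs w \/ Vs w, i \in E & transport b w (e i) y].

Lemma reached_label w i y : Hs w \/ Vs w -> transport b w (e i) y -> reached y <-> i \in E.
Proof.
move=> HVw ti; split => [[w' [j [HVw' jE tj]]]|iE]; last by exists w, i.
case: HVw HVw' => Hw [Hw'|Hw'].
- by rewrite (labelH Hw Hw' ti tj).
- by rewrite (labelHV Hw Hw' ti tj).
- by rewrite -(labelHV Hw' Hw tj ti).
- by rewrite (labelV Hw Hw' ti tj).
Qed.

Lemma reached_near x : f x <> pi 0 -> \forall y \near x, reached y <-> reached x.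
Proof.
move=> fx; have [z fz] := torus_proj_surj (f x).
have rz : regular_pt z by rewrite /regular_pt fz.
have [w HVw zw] := slab_cover rz; have fw : f x = pi w by rewrite -fz.
have rw : regular_pt w by rewrite /regular_pt -fw.
have xP : x <> P0 := regular_neq (H := H) rw fw.
have [T [cT Tb Tw TH]] : exists T, [/\ clean T, T b, T w & forall v, T v -> Hs v \/ Vs v].
  by case: HVw => hw; [exists Hs|exists Vs]; split => // v hv; [left|right].
have [i ti] := transport_center cT Tb Tw fw.
have [V [Phi [Psi [ep [_ _ lc]]]]] := model_at fw (@ltr01 R).
rewrite (mult_neq xP) in lc; have [e0 [oV Vq] h1 h2 [h3 h4]] := lc.
have [s [sT sw st]] := transport_ex cT Tw fw.
pose zeta y := w + Phi y; have zx : zeta x = w by rewrite /zeta h3 addr0.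
have cz : {for x, continuous zeta}.
  have [_ _ cP] := h1 x Vq.
  by apply: (@continuousD_cplx _ _ (fun=> w) Phi x _ cP); exact: cst_continuous.
have oT : open T by case: cT.
have fz' : \forall y \near x, f y = pi (zeta y).
  by apply: filterS (open_nbhs_nbhs (conj oV Vq)) => y /h4; rewrite expr1.
have Tz : T (zeta x) by rewrite zx. have sz : s (zeta x) = x by rewrite zx.
apply: filterS (section_near xP cz fz' oT sT Tz sz) => y [Ty sy].
have ty : transport b (zeta y) (e i) y.
  by apply: (transport_trans cT Tb Tw Ty ti); rewrite -{2}sy; exact: st.
by rewrite (reached_label (TH _ Ty) ty) (reached_label HVw ti).
Qed.

Lemma reached_regular y : reached y -> f y <> pi 0.
Proof.
move=> [w [i [HVw _ /transport_fibre[_ ->]]]].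
by case: HVw => hw; [case: cH => _ _|case: cV => _ _]; exact.
Qed.

(* The closure of the points reached is also open at P0, because small punctured
   neighbourhoods of P0 are connected. *)
Lemma invariant_trivial : E = finset.set0 \/ E = [set: 'I_n]%SET.
Proof.
have [/finset.set0Pn[i0 i0E]|] := boolP (E != finset.set0); last by move/negPn/eqP; left.
right; apply/setP => j; rewrite finset.inE.
pose Q x := closure reached x.
have step z : Q z -> \forall w \near z, [set: S] w -> Q w.
  move=> Qz; have [fz|fz] := pselect (f z = pi 0); last first.
    have nz := reached_near fz; have [y [ry Ey]] := Qz _ nz.
    have rz : reached z by apply/Ey.
    apply: filterS nz => y' hy' _; apply: subset_closure; exact/hy'.
  have [V [Phi [Psi [ep [_ e2 lc]]]]] := model_at fz (@ltr01 R).
  have [e0 [oV Vq] h1 h2 [h3 h4]] := lc.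
  have de : 0 < ep / 2 < ep by apply/andP; split; lra.
  have /andP[d0 _] := de; pose W := core V Phi (ep / 2).
  have oW : open W := open_core lc (ep / 2).
  (* In a small core around z, no point other than z lies over the lattice. *)
  have regW y : (W `\ z) y -> f y <> pi 0.
    move=> [[Vy Py] yz] fy; apply: yz.
    have z0 : cabs (0 - 0 : C) < 2^-1 by rewrite subrr cabs0; lra.
    have E0 := model_lift e2 lc Vy fy z0; rewrite add0r in E0.
    have P0y : Phi y = 0.
      by apply/eqP; move/esym/eqP: E0; rewrite expf_eq0 => /andP[].
    have [_ <- _] := h1 y Vy; rewrite P0y; exact: (Psi0 lc).
  have Wz : nbhs z W by apply: open_nbhs_nbhs; split => //; exact: (core_center lc d0).
  have [y [ry Wy]] := Qz _ Wz.
  have Wsy : (W `\ z) y by split => // yz; apply: (reached_regular ry); rewrite yz.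
  have cW : connected (W `\ z) := connected_punctured_core lc de.
  have all w : (W `\ z) w -> reached w.
    move=> Ww; apply: (@connected_pred _ (W `\ z) reached cW _ _ y w Wsy Ww ry).
    - by move=> v /regW/reached_near nv rv; apply: filterS nv => v' hv' _; apply/hv'.
    - by move=> v /regW/reached_near nv rv; apply: filterS nv => v' hv' _ /hv'.
  apply: filterS Wz => w Ww _; have [->|wz] := pselect (w = z); first exact: Qz.
  by apply: subset_closure; apply: all.
have Qall y : Q y.
  apply: (@connected_pred S setT Q (cover_connected H) _ _ (e i0) y I I).
  - by move=> z _; exact: step.
  - move=> z _ nQ; have : open (~` closure reached) by rewrite openC; exact: closed_closure.
    by move=> oQ; apply: filterS (open_nbhs_nbhs (conj oQ nQ)) => w.
  - apply: subset_closure; exists b, i0; split => //; first by left.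
    have fi : f (e i0) = pi b by apply/(eb.2); exists i0.
    have [k tk] := transport_center cH bH bH fi.
    have [s [sD sb st]] := transport_ex cH bH fi.
    by rewrite -{2}sb; exact: st.
have fj : f (e j) = pi b by apply/(eb.2); exists j.
have rj : f (e j) <> pi 0 by rewrite fj; case: cH => _ _; exact.
have [y [ry Ey]] := Qall (e j) _ (reached_near rj).
have : reached (e j) by apply/Ey.
have [s [sD sb st]] := transport_ex cH bH fj.
have tj : transport b b (e j) (e j) by rewrite -{2}sb; exact: st.
by move/(reached_label (or_introl bH) tj) => ->.
Qed.

End Invariant.
End Perms.

(** * Monodromy around a lattice point *)

Section Corner.
Variables (R : realType) (S : topologicalType) (f : S -> torus R) (P0 : S) (n : nat).
Context {H : branched_cover f P0 n}.
Local Notation C := (cplx R).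
Local Notation pi := (@torus_proj R).
Local Notation mult := (@ram_index S P0).
Local Notation transport := (transport f).
Variables (v1 v2 : C) (uni : unimodular v1 v2).
Local Notation X z := (cross z v2).
Local Notation Y z := (cross v1 z).
Local Notation b := (center v1 v2).
Variables (e : 'I_n -> S) (r u : {perm 'I_n}).
Hypothesis eb : enumerates f e b.
Hypothesis hr : forall i, transport b (b + v1) (e i) (e (r i)).
Hypothesis hu : forall i, transport b (b + v2) (e i) (e (u i)).
Local Notation corner := (v1 + v2).

Let lat1 : lattice v1. Proof. by case: uni. Qed.
Let lat2 : lattice v2. Proof. by case: uni. Qed.
Let c12 : cross v1 v2 = 1. Proof. by case: uni. Qed.

(* Walking around the lattice point [v1 + v2], the four half planes and the strips
   containing them are met in this order; step 4 is step 0 again. *)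
Definition quadrant (a : nat) : set C :=
  match a with
  | 1 => [set z | 1 < X z] | 2 => [set z | 1 < Y z] | 3 => [set z | X z < 1]
  | _ => [set z | Y z < 1] end.

Definition slab (a : nat) : set C :=
  match a with
  | 1 => slabX v2 1 | 2 => slabY v1 1 | 3 => slabX v2 0 | _ => slabY v1 0 end.

Definition base (a : nat) : C :=
  match a with
  | 1 => b + v1 | 2 => b + v1 + v2 | 3 => b + v2 | _ => b end.

(** Products of permutations act from left to right: right, up, left, down is one counterclockwise
    turn around the upper right corner. *)
Definition turn : {perm 'I_n} := (r * u * r^-1 * u^-1)%g.

(** The label at [base a] after a quarter turns, starting from label i at [base 0]. *)
Definition sheet (a : nat) : {perm 'I_n} :=
  match a with
  | 0 => 1%g | 1 => r | 2 => (r * u)%g | 3 => (r * u * r^-1)%g | _ => turn end.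

Lemma turnE i : u (r i) = r (u (turn i)).
Proof. by rewrite /turn !permM permKV permKV. Qed.

Lemma clean_slab a : clean (slab a).
Proof.
have i0 : (0 : R) \is a Num.int by exact: rpred0.
have i1 : (1 : R) \is a Num.int by exact: rpred1.
case: a => [|[|[|[|a]]]] /=.
- exact: (clean_slabY uni i0).
- exact: (clean_slabX uni i1).
- exact: (clean_slabY uni i1).
- exact: (clean_slabX uni i0).
- exact: (clean_slabY uni i0).
Qed.

Lemma base_slab a : (a <= 3)%N -> slab a (base a) /\ slab a (base a.+1).
Proof.
have [h1 h2] := (centerX uni, centerY uni).
case: a => [|[|[|[|a]]]] //= _; rewrite /slabX /slabY /=; rewrite ?XD2 ?(YD2 uni) ?(XD1 uni) ?YD1 ?h1 ?h2.
all: by do !split; lra.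
Qed.

Lemma transport_turn a i : (a <= 3)%N ->
  transport (base a) (base a.+1) (e (sheet a i)) (e (sheet a.+1 i)).
Proof.
case: a => [|[|[|[|a]]]] //= _.
- by rewrite perm1; exact: hr.
- by rewrite permM; have := transport_shift lat1 (hu (r i)); rewrite (addrAC b v2 v1).
- have := transport_sym (transport_shift lat2 (hr ((r * u * r^-1)%g i))).
  have -> : r ((r * u * r^-1)%g i) = (r * u)%g i by rewrite permM permKV.
  by [].
- have := transport_sym (hu (turn i)).
  have -> : u (turn i) = (r * u * r^-1)%g i by rewrite /turn permM permKV.
  by [].
Qed.

Lemma transport_next a i w x : (a <= 3)%N -> slab a w ->
  transport (base a) w (e (sheet a i)) x <-> transport (base a.+1) w (e (sheet a.+1 i)) x.
Proof.
move=> a3 aw; have [s1 s2] := base_slab a3; have t := transport_turn i a3.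
split => h.
  exact: (transport_trans (H := H) (clean_slab a) s2 s1 aw (transport_sym t) h).
exact: (transport_trans (H := H) (clean_slab a) s1 s2 aw t h).
Qed.

Section AtPoint.
Variables (q : S) (V : set S) (Phi : S -> C) (Psi : C -> S) (ep delta : R).
Hypotheses (ep2 : ep <= 2^-1) (lc : local_coordinate f q (mult q) V Phi Psi ep corner).
Hypothesis dep : 0 < delta < ep.
Let B := disc corner (delta ^+ mult q).
Hypothesis small : forall w, B w -> `|X w - 1| < 1 /\ `|Y w - 1| < 1.

Let W := core V Phi delta.
Let zeta x := corner + Phi x ^+ mult q.

Lemma quadrant_slab a w : (a <= 3)%N -> B w -> quadrant a w -> slab a w.
Proof.
move=> a3 /small; rewrite !ltr_norml => -[/andP[h1 h2] /andP[h3 h4]].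
by case: a a3 => [|[|[|[|a]]]] //= _ h; split => /=; lra.
Qed.

Lemma open_quadrant a : open (quadrant a).
Proof.
case: a => [|[|[|[|a]]]].
- exact: (@open_affine_lt R (fun z => cross v1 z) 1 (affine_crossr v1)).
- exact: (@open_affine_gt R (fun z => cross z v2) 1 (affine_crossl v2)).
- exact: (@open_affine_gt R (fun z => cross v1 z) 1 (affine_crossr v1)).
- exact: (@open_affine_lt R (fun z => cross z v2) 1 (affine_crossl v2)).
- exact: (@open_affine_lt R (fun z => cross v1 z) 1 (affine_crossr v1)).
Qed.

Lemma corner_coord : X corner = 1 /\ Y corner = 1.
Proof. by rewrite crossDl crossDr !crossvv c12 add0r addr0. Qed.

Lemma delta_gt0 : 0 < delta. Proof. by case/andP: dep. Qed.

Lemma zetaB x : W x -> B (zeta x).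
Proof.
move=> [Vx]; rewrite /disc /= subr0 => Px.
rewrite /B /zeta /disc /= addrAC subrr add0r cabsX.
by rewrite ltr_pXn2r ?nnegrE ?cabs_ge0 ?(ltW delta_gt0)//; exact: mult_gt0.
Qed.

Lemma f_zeta x : V x -> f x = pi (zeta x).
Proof. by have [_ _ _ _ [_ h4]] := lc; exact: h4. Qed.

Lemma zeta_quadrant x : W x -> x <> q -> exists2 a, (a <= 3)%N & quadrant a (zeta x).
Proof.
move=> [Vx Px] xq; have [X1 Y1] := corner_coord.
case: (ltgtP (X (zeta x)) 1) => hx; [by exists 3%N|by exists 1%N|].
case: (ltgtP (Y (zeta x)) 1) => hy; [by exists 0%N|by exists 2%N|].
have E : zeta x = corner by apply: (cross_inj uni); rewrite ?X1 ?Y1.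
case: xq; have P0x : Phi x = 0.
  apply/eqP; move/eqP: E; rewrite /zeta -subr_eq0 addrAC subrr add0r expf_eq0.
  by case/andP.
have [_ _ h1 _ _] := lc; have [_ <- _] := h1 x Vx; rewrite P0x; exact: Psi0 lc.
Qed.

Lemma zeta_continuous x : V x -> {for x, continuous zeta}.
Proof.
move=> Vx; have [_ _ h1 _ _] := lc; have [_ _ cP] := h1 x Vx.
apply: (@continuousD_cplx _ _ (fun=> corner) (fun x => Phi x ^+ mult q) x); first exact: cst_continuous.
exact: continuousX_cplx.
Qed.

Lemma puncture_regular x : W x -> x <> q -> regular_pt (zeta x).
Proof.
move=> Wx xq; have [a a3 qa] := zeta_quadrant Wx xq.
by have := quadrant_slab a3 (zetaB Wx) qa; case: (clean_slab a) => _ _; apply.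
Qed.

Section Invariant.
Variable E : {set 'I_n}.
Hypothesis tE : forall i, (turn i \in E) = (i \in E).

Definition on_sheet a x := exists2 i, i \in E & transport (base a) (zeta x) (e (sheet a i)) x.

Lemma on_sheet_next a x : (a <= 3)%N -> W x -> quadrant a (zeta x) ->
  on_sheet a x <-> on_sheet a.+1 x.
Proof.
move=> a3 Wx qx; have sx := quadrant_slab a3 (zetaB Wx) qx.
by split => -[i iE t]; exists i => //; apply/(transport_next i _ a3 sx).
Qed.

Lemma on_sheet4 x : on_sheet 4 x <-> on_sheet 0 x.
Proof.
split => -[i iE t].
  by exists (turn i); rewrite ?tE// [sheet 0]/= perm1.
exists (turn^-1 i)%g; first by rewrite -tE permKV.
by rewrite /= permKV; move: t; rewrite /= perm1.
Qed.

Lemma on_sheet_near a x : (a <= 3)%N -> W x -> x <> q -> quadrant a (zeta x) ->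
  \forall y \near x, quadrant a (zeta y) /\ (on_sheet a y <-> on_sheet a x).
Proof.
move=> a3 Wx xq qx; have sx := quadrant_slab a3 (zetaB Wx) qx; have [Vx _] := Wx.
have [_ [oV _] _ _ _] := lc.
have fx := f_zeta Vx.
have xP : x <> P0 := regular_neq (H := H) (puncture_regular Wx xq) fx.
have [s [sD sz st]] := transport_ex (clean_slab a) sx fx.
have oS : open (slab a) by case: (clean_slab a).
have fV : \forall y \near x, f y = pi (zeta y).
  by apply: filterS (open_nbhs_nbhs (conj oV Vx)) => y; exact: f_zeta.
have n1 := section_near (H := H) xP (zeta_continuous Vx) fV oS sD sx sz.
have n2 : \forall y \near x, quadrant a (zeta y).
  by apply: (zeta_continuous Vx); apply: open_nbhs_nbhs; split => //; exact: open_quadrant.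
apply: filterS2 n1 n2 => y [sy yE] qy; split => //.
have [bs _] := base_slab a3; have txy : transport (zeta x) (zeta y) x y by rewrite -{2}yE; exact: st.
split => -[i iE t]; exists i => //.
  exact: (transport_trans (H := H) (clean_slab a) bs sy sx t (transport_sym txy)).
exact: (transport_trans (H := H) (clean_slab a) bs sx sy t txy).
Qed.

(** The punctured core is connected, and [on_sheet] continues over it from one half plane to the
    next. So a [turn]-invariant set of labels containing one sheet around q contains them all. *)
Lemma corner_transitive x y : W x -> W y -> quadrant 0 (zeta x) -> quadrant 0 (zeta y) ->
  on_sheet 0 x -> on_sheet 0 y.
Proof.
move=> Wx Wy qx qy ox.
have neq z : quadrant 0 (zeta z) -> z <> q.
  move=> /= qz zq; have [_ [_ Vq] _ _ [h3 _]] := lc.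
  move: qz; rewrite zq /zeta h3 expr0n; have := mult_gt0 P0 q; case: (mult q) => // m _.
  by rewrite addr0 (proj2 corner_coord) ltxx.
have /(@connected_pred_family _ nat _ (fun a => [set x | (a <= 3)%N /\ quadrant a (zeta x)]) on_sheet) :=
  connected_punctured_core lc dep.
move=> /(_ _ _ _ 0%N 0%N x y); apply=> //.
- move=> z [Wz zq]; have [a a3 qa] := zeta_quadrant Wz zq; by exists a.
- move=> a z [Wz zq] [a3 qa]; apply: filterS (on_sheet_near a3 Wz zq qa) => w [qw ow].
  by split.
- move=> a a' z [Wz zq] [a3 qa] [a'3 qa'].
  (* Opposite half planes are disjoint. Neighbouring ones are compared by this equivalence, together
     with the identification of step 4 with step 0. *)
  have N k : (k <= 3)%N -> quadrant k (zeta z) -> on_sheet k z <-> on_sheet k.+1 z.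
    by move=> k3 qk; exact: on_sheet_next.
  case: a a3 qa => [|[|[|[|a]]]] // _ qa; case: a' a'3 qa' => [|[|[|[|a']]]] // _ qa'; move=> oz //.
  + by apply/(N 0%N).
  + by exfalso; move: qa qa' => /=; lra.
  + by apply/(N 3%N) => //; apply/on_sheet4.
  + by apply/(N 0%N).
  + by apply/(N 1%N).
  + by exfalso; move: qa qa' => /=; lra.
  + by exfalso; move: qa qa' => /=; lra.
  + by apply/(N 1%N).
  + by apply/(N 2%N).
  + by apply/on_sheet4; apply/(N 3%N).
  + by exfalso; move: qa qa' => /=; lra.
  + by apply/(N 2%N).
- by split => //; exact: neq.
- by split => //; exact: neq.
Qed.

End Invariant.
End AtPoint.
End Corner.

(** The third hypothesis, applied to an orbit of c, makes I a single orbit. *)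
Lemma three_cycle (T : finType) (c : {perm T}) (I : {set T}) : #|I| = 3%N ->
  (forall i, i \in I -> c i \in I) ->
  (forall E : {set T}, (forall i, (c i \in E) = (i \in E)) ->
     forall i j, i \in I -> i \in E -> j \in I -> j \in E) ->
  exists x y z, [/\ x != y, y != z, x != z, I = [set x; y; z]%SET &
    [/\ c x = y, c y = z & c z = x]].
Proof.
move=> I3 cI tI; have [x xI] : exists x, x \in I by apply/finset.set0Pn; rewrite -card_gt0 I3.
have pI : porbit c x = I.
  apply/eqP; rewrite finset.eqEsubset; apply/andP; split; apply/fintype.subsetP => y.
    by case/porbit_iterP => k ->; elim: k => //= k; exact: cI.
  move=> yI; apply: (tI (porbit c x) _ x y) => //; last exact: porbit_id.
  by move=> i; rewrite porbit_sym [RHS]porbit_sym porbit_step.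
have c3 : #|porbit c x| = 3%N by rewrite pI.
have ne i j : (i < j < 3)%N -> iter i c x != iter j c x by rewrite -c3; exact: porbit_iter_neq.
have cx3 : iter 3 c x = x by rewrite -c3 iter_porbit.
exists x, (c x), (c (c x)); have [[n1 n2] n3] := (ne 0%N 1%N isT, ne 1%N 2%N isT, ne 0%N 2%N isT).
split => //; apply/esym/eqP; rewrite eqEcard; apply/andP; split.
  apply/fintype.subsetP => y; rewrite !finset.inE -orbA => /or3P[]/eqP ->; [exact: xI|exact: cI|by apply/cI/cI].
by rewrite I3 -finset.setUA !cardsU1 !finset.inE cards1 negb_or n1 n2 n3.
Qed.

Lemma cube_roots_exist (R : realType) (k : cplx R) : k != 0 -> exists t0 t1 t2 : cplx R,
  [/\ t0 != t1, t1 != t2, t0 != t2, [/\ t0 ^+ 3 = k, t1 ^+ 3 = k & t2 ^+ 3 = k] &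
   forall t, t ^+ 3 = k -> [\/ t = t0, t = t1 | t = t2]].
Proof.
move=> k0; have [t0 t0E] := cplx_root k (isT : 0 < 3)%N.
have [s sE] := cplx_root (-3 : cplx R) (isT : 0 < 2)%N.
have n2 : (2 : cplx R) != 0 by rewrite pnatr_eq0.
have n3 : (3 : cplx R) != 0 by rewrite pnatr_eq0.
(* A primitive cube root of unity, (-1 + sqrt(-3)) / 2. *)
pose w := (s - 1) / 2; have w2 : w ^+ 2 = - 1 - w.
  have -> : w ^+ 2 = (s ^+ 2 - 2 * s + 1) / 4 by rewrite /w; field.
  by rewrite sE /w; field.
have w3 : w ^+ 3 = 1 by rewrite exprS w2 mulrBr mulrN1 -expr2 w2; ring.
have w1 : w != 1.
  apply: contraNneq n3 => w1; move/eqP: w2; rewrite w1 expr1n -subr_eq0.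
  by have -> : 1 - (-1 - 1) = 3 :> cplx R by ring.
have w0 : w != 0 by apply: contraTneq (oner_neq0 (cplx R)) => w0; rewrite -w3 w0 expr0n eqxx.
have t00 : t0 != 0 by apply: contraNneq k0 => t00; rewrite -t0E t00 expr0n.
exists t0, (w * t0), (w ^+ 2 * t0); split.
- by rewrite -[X in X != _]mul1r (inj_eq (mulIf t00)) eq_sym.
- by rewrite (inj_eq (mulIf t00)) expr2 -[X in X != _]mulr1 (inj_eq (mulfI w0)) eq_sym.
- rewrite -[X in X != _]mul1r (inj_eq (mulIf t00)); apply: contraNneq w1 => h.
  by have : w * 1 = w * w ^+ 2 by [rewrite -h]; rewrite mulr1 -exprS w3 => ->.
- by split; [exact: t0E|rewrite exprMn w3 mul1r|rewrite exprMn exprAC w3 expr1n mul1r].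
move=> t tE; have : (t - t0) * (t - w * t0) * (t - w ^+ 2 * t0) = 0.
  have -> : (t - t0) * (t - w * t0) * (t - w ^+ 2 * t0) = t ^+ 3 - w ^+ 3 * t0 ^+ 3
     - (1 + w + w ^+ 2) * t0 * t ^+ 2 + w * (1 + w + w ^+ 2) * t0 ^+ 2 * t by ring.
  by rewrite w3 tE t0E w2; ring.
move/eqP; rewrite !mulf_eq0 -orbA !subr_eq0 => /or3P[]/eqP h.
- exact: Or31.
- exact: Or32.
- exact: Or33.
Qed.

(** * Sheets arriving at a point above the corner *)

Section Descent.
Variables (R : realType) (S : topologicalType) (f : S -> torus R) (P0 : S) (n : nat).
Context {H : branched_cover f P0 n}.
Local Notation C := (cplx R).
Local Notation pi := (@torus_proj R).
Local Notation mult := (@ram_index S P0).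
Local Notation transport := (transport f).

Section Singular.
Variables (v1 v2 : C) (uni : unimodular v1 v2).
Local Notation X z := (cross z v2).
Local Notation Y z := (cross v1 z).
Local Notation b := (center v1 v2).
Variables (e : 'I_n -> S) (r u : {perm 'I_n}).
Hypothesis eb : enumerates f e b.
Hypothesis hr : forall i, transport b (b + v1) (e i) (e (r i)).
Hypothesis hu : forall i, transport b (b + v2) (e i) (e (u i)).
Local Notation corner := (v1 + v2).
Local Notation turn := (turn r u).
Local Notation slab := (slab v1 v2).
Local Notation base := (base v1 v2).
Local Notation sheet := (sheet r u).

Let c12 : cross v1 v2 = 1. Proof. by case: uni. Qed.

Lemma near_corner : exists2 rho : R, 0 < rho & forall w, disc corner rho w ->
  `|X w - 1| < 1 /\ `|Y w - 1| < 1.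
Proof.
have [X1 Y1] := corner_coord uni.
have nX : \forall w \near corner, `|X w - 1| < 1.
  have /cvgrPdist_lt h := @continuous_cross R v2 corner.
  by apply: filterS (h 1 ltr01) => w; rewrite X1 distrC.
have nY : \forall w \near corner, `|Y w - 1| < 1.
  have /cvgrPdist_lt h := (affine_crossr v1).1 corner.
  by apply: filterS (h 1 ltr01) => w; rewrite Y1 distrC.
have /nbhs_discP[rho rho0 h] : \forall w \near corner, `|X w - 1| < 1 /\ `|Y w - 1| < 1.
  by apply: filterS2 nX nY => w.
by exists rho.
Qed.

Lemma corner_points rho : 0 < rho -> exists t : R,
  0 < t /\ forall s s' : R, `|s| <= 1 -> `|s'| <= 1 ->
   let w := corner + rcplx (s * t) * v1 + rcplx (s' * t) * v2 in
   [/\ disc corner rho w, X w = 1 + s * t & Y w = 1 + s' * t].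
Proof.
move=> rho0; have [X1 Y1] := corner_coord uni.
pose M := cabs v1 + cabs v2 + 1.
have M0 : 0 < M by rewrite /M; have := cabs_ge0 v1; have := cabs_ge0 v2; lra.
exists (rho / M); split; first by rewrite divr_gt0.
move=> s s' s1 s'1 w; split.
- have -> : disc corner rho w = (cabs (w - corner) < rho) :> Prop by [].
  have -> : w - corner = rcplx (s * (rho / M)) * v1 + rcplx (s' * (rho / M)) * v2 by rewrite /w; ring.
  apply: le_lt_trans (cabsD _ _) _; rewrite !cabsM !cabs_rcplx.
  have t0 : 0 < rho / M by rewrite divr_gt0.
  rewrite (normrM s) (normrM s') (ger0_norm (ltW t0)).
  have h1 : `|s| * (rho / M) * cabs v1 <= (rho / M) * cabs v1.
    by rewrite ler_wpM2r ?cabs_ge0// ler_piMl ?(ltW t0).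
  have h2 : `|s'| * (rho / M) * cabs v2 <= (rho / M) * cabs v2.
    by rewrite ler_wpM2r ?cabs_ge0// ler_piMl ?(ltW t0).
  have h3 : rho = (rho / M) * cabs v1 + (rho / M) * cabs v2 + rho / M.
    have E : rho / M * M = rho by rewrite divfK// gt_eqF.
    by rewrite -[LHS]E {2}/M !mulrDr mulr1.
  lra.
- by rewrite /w !crossDl !crossZl c12 crossvv; ring.
by rewrite /w !crossDr !crossZr c12 crossvv; ring.
Qed.

Lemma four_points rho : 0 < rho -> exists z1 z2 z3 z4,
  [/\ [/\ disc corner rho z1, X z1 < 1 & Y z1 < 1],
      [/\ disc corner rho z2, 1 < X z2 & Y z2 < 1],
      [/\ disc corner rho z3, 1 < X z3 & 1 < Y z3] &
      [/\ disc corner rho z4, X z4 < 1 & 1 < Y z4]].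
Proof.
move=> rho0; have [t [t0 pts]] := corner_points rho0.
have n1 : `|1 : R| <= 1 by rewrite normr1.
have m1 : `|-1 : R| <= 1 by rewrite normrN1.
have [B1 X1 Y1] := pts _ _ m1 m1; have [B2 X2 Y2] := pts _ _ n1 m1.
have [B3 X3 Y3] := pts _ _ n1 n1; have [B4 X4 Y4] := pts _ _ m1 n1.
do 4 eexists; split.
- by split; [exact: B1|rewrite X1; lra|rewrite Y1; lra].
- by split; [exact: B2|rewrite X2; lra|rewrite Y2; lra].
- by split; [exact: B3|rewrite X3; lra|rewrite Y3; lra].
- by split; [exact: B4|rewrite X4; lra|rewrite Y4; lra].
Qed.

Section AtPoint.
Variables (q : S) (V : set S) (Phi : S -> C) (Psi : C -> S) (ep delta : R).
Hypotheses (ep2 : ep <= 2^-1) (lc : local_coordinate f q (mult q) V Phi Psi ep corner).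
Hypothesis dep : 0 < delta < ep.
Let B := disc corner (delta ^+ mult q).
Hypothesis small : forall w, B w -> `|X w - 1| < 1 /\ `|Y w - 1| < 1.
Let W := core V Phi delta.
Variable w1 : C.
Hypotheses (w1B : B w1) (w1X : X w1 < 1) (w1Y : Y w1 < 1).

(* The sheet i over the strip 0 < y < 1 has q as its limit at [corner]. *)
Definition arrives i := exists2 x, W x & transport b w1 (e i) x.

(** A quarter turn: the lift moves inside one strip, trapped in the core, and is then relabelled
    from the next base point, which lies in the same strip. *)
Lemma arrives_step a i w w' x : (a <= 3)%N -> B w -> B w' -> slab a w -> slab a w' ->
  W x -> transport (base a) w (e (sheet a i)) x ->
  exists2 x', W x' & transport (base a.+1) w' (e (sheet a.+1 i)) x'.
Proof.
move=> a3 Bw Bw' sw sw' Wx t; have [_ fx] := transport_fibre t.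
have [s [sD sz st]] := transport_ex (clean_slab uni a) sw fx.
have t' := st _ sw'; exists (s w').
  exact: (trapped_transport (H := H) ep2 lc dep (clean_slab uni a) sw sw' Bw Bw' t').
apply/(transport_next (H := H) uni hr hu i (s w') a3 sw').
have [bs _] := base_slab uni a3.
exact: (transport_trans (H := H) (clean_slab uni a) bs sw sw' t t').
Qed.

Lemma arrives_turn i : arrives i -> arrives (turn i).
Proof.
move=> [x Wx t].
have rho0 : 0 < delta ^+ mult q by rewrite exprn_gt0//; case/andP: dep.
have [_ [z2 [z3 [z4 [_ [B2 X2 Y2] [B3 X3 Y3] [B4 X4 Y4]]]]]] := four_points rho0.
have sl a w : (a <= 3)%N -> B w -> quadrant v1 v2 a w -> slab a w.
  by move=> a3 Bw; apply: (quadrant_slab small).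
have {}t : transport (base 0) w1 (e (sheet 0 i)) x by rewrite /= perm1.
have [x2 W2 t2] := arrives_step (isT : (0 <= 3)%N) w1B B2 (sl 0%N _ isT w1B w1Y) (sl 0%N _ isT B2 Y2) Wx t.
have [x3 W3 t3] := arrives_step (isT : (1 <= 3)%N) B2 B3 (sl 1%N _ isT B2 X2) (sl 1%N _ isT B3 X3) W2 t2.
have [x4 W4 t4] := arrives_step (isT : (2 <= 3)%N) B3 B4 (sl 2%N _ isT B3 Y3) (sl 2%N _ isT B4 Y4) W3 t3.
have [x5 W5 t5] := arrives_step (isT : (3 <= 3)%N) B4 w1B (sl 3%N _ isT B4 X4) (sl 3%N _ isT w1B w1X) W4 t4.
by exists x5.
Qed.

Lemma arrives_transitive (E : {set 'I_n}) i j : (forall i, (turn i \in E) = (i \in E)) ->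
  arrives i -> i \in E -> arrives j -> j \in E.
Proof.
move=> tE [x Wx tx] iE [y Wy ty].
have zE z k : W z -> transport b w1 (e k) z -> w1 = corner + Phi z ^+ mult q.
  move=> [Vz _] /transport_fibre[_ fz]; apply: (model_lift ep2 lc Vz fz).
  apply: lt_le_trans w1B _; case/andP: dep => d0 d1; have d2 : delta <= 1 by move: ep2; lra.
  apply: (@le_trans _ _ delta); last by move: ep2; lra.
  have := mult_gt0 P0 q; case: (mult q) => // m _; rewrite exprSr ler_piMl ?(ltW d0)//.
  by rewrite exprn_ile1 ?(ltW d0).
have [w1x w1y] := (zE _ _ Wx tx, zE _ _ Wy ty).
have := corner_transitive (H := H) uni hr hu lc dep small tE Wx Wy.
rewrite /= -w1x -w1y => /(_ w1Y w1Y) [|k kE].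
  by exists i => //=; rewrite perm1 -w1x.
rewrite /= perm1 -w1y => tk; rewrite -(eb.1 k j) //.
exact: (transport_fun (H := H) (transport_sym tk) (transport_sym ty)).
Qed.

Lemma arrives_limit i s : section_on f (slabY v1 0) s -> s b = e i ->
  (forall A, nbhs q A -> exists2 rho, 0 < rho &
    forall w, slabY v1 0 w -> disc corner rho w -> A (s w)) -> arrives i.
Proof.
move=> sD sb lim; have /andP[d0 _] := dep.
have qW : nbhs q W by apply: open_nbhs_nbhs; split; [exact: (open_core lc)|exact: (core_center lc d0)].
have [rho rho0 h] := lim _ qW.
have rho1 : 0 < delta ^+ mult q by rewrite exprn_gt0.
have rm : 0 < Num.min rho (delta ^+ mult q) by rewrite lt_min rho0.
have [w2 [_ [_ [_ [[B2 X2 Y2] _ _ _]]]]] := four_points rm.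
have [Br Bd] : disc corner rho w2 /\ B w2 by move: B2; rewrite /B /disc /= lt_min => /andP.
have s2 : slabY v1 0 w2 := quadrant_slab small (a := 0) isT Bd Y2.
have s1 : slabY v1 0 w1 := quadrant_slab small (a := 0) isT w1B w1Y.
have cs : clean (slabY v1 0) := clean_slab uni 0.
have bs : slabY v1 0 b := center_slabY uni.
exists (s w1); last by rewrite -sb; exact: (transport_section cs sD bs s1).
apply: (trapped_transport (H := H) ep2 lc dep cs s2 s1 Bd w1B (transport_section cs sD s2 s1)).
exact: h.
Qed.

(** Here the local degree is 1, so the core contains a single point over [w1]. *)
Lemma arrives_regular i j : q <> P0 -> arrives i -> arrives j -> i = j.
Proof.
move=> qP [x Wx tx] [y Wy ty].
have zE z k : W z -> transport b w1 (e k) z -> Phi z = w1 - corner.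
  move=> [Vz _] /transport_fibre[_ fz]; have := model_lift ep2 lc Vz fz.
  rewrite (mult_neq qP) expr1 => -> //; first by rewrite addrAC subrr add0r.
  by apply: lt_le_trans w1B _; rewrite (mult_neq qP) expr1; move: dep ep2; lra.
have [_ _ h1 _ _] := lc; have [_ Kx _] := h1 x Wx.1; have [_ Ky _] := h1 y Wy.1.
apply: eb.1; apply: (transport_fun (H := H) (transport_sym tx)).
by rewrite -Kx (zE _ _ Wx tx) -(zE _ _ Wy ty) Ky; exact: transport_sym.
Qed.

(** The points of the core over [w1] correspond to the three cube roots of [w1 - corner]. *)
Lemma arrives_card : q = P0 -> #|[set i | `[< arrives i >]]%SET| = 3%N.
Proof.
move=> qP; have m3 : mult q = 3%N by rewrite /ram_index asboolT.
have /andP[d0 d1] := dep.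
have k0 : w1 - corner != 0.
  apply/eqP => /subr0_eq E; move: w1X; rewrite E; have [-> _] := corner_coord uni.
  by rewrite ltxx.
have [t0 [t1 [t2 [n01 n12 n02 [E0 E1 E2] all]]]] := cube_roots_exist k0.
have [_ _ h1 h2 [_ h4]] := lc; rewrite m3 in h4.
have s1 : slabY v1 0 w1 := quadrant_slab small (a := 0) isT w1B w1Y.
have cs : clean (slabY v1 0) := clean_slab uni 0.
have bs : slabY v1 0 b := center_slabY uni.
have root t : t ^+ 3 = w1 - corner -> exists i, [/\ arrives i, disc 0 ep t & transport b w1 (e i) (Psi t)].
  move=> tE; have td : disc 0 delta t.
    move: w1B; rewrite /B /disc /= m3 subr0 -tE cabsX.
    by rewrite ltr_pXn2r ?nnegrE ?cabs_ge0 ?(ltW d0).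
  have te : disc 0 ep t := disc_subset (ltW d1) td.
  have [Vt Pt _] := h2 t te.
  have ft : f (Psi t) = pi w1 by rewrite h4// Pt tE addrC subrK.
  have [i ti] := transport_center (H := H) eb cs bs s1 ft.
  exists i; split => //; exists (Psi t) => //; split => //; by rewrite Pt.
have [i0 [a0 e0 T0]] := root _ E0; have [i1 [a1 e1 T1]] := root _ E1; have [i2 [a2 e2 T2]] := root _ E2.
have ne t t' i : disc 0 ep t -> disc 0 ep t' -> transport b w1 (e i) (Psi t) ->
    transport b w1 (e i) (Psi t') -> t = t'.
  move=> te te' Tt Tt'; have := transport_fun (H := H) Tt Tt' => /(congr1 Phi).
  by have [_ -> _] := h2 _ te; have [_ -> _] := h2 _ te'.
have i01 : i0 != i1 by apply: contraNneq n01 => h; rewrite h in T0; exact/eqP/(ne _ _ i1 e0 e1 T0 T1).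
have i12 : i1 != i2 by apply: contraNneq n12 => h; rewrite h in T1; exact/eqP/(ne _ _ i2 e1 e2 T1 T2).
have i02 : i0 != i2 by apply: contraNneq n02 => h; rewrite h in T0; exact/eqP/(ne _ _ i2 e0 e2 T0 T2).
suff -> : [set i | `[< arrives i >]]%SET = [set i0; i1; i2]%SET.
  by rewrite -finset.setUA !cardsU1 !finset.inE cards1 negb_or i01 i12 i02.
apply/setP => i; rewrite !finset.inE; apply/asboolP/idP; last first.
  by rewrite -orbA => /or3P[]/eqP ->.
move=> [x [Vx Px] tx]; have [_ fx] := transport_fibre tx.
have PE : Phi x ^+ 3 = w1 - corner.
  have := model_lift ep2 lc Vx fx; rewrite m3 => E; rewrite [in RHS]E; first by rewrite addrAC subrr add0r.
  apply: lt_le_trans w1B _; rewrite m3; have d3 : delta <= 1 by move: ep2; lra.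
  apply: (@le_trans _ _ delta); last by move: ep2; lra.
  by rewrite exprSr ler_piMl ?(ltW d0)// exprn_ile1 ?(ltW d0).
have [_ Kx _] := h1 x Vx; rewrite -Kx in tx.
have lab k t : Phi x = t -> transport b w1 (e k) (Psi t) -> i = k.
  move=> <- tk; apply: eb.1.
  exact: (transport_fun (H := H) (transport_sym tx) (transport_sym tk)).
case: (all _ PE) => Pt.
- by rewrite (lab _ _ Pt T0) eqxx.
- by rewrite (lab _ _ Pt T1) eqxx orbT.
- by rewrite (lab _ _ Pt T2) eqxx !orbT.
Qed.

End AtPoint.
End Singular.
End Descent.

(** * Descent to a cyclic permutation *)

Section Reduction.
Variables (R : realType) (S : topologicalType) (f : S -> torus R) (P0 : S) (n : nat).
Context {H : branched_cover f P0 n}.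
Local Notation C := (cplx R).
Local Notation pi := (@torus_proj R).
Local Notation mult := (@ram_index S P0).
Local Notation transport := (transport f).

Section Singular.
Variables (v1 v2 : C) (uni : unimodular v1 v2).
Local Notation b := (center v1 v2).
Variables (e : 'I_n -> S) (r u : {perm 'I_n}).
Hypothesis eb : enumerates f e b.
Hypothesis hr : forall i, transport b (b + v1) (e i) (e (r i)).
Hypothesis hu : forall i, transport b (b + v2) (e i) (e (u i)).
Local Notation corner := (v1 + v2).
Local Notation turn := (turn r u).

Lemma corner_lattice : lattice corner.
Proof. by case: uni => l1 l2 _; exact: latticeD. Qed.

Lemma corner_data q : f q = pi corner -> exists V Phi Psi ep delta w1,
  [/\ [/\ ep <= 2^-1, local_coordinate f q (mult q) V Phi Psi ep corner & 0 < delta < ep],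
      forall w, disc corner (delta ^+ mult q) w -> `|cross w v2 - 1| < 1 /\ `|cross v1 w - 1| < 1 &
      [/\ disc corner (delta ^+ mult q) w1, cross w1 v2 < 1 & cross v1 w1 < 1]].
Proof.
move=> fq; have [rho rho0 small] := near_corner uni.
have [V [Phi [Psi [ep [_ ep2 lc]]]]] := model_at (H := H) fq (@ltr01 R).
have [e0 _ _ _ _] := lc.
pose delta := Num.min (ep / 2) rho.
have d0 : 0 < delta by rewrite lt_min rho0 divr_gt0.
have de : delta < ep by rewrite gt_min; apply/orP; left; lra.
have dr : delta <= rho by rewrite ge_min lexx orbT.
have dm : delta ^+ mult q <= rho.
  apply: le_trans dr; have d1 : delta <= 1 by lra.
  have := mult_gt0 P0 q; case: (mult q) => // m _; rewrite exprSr ler_piMl ?(ltW d0)//.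
  by rewrite exprn_ile1 ?(ltW d0).
have rho1 : 0 < delta ^+ mult q by rewrite exprn_gt0.
have [w1 [_ [_ [_ [[B1 X1 Y1] _ _ _]]]]] := four_points uni rho1.
exists V, Phi, Psi, ep, delta, w1; split => //; first by rewrite d0 de.
by move=> w /(disc_subset dm); exact: small.
Qed.

Lemma corner_limit i : exists q s, [/\ f q = pi corner, section_on f (slabY v1 0) s, s b = e i &
  forall A, nbhs q A -> exists2 rho, 0 < rho &
    forall w, slabY v1 0 w -> disc corner rho w -> A (s w)].
Proof.
have cs : clean (slabY v1 0) := clean_slab uni 0.
have bs : slabY v1 0 b := center_slabY uni.
have fi : f (e i) = pi b by apply/(eb.2); exists i.
have [s [sD sb _]] := transport_ex (H := H) cs bs fi.
have [rho|q [fq lim]] := section_limit (H := H) cs sD (p := corner).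
  move=> rho0; have [rho' rho'0 small] := near_corner uni.
  have rm : 0 < Num.min rho rho' by rewrite lt_min rho0.
  have [w1 [_ [_ [_ [[B1 X1 Y1] _ _ _]]]]] := four_points uni rm.
  have [Br Br'] : disc corner rho w1 /\ disc corner rho' w1.
    by move: B1; rewrite /disc /= lt_min => /andP.
  exists w1; split => //; have [_] := small _ Br'; rewrite ltr_norml => /andP[h1 h2].
  by split => /=; lra.
by exists q, s.
Qed.

(** The sheets arriving at [P0] are three, and [turn] permutes them transitively. Any other sheet
    arrives at some q other than [P0]; it is alone there, so [turn] fixes it. *)
Lemma singular_points : exists x y z, [/\ x != y, y != z, x != z &
  [/\ u (r x) = r (u y), u (r y) = r (u z), u (r z) = r (u x) &
      forall t, t \notin [set x; y; z]%SET -> u (r t) = r (u t)]].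
Proof.
have fP : f P0 = pi corner.
  rewrite (cover_origin H); apply/proj_lattice; rewrite sub0r; exact/latticeN/corner_lattice.
have [V [Phi [Psi [ep [delta [w1 [[ep2 lc dep] small [B1 X1 Y1]]]]]]]] := corner_data fP.
pose I := [set i | `[< arrives f v1 v2 e V Phi delta w1 i >]]%SET.
have I3 : #|I| = 3%N by exact: (arrives_card (H := H) uni eb ep2 lc dep small B1 X1 Y1 erefl).
have [x [y [z [xy yz xz IE [cx cy cz]]]]] : exists x y z, [/\ x != y, y != z, x != z, I = [set x; y; z]%SET &
    [/\ turn x = y, turn y = z & turn z = x]].
  apply: three_cycle => //.
    move=> i; rewrite !finset.inE => /asboolP h; apply/asboolP.
    exact: (arrives_turn (H := H) uni hr hu ep2 lc dep small B1 X1 Y1).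
  move=> E tE i j; rewrite !finset.inE => /asboolP hi iE /asboolP hj.
  exact: (arrives_transitive (H := H) uni eb hr hu ep2 lc dep small B1 Y1 tE hi iE hj).
exists x, y, z; split => //; split.
- by rewrite (turnE r u x) cx.
- by rewrite (turnE r u y) cy.
- by rewrite (turnE r u z) cz.
move=> t; rewrite -IE => tI; rewrite (turnE r u t); congr (r (u _)).
have [q [s [fq sD sb lim]]] := corner_limit t.
have [qP|qP] := pselect (q = P0).
  case/negP: tI; rewrite finset.inE; apply/asboolP; rewrite qP in lim.
  exact: (arrives_limit (H := H) uni ep2 lc dep small B1 Y1 sD sb lim).
have [V' [Phi' [Psi' [ep' [delta' [w1' [[ep2' lc' dep'] small' [B1' X1' Y1']]]]]]]] := corner_data fq.
have at' := arrives_limit (H := H) uni ep2' lc' dep' small' B1' Y1' sD sb lim.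
apply: (arrives_regular (H := H) eb ep2' lc' dep' B1' qP _ at').
exact: (arrives_turn (H := H) uni hr hu ep2' lc' dep' small' B1' X1' Y1' at').
Qed.

End Singular.

(** The sign of the second vector keeps the determinant equal to 1. *)
Lemma unimodular_shear (v1 v2 : C) k : unimodular v1 v2 -> unimodular (v2 + v1 *+ k) (- v1).
Proof.
move=> [l1 l2 c12]; split; [exact: latticeD (latticeMn k l1)|exact: latticeN|].
by rewrite crossNr crossDl crossMnl crossvv mulr0 addr0 -crossC.
Qed.

Lemma monodromy_ex (v1 v2 : C) : unimodular v1 v2 -> exists (e : 'I_n -> S) (r u : {perm 'I_n}),
  [/\ enumerates f e (center v1 v2),
      forall i, transport (center v1 v2) (center v1 v2 + v1) (e i) (e (r i)) &
      forall i, transport (center v1 v2) (center v1 v2 + v2) (e i) (e (u i))].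
Proof.
move=> uni; have [l1 l2 c12] := uni; set b := center v1 v2.
have cH : clean (slabY v1 0) := clean_slab uni 0.
have cV : clean (slabX v2 0) := clean_slab uni 3.
have bH : slabY v1 0 b := center_slabY uni.
have bV : slabX v2 0 b := center_slabX uni.
have rb : regular_pt b by case: cH => _ _; exact.
have [e eb] := enumeration (H := H) rb.
have e1 : enumerates f e (b + v1).
  by apply: enumerates_proj eb; apply/proj_lattice; rewrite opprD addNKr; exact: latticeN.
have e2 : enumerates f e (b + v2).
  by apply: enumerates_proj eb; apply/proj_lattice; rewrite opprD addNKr; exact: latticeN.
have [r hr] := transport_perm (H := H) cH bH (slabY_shift bH) eb e1.
have [u hu] := transport_perm (H := H) cV bV (slabX_shift bV) eb e2.
by exists e, r, u.
Qed.

Lemma card_porbits_conj (T : finType) (s t : {perm T}) (g : T -> T) :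
  (forall i, t (g i) = g (s i)) -> (forall j, exists i, j = g i) -> (#|porbits t| <= #|porbits s|)%N.
Proof.
move=> tg sg.
pose F (A : {set T}) := [set g x | x in A]%SET.
have sub : porbits t \subset [set F A | A in porbits s]%SET.
  apply/fintype.subsetP => _ /imsetP[j _ ->]; have [i ->] := sg j.
  apply/imsetP; exists (porbit s i); first exact: imset_f.
  have it k : iter k t (g i) = g (iter k s i) by elim: k => //= k ->.
  apply/setP => j'; apply/porbit_iterP/imsetP => [[k ->]|[_ /porbit_iterP[k ->] ->]].
    by exists (iter k s i); [exact: mem_porbit_iter|exact: it].
  by exists k; rewrite it.
exact: leq_trans (fintype.subset_leq_card sub) (leq_imset_card _ _).
Qed.

(** Going k times along [v1] and then along [v2] is [r ^+ k * u]. The triangle closed by the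
    straight segment along [v1'] contains no lattice point, so the straight path has the same
    effect, and changing the base point only conjugates. *)
Lemma shear_cycles (v1 v2 : C) (e : 'I_n -> S) (r u : {perm 'I_n}) k : unimodular v1 v2 ->
  enumerates f e (center v1 v2) ->
  (forall i, transport (center v1 v2) (center v1 v2 + v1) (e i) (e (r i))) ->
  (forall i, transport (center v1 v2) (center v1 v2 + v2) (e i) (e (u i))) ->
  forall (e' : 'I_n -> S) (r' : {perm 'I_n}),
  let v1' := v2 + v1 *+ k in let b' := center v1' (- v1) in
  enumerates f e' b' -> (forall i, transport b' (b' + v1') (e' i) (e' (r' i))) ->
  (#|porbits r'| <= #|porbits (r ^+ k * u)%g|)%N.
Proof.
move=> uni eb hr hu e' r' v1' b' eb' hr'; have [l1 l2 c12] := uni.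
have uni' : unimodular v1' (- v1) := unimodular_shear k uni.
have [l1' l2' c12'] := uni'.
set b := center v1 v2 in eb hr hu.
have [bX bY] := (centerX uni, centerY uni); rewrite -/b in bX bY.
have cH : clean (slabY v1 0) := clean_slab uni 0.
have cV : clean (slabX v2 0) := clean_slab uni 3.
have bH : slabY v1 0 b := center_slabY uni.
have bV : slabX v2 0 b := center_slabX uni.
(* The starting point [z1] is put so low that [k * d < 1/2]: the broken path then stays to the right
   of the line through 0 along [v1'], and [z1] lies in the adjacent strip of the new basis. *)
pose d : R := (2 * k%:R + 3)^-1.
have k0 : 0 <= k%:R :> R by [].
have K0 : 0 < 2 * k%:R + 3 :> R by lra.
have d0 : 0 < d by rewrite invr_gt0.
have dK : d * (2 * k%:R + 3) = 1 by rewrite /d mulVf// gt_eqF.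
have kd : k%:R * d < 2^-1 by nra.
have d1 : d < 1 by nra.
pose z1 : C := rcplx 2^-1 * v1 + rcplx d * v2.
have zX : cross z1 v2 = 2^-1 by rewrite crossDl !crossZl c12 crossvv; ring.
have zY : cross v1 z1 = d by rewrite crossDr !crossZr c12 crossvv; ring.
have zH : slabY v1 0 z1 by split; rewrite /= zY; lra.
have zV : slabX v2 0 z1 by split; rewrite /= zX; lra.
have rz : regular_pt z1 by case: cH => _ _; exact.
have [e1 ez] := enumeration (H := H) rz.
have [g hg] := transport_perm (H := H) cH bH zH eb ez.
pose y i := e1 (g i).
have yz : enumerates f y z1.
  split; first by move=> i j /(ez.1)/perm_inj.
  move=> p; split => [/(ez.2)[i ->]|[i ->]]; last by apply/(ez.2); exists (g i).
  by exists (g^-1 i)%g; rewrite /y permKV.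
have by_ i : transport b z1 (e i) (y i) := hg i.
have tk i : transport z1 (z1 + v1 *+ k) (y i) (y (iter k r i)).
  have zk : slabY v1 0 (z1 + v1 *+ k) by apply: DMn => // z; exact: slabY_shift.
  have bk : slabY v1 0 (b + v1 *+ k) by apply: DMn => // z; exact: slabY_shift.
  have t1 := transport_iter (H := H) cH (fun z => @slabY_shift R v1 0 z) bH l1 eb hr k i.
  have t2 := transport_shift (latticeMn k l1) (by_ (iter k r i)).
  have t3 := transport_trans (H := H) cH bH bk zk t1 t2.
  exact: (transport_trans (H := H) cH zH bH zk (transport_sym (by_ i)) t3).
have tu i : transport z1 (z1 + v2) (y i) (y (u i)).
  have t2 := transport_shift l2 (by_ (u i)).
  have t3 := transport_trans (H := H) cV bV (slabX_shift bV) (slabX_shift zV) (hu i) t2.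
  exact: (transport_trans (H := H) cV zV bV (slabX_shift zV) (transport_sym (by_ i)) t3).
have tv i : transport z1 (z1 + v1') (y i) (y ((r ^+ k * u)%g i)).
  have t1 := tk i; have t2 := transport_shift (latticeMn k l1) (tu (iter k r i)).
  (* On the line y = 1, which carries the only lattice points to be feared, D is
     the open interval k < x < k + 1. *)
  pose D := ([set z | 0 < cross v1 z] `&` [set z | cross v1 z < 2]) `&`
     ([set z | cross z v2 < k%:R + 1] `&` [set z | 0 < cross z v1']).
  have lX z : cross z v1' = cross z v2 - k%:R * cross v1 z.
    by rewrite crossDr crossMnr (crossC z v1) mulrN.
  have cD : clean D.
    split.
    - apply: openI; apply: openI.
      + exact: (@open_affine_gt R (fun z => cross v1 z) 0 (affine_crossr v1)).
      + exact: (@open_affine_lt R (fun z => cross v1 z) 2 (affine_crossr v1)).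
      + exact: (@open_affine_lt R (fun z => cross z v2) (k%:R + 1) (affine_crossl v2)).
      + exact: (@open_affine_gt R (fun z => cross z v1') 0 (affine_crossl v1')).
    - apply: convexCI; apply: convexCI.
      + exact: (@convex_affine_gt R (fun z => cross v1 z) 0 (affine_crossr v1)).
      + exact: (@convex_affine_lt R (fun z => cross v1 z) 2 (affine_crossr v1)).
      + exact: (@convex_affine_lt R (fun z => cross z v2) (k%:R + 1) (affine_crossl v2)).
      + exact: (@convex_affine_gt R (fun z => cross z v1') 0 (affine_crossl v1')).
    move=> z [[/= h1 h2] [/= h3 h4]]; apply/regular_lattice/negP => /(lattice_coord uni)[xi yi].
    have Y1 : cross v1 z = 1.
      apply/eqP; rewrite -subr_eq0; apply/eqP; apply: int_small; first by rewrite rpredB// rpred1.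
      by rewrite ltr_norml; apply/andP; split; lra.
    move: h4; rewrite lX Y1 mulr1 subr_gt0 => h4.
    by apply: (int_between xi (rpred_nat _ k)); rewrite h4.
  have X2 : cross (z1 + v1 *+ k) v2 = 2^-1 + k%:R by rewrite crossDl crossMnl c12 zX mulr1.
  have Y2 : cross v1 (z1 + v1 *+ k) = d by rewrite crossDr crossMnr crossvv zY mulr0 addr0.
  have X3 : cross (z1 + v2 + v1 *+ k) v2 = 2^-1 + k%:R.
    by rewrite crossDl (crossDl z1) crossMnl c12 crossvv zX mulr1 addr0.
  have Y3 : cross v1 (z1 + v2 + v1 *+ k) = d + 1.
    by rewrite crossDr (crossDr _ z1) crossMnr crossvv c12 zY mulr0 addr0.
  have D1 : D z1 by split; split; rewrite /= ?lX ?zX ?zY; lra.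
  have D2 : D (z1 + v1 *+ k) by split; split; rewrite /= ?lX ?X2 ?Y2; lra.
  have D3 : D (z1 + v2 + v1 *+ k) by split; split; rewrite /= ?lX ?X3 ?Y3; lra.
  have := transport_trans (H := H) cD D1 D2 D3 t1 t2.
  by rewrite permM permX -addrA.
(* The new centre lies in the strip of index 0 of [v1'] and [z1] in that of index -1; subtracting
   the second vector [- v1] of the new basis brings the centre next to [z1]. *)
pose b2 := b' - - v1.
have sl' : clean (slabY v1' (-1)) by apply: (clean_slabY uni'); rewrite rpredN rpred1.
have b2Y : cross v1' b2 = - 2^-1 by rewrite crossBr (centerY uni') c12'; lra.
have b2S : slabY v1' (-1) b2 by split; rewrite /= b2Y; lra.
have z1Y : cross v1' z1 = k%:R * d - 2^-1.
  by rewrite crossDl crossMnl zY (crossC v2) zX; ring.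
have z1S : slabY v1' (-1) z1 by split; rewrite /= z1Y; nra.
have e2 : enumerates f e' b2.
  by apply: enumerates_proj eb'; apply/proj_lattice; rewrite /b2 opprB addrCA subrr addr0; exact: l2'.
have [th hth] := transport_perm (H := H) sl' z1S b2S yz e2.
apply: (@card_porbits_conj _ (r ^+ k * u)%g r' th) => [i|j]; last by exists (th^-1 j)%g; rewrite permKV.
have t1 := transport_shift (latticeN l2') (hr' (th i)); rewrite -/b2 in t1.
have b3 : b' + v1' - - v1 = b2 + v1' by rewrite /b2; ring.
rewrite b3 in t1.
have t2 := transport_shift l1' (hth ((r ^+ k * u)%g i)).
have z1S' := slabY_shift z1S; have b2S' := slabY_shift b2S.
have t3 := transport_trans (H := H) sl' z1S z1S' b2S' (tv i) t2.
have t4 := transport_trans (H := H) sl' b2S z1S b2S' (transport_sym (hth i)) t3.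
exact: (eb'.1 _ _ (transport_fun (H := H) t1 t4)).
Qed.

Theorem one_cycle_basis : prime n -> exists (v1 v2 : C) (e : 'I_n -> S) (r : {perm 'I_n}),
  [/\ unimodular v1 v2, enumerates f e (center v1 v2),
      forall i, transport (center v1 v2) (center v1 v2 + v1) (e i) (e (r i)) &
      forall p q, q \in porbit r p].
Proof.
move=> npr.
suff ind m : forall (v1 v2 : C) (e : 'I_n -> S) (r u : {perm 'I_n}), unimodular v1 v2 -> enumerates f e (center v1 v2) ->
    (forall i, transport (center v1 v2) (center v1 v2 + v1) (e i) (e (r i))) ->
    (forall i, transport (center v1 v2) (center v1 v2 + v2) (e i) (e (u i))) ->
    (#|porbits r| <= m)%N -> exists (v1 v2 : C) (e : 'I_n -> S) (r : {perm 'I_n}),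
    [/\ unimodular v1 v2, enumerates f e (center v1 v2),
      forall i, transport (center v1 v2) (center v1 v2 + v1) (e i) (e (r i)) &
      forall p q, q \in porbit r p].
  have uni : @unimodular R 1 'i%C.
    split; rewrite ?latticeE /= ?rpred0 ?rpred1// /cross /=; ring.
  have [e [r [u [h1 h2 h3]]]] := monodromy_ex uni.
  exact: ind uni h1 h2 h3 (leqnn _).
elim: m => [|m IH] v1 v2 e r u uni eb hr hu rm.
  have i0 : 'I_n by exists 0%N; exact: prime_gt0.
  move: rm; rewrite leqn0 cards_eq0 => /eqP r0.
  have : porbit r i0 \in porbits r by exact: imset_f.
  by rewrite r0 finset.inE.
have [all|] := pselect (forall p q, q \in porbit r p); first by exists v1, v2, e, r.
move=> /existsNP[p /existsNP[q /negP qp]].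
have [x [y [z [xy yz xz [ux uy uz reg]]]]] := singular_points uni eb hr hu.
have card : prime #|'I_n| by rewrite card_ord.
have trans (E : {set 'I_n}) : (forall i, (r i \in E) = (i \in E)) ->
    (forall i, (u i \in E) = (i \in E)) -> E = finset.set0 \/ E = finset.setT.
  by move=> rE uE; exact: (invariant_trivial (H := H) uni eb hr hu rE uE).
have [k kN] := fewer_cycles card trans xy yz xz ux uy uz reg qp.
have [e' [r' [u' [h1 h2 h3]]]] := monodromy_ex (unimodular_shear k uni).
apply: (IH _ _ e' r' u' (unimodular_shear k uni) h1 h2 h3).
apply: leq_trans (shear_cycles uni eb hr hu h1 h2) _.
by rewrite -ltnS; exact: leq_trans kN rm.
Qed.

End Reduction.

(** * The strip and its lower edge *)

Section OneCylinder.
Variables (R : realType) (S : topologicalType) (f : S -> torus R) (P0 : S) (n : nat).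
Context {H : branched_cover f P0 n}.
Local Notation C := (cplx R).
Local Notation pi := (@torus_proj R).
Local Notation mult := (@ram_index S P0).
Local Notation transport := (transport f).
Variables (v1 v2 : C) (uni : unimodular v1 v2).
Local Notation b := (center v1 v2).
Variables (e : 'I_n -> S) (r : {perm 'I_n}).
Hypothesis eb : enumerates f e b.
Hypothesis hr : forall i, transport b (b + v1) (e i) (e (r i)).
Hypothesis one_cycle : forall p q, q \in porbit r p.
Variables (i0 : 'I_n) (sg : C -> S).
Local Notation Hs := (slabY v1 0).
Hypothesis sgD : section_on f Hs sg.
Hypothesis sgb : sg b = e i0.

Let lat1 : lattice v1. Proof. by case: uni. Qed.
Let lat2 : lattice v2. Proof. by case: uni. Qed.
Let c12 : cross v1 v2 = 1. Proof. by case: uni. Qed.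
Let cH : clean Hs. Proof. exact: (clean_slab uni 0). Qed.
Let bH : Hs b. Proof. exact: center_slabY. Qed.
Let shH z : Hs z -> Hs (z + v1). Proof. exact: slabY_shift. Qed.

Lemma slabYMn z k : Hs z -> Hs (z + v1 *+ k).
Proof. by move=> Hz; apply: DMn => // w; exact: shH. Qed.

Lemma transport_sg z : Hs z -> transport b z (e i0) (sg z).
Proof. by move=> Hz; rewrite -sgb; exact: (transport_section cH sgD bH Hz). Qed.

(** Translation by k [v1] along the strip applies [r] k times, so the labels of a fibre are
    successive values of the single section [sg]. *)
Lemma sg_shift z k x : Hs z -> transport b z (e (iter k r i0)) x <-> sg (z + v1 *+ k) = x.
Proof.
move=> Hz; have zk := slabYMn k Hz; have bk := slabYMn k bH.
have t1 := transport_iter (H := H) cH shH bH lat1 eb hr k i0.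
split => [t|<-].
  have t2 := transport_trans (H := H) cH bH bk zk t1 (transport_shift (latticeMn k lat1) t).
  exact: (transport_fun (H := H) (transport_sg zk) t2).
exact: (transport_unshift (H := H) cH shH bH lat1 eb hr Hz (transport_sg zk)).
Qed.

(** As [r] is a single cycle, every label occurs along the strip. *)
Lemma sg_surj z x : Hs z -> f x = pi z -> exists k : nat, sg (z + v1 *+ k) = x.
Proof.
move=> Hz fx; have [i ti] := transport_center (H := H) eb cH bH Hz fx.
have /porbit_iterP[k ik] := one_cycle i0 i; exists k; apply/(sg_shift _ _ Hz).
by rewrite -ik.
Qed.

Lemma porbit_all : #|porbit r i0| = n.
Proof.
have -> : porbit r i0 = [set: 'I_n]%SET.
  by apply/setP => j; rewrite one_cycle finset.inE.
by rewrite cardsT card_ord.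
Qed.

Lemma sg_period z k : Hs z -> sg (z + v1 *+ k) = sg z <-> (n %| k)%N.
Proof.
move=> Hz; have n0 : (0 < n)%N by apply: leq_ltn_trans (leq0n i0) (ltn_ord i0).
have iter_n : iter n r i0 = i0 by have := iter_porbit r i0; rewrite porbit_all.
rewrite -(sg_shift k _ Hz); split => [t|/dvdnP[m ->]].
  have E : iter k r i0 = i0.
    by apply: (proj1 eb); exact: (transport_fun (H := H) (transport_sym t) (transport_sym (transport_sg Hz))).
  rewrite /dvdn; apply: contraT => k0.
  have : iter 0 r i0 != iter (k %% n) r i0.
    by apply: porbit_iter_neq; rewrite porbit_all lt0n k0 ltn_pmod.
  by rewrite iter_mod// E eqxx.
by rewrite -(iter_mod (m * n) iter_n) modnMl; exact: transport_sg.
Qed.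

Definition boundary_at (x : R) (q : S) := f q = pi (rcplx x * v1) /\
  forall A, nbhs q A -> exists2 rho, 0 < rho &
    forall w, Hs w -> disc (rcplx x * v1) rho w -> A (sg w).

Lemma near_boundary (x rho : R) : 0 < rho ->
  exists w, Hs w /\ disc (rcplx x * v1) rho w.
Proof.
move=> rho0; pose M := cabs v2 + 1; have M0 : 0 < M by rewrite ltr_wpDl ?cabs_ge0.
pose t := Num.min 2^-1 (rho / M / 2).
have t0 : 0 < t by rewrite lt_min invr_gt0 ltr0n !divr_gt0.
have t1 : t <= 2^-1 by rewrite ge_min lexx.
have t2 : t * M < rho.
  have : t <= rho / M / 2 by rewrite ge_min lexx orbT.
  have h : rho / M / 2 * M = rho / 2 by field; rewrite gt_eqF.
  by move=> /(ler_wpM2r (ltW M0)); rewrite h; lra.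
exists (rcplx x * v1 + rcplx t * v2); split.
  by split; rewrite /= crossDr !crossZr crossvv c12; lra.
rewrite /disc /= addrAC subrr add0r cabsM cabs_rcplx ger0_norm ?(ltW t0)//.
by move: t2; rewrite /M; lra.
Qed.

Lemma boundary_ex x : exists q, boundary_at x q.
Proof.
have [rho rho0|q [fq lim]] := section_limit (H := H) cH sgD (p := rcplx x * v1).
  by have [w [Hw dw]] := near_boundary x rho0; exists w.
by exists q.
Qed.

Lemma boundary_closed x q (A : set S) rho : boundary_at x q -> closed A -> 0 < rho ->
  (forall w, Hs w -> disc (rcplx x * v1) rho w -> A (sg w)) -> A q.
Proof.
move=> [_ lim] cA rho0 h; apply: contrapT => nA.
have oA : open (~` A) by rewrite openC.
have [rho' rho'0 h'] := lim _ (open_nbhs_nbhs (conj oA nA)).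
have rm : 0 < Num.min rho rho' by rewrite lt_min rho0.
have [w [Hw]] := near_boundary x rm; rewrite /disc /= lt_min => /andP[d1 d2].
by apply: (h' w Hw d2); exact: h.
Qed.

Lemma boundary_unique x q q' : boundary_at x q -> boundary_at x q' -> q = q'.
Proof.
move=> bq [_ lim]; apply: contrapT => /(separated (H := H))[A [B [Aq Bq oA oB AB]]].
have [rho rho0 h] := lim _ (open_nbhs_nbhs (conj oB Bq)).
suff : (~` A) q by [].
have cA : closed (~` A) by rewrite closedC.
apply: (boundary_closed bq cA rho0) => w Hw dw Aw; exact: (AB _ Aw (h w Hw dw)).
Qed.

Lemma boundary_period x q : boundary_at x q -> boundary_at (x + n%:R) q.
Proof.
have E : rcplx (x + n%:R) * v1 = rcplx x * v1 + v1 *+ n.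
  by rewrite rcplxD mulrDl /rcplx rmorph_nat mulr_natl.
move=> [fq lim]; split.
  rewrite fq E; apply/proj_lattice; rewrite opprD addNKr; exact/latticeN/latticeMn.
move=> A /lim[rho rho0 h]; exists rho => // w Hw dw.
have Hw' : Hs (w - v1 *+ n).
  by case: Hw => h1 h2; split; rewrite /= crossBr crossMnr crossvv mulr0 subr0.
have <- : sg (w - v1 *+ n) = sg w by apply/esym; rewrite -{1}(subrK (v1 *+ n) w); apply/(sg_period n Hw').
apply: h => //; move: dw; rewrite /disc /= E.
by congr (cabs _ < _); ring.
Qed.

Lemma core_cdisc q z V Phi Psi ep delta : local_coordinate f q (mult q) V Phi Psi ep z ->
  delta < ep -> closed (Psi @` [set w | cabs (w - 0) <= delta]) /\
   (core V Phi delta `<=` Psi @` [set w | cabs (w - 0) <= delta]) /\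
   (Psi @` [set w | cabs (w - 0) <= delta] `<=` core V Phi ep).
Proof.
move=> lc de; have [e0 _ _ h2 _] := lc.
have D w : cabs (w - 0) <= delta -> disc 0 ep w by move=> h; exact: le_lt_trans de.
split; last split.
- apply: compact_closed; first exact: cover_hausdorff H.
  apply: continuous_compact; last exact: compact_cdisc.
  by apply: continuous_in_subspaceT => w; rewrite inE => /D/h2[].
- move=> x /(coreP lc _ (ltW de))[w wd ->]; exists w => //; exact: ltW.
by move=> _ [w /D wd <-]; apply/(coreP lc _ (lexx _)); exists w.
Qed.

Definition bd x : S := projT1 (cid (boundary_ex x)).

Lemma bdP x : boundary_at x (bd x). Proof. exact: projT2 (cid (boundary_ex x)). Qed.

Lemma f_bd x : f (bd x) = pi (rcplx x * v1). Proof. by have [] := bdP x. Qed.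

Lemma bd_period x : bd (x + n%:R) = bd x.
Proof. exact: boundary_unique (bdP _) (boundary_period (bdP x)). Qed.

Lemma bd_continuous : continuous bd.
Proof.
move=> x A bA; have [V [Phi [Psi [ep [_ ep2 lc]]]]] := model_at (H := H) (f_bd x) (@ltr01 R).
have [d /andP[d0 de] dA] := core_basis lc bA.
(* Boundary values of points in the core of radius [d2] lie in the closed core of that radius, hence
   still in the core of radius d. *)
pose d2 := d / 2; have d20 : 0 < d2 by rewrite divr_gt0.
have d2e : d2 < ep by rewrite /d2; lra.
have [cl [sub1 _]] := core_cdisc lc d2e.
have [_ lim] := bdP x.
have cn : nbhs (bd x) (core V Phi d2).
  by apply: open_nbhs_nbhs; split; [exact: (open_core lc)|exact: (core_center lc d20)].
have [rho rho0 h] := lim _ cn.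
have r2 : 0 < rho / 2 by rewrite divr_gt0.
have cl2 : continuous (fun t : R => rcplx t * v1).
  have -> : (fun t : R => rcplx t * v1) = (fun t : R => 0 + rcplx t * v1).
    by apply/funext => t; rewrite add0r.
  exact: line_continuous.
suff : nbhs x (bd @^-1` A) by [].
apply: filterS (near_cabs (cl2 x) r2) => y xy; apply: dA.
have : (Psi @` [set w | cabs (w - 0) <= d2]) (bd y).
  apply: (boundary_closed (bdP y) cl r2) => w Hw dw; apply: sub1; apply: h => //.
  by rewrite /disc /=; have := cabs_sub_le w (rcplx x * v1) (rcplx y * v1); move: dw; rewrite /disc /=; lra.
move=> [w /= wd <-]; apply/(coreP lc _ (ltW de)); exists w => //.
by rewrite /disc /=; rewrite /d2 in wd; lra.
Qed.

(** An m-th root in the model gives a point near q lying over the strip; it is a value of [sg]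
    shifted by some k. Trapping keeps [sg] near q there, so [bd (x + k)] lies in a small core of q
    above its centre, where q is the only point. *)
Lemma bd_surj (x : R) q : f q = pi (rcplx x * v1) -> exists k : nat, bd (x + k%:R) = q.
Proof.
move=> fq; have [V [Phi [Psi [ep [_ ep2 lc]]]]] := model_at (H := H) fq (@ltr01 R).
have [e0 _ h1 h2 [h3 h4]] := lc.
have de : 0 < ep / 2 < ep by apply/andP; split; lra.
have /andP[d0 d1] := de; set d := ep / 2 in de d0 d1.
have rho0 : 0 < d ^+ mult q by rewrite exprn_gt0.
have [w [Hw dw]] := near_boundary x rho0.
have [t tE] := cplx_root (w - rcplx x * v1) (mult_gt0 P0 q).
have td : disc 0 d t.
  move: dw; rewrite /disc /= subr0 -tE cabsX.
  by rewrite ltr_pXn2r ?nnegrE ?cabs_ge0 ?(ltW d0)//; exact: mult_gt0.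
have te : disc 0 ep t := disc_subset (ltW d1) td.
have [Vt Pt _] := h2 t te.
have ft : f (Psi t) = pi w by rewrite h4// Pt tE addrC subrK.
have [k sk] := sg_surj Hw ft; exists k.
have ct : core V Phi d (Psi t) by split => //; rewrite Pt.
have E : rcplx (x + k%:R) * v1 = rcplx x * v1 + v1 *+ k.
  by rewrite rcplxD mulrDl /rcplx rmorph_nat mulr_natl.
have [cl [sub1 sub2]] := core_cdisc lc d1.
have : (Psi @` [set w | cabs (w - 0) <= d]) (bd (x + k%:R)).
  apply: (boundary_closed (bdP _) cl rho0) => w' Hw'; rewrite E => dw'; apply: sub1.
  have Hw'' : Hs (w' - v1 *+ k).
    by case: Hw' => a1 a2; split; rewrite /= crossBr crossMnr crossvv mulr0 subr0.
  have dw'' : disc (rcplx x * v1) (d ^+ mult q) (w' - v1 *+ k).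
    by move: dw'; rewrite /disc /=; congr (cabs _ < _); ring.
  have t1 := transport_section cH sgD (slabYMn k Hw) Hw'.
  have t2 := transport_shift (latticeN (latticeMn k lat1)) t1; rewrite addrK sk in t2.
  exact: (trapped_transport (H := H) ep2 lc de cH Hw Hw'' dw dw'' t2 ct).
move=> /sub2[Vb Pb]; have fb := f_bd (x + k%:R); rewrite E in fb.
have fb' : f (bd (x + k%:R)) = pi (rcplx x * v1).
  by rewrite fb; apply/proj_lattice; rewrite addrAC subrr add0r; exact: latticeMn.
have z0 : cabs (rcplx x * v1 - rcplx x * v1) < 2^-1 by rewrite subrr cabs0; lra.
have := model_lift ep2 lc Vb fb' z0 => /eqP; rewrite -{1}[rcplx x * v1]addr0 (inj_eq (addrI _)) eq_sym expf_eq0.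
move=> /andP[_ /eqP P00]; have [_ <- _] := h1 _ Vb.
by rewrite P00; exact: Psi0 lc.
Qed.

Lemma bd_P0 x : bd x = P0 -> x \is a Num.int.
Proof.
move=> bP; have := f_bd x; rewrite bP (cover_origin H) => /proj_lattice.
rewrite sub0r => /latticeN; rewrite opprK => /(lattice_coord uni)[].
by rewrite crossZl c12 mulr1.
Qed.

Lemma bd_P0_ex : exists k : nat, bd k%:R = P0.
Proof.
have [k kE] : exists k : nat, bd (0 + k%:R) = P0.
  by apply: bd_surj; rewrite (cover_origin H) /rcplx rmorph0 mul0r.
by exists k; rewrite add0r in kE.
Qed.

Lemma bd_periodZ x (m : int) : bd (x + m%:~R * n%:R) = bd x.
Proof.
have P y (k : nat) : bd (y + k%:R * n%:R) = bd y.
  elim: k => [|k IH]; first by rewrite mul0r addr0.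
  by rewrite -natr1 mulrDl mul1r addrA bd_period.
case: m => m; first by rewrite -pmulrn P.
by have := P (x - m.+1%:R * n%:R) m.+1; rewrite subrK NegzE mulrNz -pmulrn mulNr.
Qed.

(** Passages through [P0] occur only at integers and recur with period n, so there are a last one up
    to x and a first one after x. *)
Lemma bd_segment x : exists j j' : R, [/\ j <= x < j', bd j = P0, bd j' = P0 &
  forall y, j < y < j' -> bd y <> P0].
Proof.
have n0 : (0 < n)%N by apply: leq_ltn_trans (leq0n i0) (ltn_ord i0).
have n1 : 1 <= n%:R :> R by rewrite ler1n.
have [k kE] := bd_P0_ex.
(* Removing periods from any passage gives one not after x; from there, later passages are at
   natural distances, and maxima and minima over the naturals apply. *)
have [a [a_int ax aE]] : exists a : R, [/\ a \is a Num.int, a <= x & bd a = P0].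
  pose m := Num.floor ((x - k%:R) / n%:R).
  exists (k%:R + m%:~R * n%:R); split.
  - by rewrite rpredD ?rpredM ?rpred_nat ?intr_int.
  - have := floor_le ((x - k%:R) / n%:R); rewrite -/m ler_pdivlMr; last lra.
    by lra.
  - by rewrite bd_periodZ.
have int_a y : bd y = P0 -> a <= y -> exists i : nat, y = a + i%:R.
  move=> /bd_P0 yi ay; have [|i [E|E]] := @int_diff R y a; first by rewrite rpredB.
    by exists i.
  have i0' : 0 <= i%:R :> R by rewrite ler0n.
  have E0 : i%:R = 0 :> R by lra.
  by exists 0%N; rewrite E E0; lra.
pose P i := `[< bd (a + i%:R) = P0 /\ a + i%:R <= x >].
have exP : exists i, P i by exists 0%N; apply/asboolP; rewrite addr0.
have leP' i : P i -> (i <= Num.truncn (x - a))%N.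
  move=> /asboolP[_ h]; rewrite -ltnS -(ltr_nat R).
  have := truncnS_gt (x - a); lra.
case: (ex_maxnP exP leP') => i /asboolP[iE ix] imax.
pose Q l := `[< bd (a + l%:R) = P0 /\ x < a + l%:R >].
have exQ : exists l, Q l.
  have [q [q1 q2]] : exists q : nat, x < a + q%:R * n%:R /\ bd (a + q%:R * n%:R) = P0.
    exists (Num.truncn (x - a)).+1; split; last by rewrite -(bd_periodZ a (Num.truncn (x - a)).+1) in aE.
    have := truncnS_gt (x - a); have : 0 <= (Num.truncn (x - a)).+1%:R :> R by rewrite ler0n.
    by nra.
  by exists (q * n)%N; apply/asboolP; rewrite natrM.
case: (ex_minnP exQ) => l /asboolP[lE lx] lmin.
exists (a + i%:R), (a + l%:R); split => //; first by rewrite ix lx.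
move=> y /andP[y1 y2] yE; have i0' : 0 <= i%:R :> R by rewrite ler0n.
have [|m mE] := int_a y yE; first by lra.
move: y1 y2; rewrite mE !ltrD2l !ltr_nat => im ml.
have [ymx|xmy] := leP (a + m%:R) x.
  have Pm : P m by apply/asboolP; rewrite -mE mE -{1}mE.
  by have := imax _ Pm; rewrite leqNgt im.
have Qm : Q m by apply/asboolP; rewrite -mE mE -{1}mE.
by have := lmin _ Qm; rewrite leqNgt ml.
Qed.

Lemma slab_or_line (x : S) : (exists2 z, Hs z & f x = pi z) \/ exists y : R, f x = pi (rcplx y * v1).
Proof.
have [z fz] := torus_proj_surj (f x).
have [yi|yn] := boolP (cross v1 z \is a Num.int); last first.
  by have [w [h1 _ h2]] := slabY_reduce uni yn; left; exists w => //; rewrite -fz.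
right; exists (cross z v2); rewrite -fz; apply/proj_lattice.
by rewrite {1}(basis_decomp uni z) addrAC subrr add0r; exact: latticeZ.
Qed.

End OneCylinder.

(** * Square-tiled surfaces *)

Section Tiled.
Variables (R : realType) (X : translationSurface R) (n : nat) (f : X -> torus R).
Local Notation C := (cplx R).
Local Notation pi := (@torus_proj R).
Local Notation omega := (ts_form X).
Hypotheses (holf : holomorphic f) (degf : has_degree f n).
Hypothesis pullf : is_pullback f (torus_dz R) omega.
Hypothesis ramf : forall p, ramified f p -> f p = torus_origin R.
Hypothesis zerof : forall p, form_zero omega p -> f p = torus_origin R.
Variable P0 : X.
Hypothesis ordP0 : form_zero_of_order omega P0 2.
Hypothesis zeroP0 : forall q, form_zero omega q -> q = P0.

Lemma form_zero_P0 : form_zero omega P0.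
Proof.
have [c [h [ac _ _ hE]]] := ordP0; exists c => //.
by rewrite (nbhs_singleton hE) subrr expr0n mul0r.
Qed.

(** No ramification point lies over t, so the degree counts this fibre. *)
Lemma fibre_enum (t : torus R) : t <> torus_origin R ->
  exists g : 'I_n -> X, injective g /\ forall p, f p = t <-> exists i, p = g i.
Proof.
move=> t0; have : (f @^-1` [set t] #= `I_n)%card.
  by apply: degf => p fp /ramf; rewrite fp.
move=> /card_set_bijP[h [h1 h2 h3]].
have gP (i : 'I_n) : exists2 p, f p = t & h p = i by apply: h3; exact: ltn_ord.
exists (fun i => s2val (cid2 (gP i))); split.
  move=> i j E; apply/val_inj; rewrite /= -(s2valP' (cid2 (gP i))) -(s2valP' (cid2 (gP j))).
  by rewrite E.
move=> p; split => [fp|[i ->]]; last exact: (s2valP (cid2 (gP i))).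
have hp : (h p < n)%N by exact: h1.
exists (Ordinal hp); apply: h2; rewrite ?inE //=.
  exact: (s2valP (cid2 (gP (Ordinal hp)))).
by rewrite (s2valP' (cid2 (gP (Ordinal hp)))).
Qed.

Lemma tiled_cover : branched_cover f P0 n.
Proof.
split.
- exact: rs_hausdorff.
- exact: ts_compact.
- exact: ts_connected.
- exact: holf.1.
- exact: zerof form_zero_P0.
- move=> q; rewrite /ram_index; case: asboolP => [->|qP].
    exact: (zero_coordinate holf pullf ordP0).
  have nz : ~ form_zero omega q by move/zeroP0.
  have [V [Phi [Psi [e [z0 [lc _]]]]]] := regular_coordinate holf pullf nz.
  by exists V, Phi, Psi, e, z0.
- exact: fibre_enum.
Qed.

(** Near [g y] the regular coordinate of [g y'] and [u * (U y' - U y)] are small lifts of the same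
    point, hence equal; the chain rule passes to the chart c. It is used with U the identity for the
    annulus and U the inclusion of the reals for saddle connections. *)
Lemma coord_along (Y : topologicalType) (U : Y -> C) (g : Y -> X) y a (u : C) :
  {for y, continuous U} -> {for y, continuous g} -> ~ form_zero omega (g y) ->
  f (g y) = pi a -> (\forall y' \near y, f (g y') = pi (a + u * (U y' - U y))) ->
  forall c, chart_at (g y) c ->
  coef omega c (g y) != 0 /\ lin_approx U (coord c \o g) y ((coef omega c (g y))^-1 * u).
Proof.
move=> cU cg nz fa near c gc.
have [V [Phi [Psi [e [z0 [lc der]]]]]] := regular_coordinate holf pullf nz.
have [e0 [oV Vq] h1 h2 [h3 h4]] := lc.
have [l0 la] := der _ _ Vq gc; split => //.
have cP : {for g y, continuous Phi} by have [] := h1 _ Vq.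
have cPg : {for y, continuous (Phi \o g)} := @continuous_comp _ _ _ g Phi y cg cP.
have nV : \forall y' \near y, V (g y').
  by apply: (cg V); exact: open_nbhs_nbhs.
have nP : \forall y' \near y, cabs (Phi (g y') - Phi (g y)) < 2^-1.
  by apply: (@near_cabs R _ (Phi \o g) y 2^-1 cPg); lra.
have u1 : 0 < cabs u + 1 by rewrite ltr_wpDl ?cabs_ge0.
have d0 : 0 < 2^-1 / (cabs u + 1) by apply: divr_gt0; lra.
have nU := near_cabs cU d0.
have lP : lin_approx U (Phi \o g) y u.
  apply: (@lin_approx_near _ _ U (fun y' => u * U y' - u * U y) (Phi \o g)).
    apply: filterS2 (filterI nV nP) (filterI near nU) => y' [Vy Py] [fy Uy] /=.
    rewrite -mulrBr; apply/esym.
    have b1 : cabs (u * (U y' - U y)) < 2^-1.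
      rewrite cabsM; have := cabs_ge0 (U y' - U y); have := cabs_ge0 u => ua Ua.
      have : (cabs u + 1) * cabs (U y' - U y) < 2^-1 by rewrite -ltr_pdivlMl// mulrC.
      by rewrite mulrDl; lra.
    have E : pi (z0 + Phi (g y')) = pi (z0 + u * (U y' - U y)).
      rewrite -[Phi _]expr1 -h4// fy; apply: (@proj_eqD R).
      by rewrite -fa h4// h3 expr1 addr0.
    apply: (addrI z0); apply: (@proj_small R _ _ E).
    have -> : z0 + Phi (g y') - (z0 + u * (U y' - U y)) = Phi (g y') - u * (U y' - U y) by ring.
    have := cabs_sub_le (Phi (g y')) (u * (U y' - U y)) 0; rewrite subr0 sub0r cabsN.
    by move: Py; rewrite h3 subr0; lra.
  have := lin_approxD (lin_approxZ u (lin_approx_id U y)) (lin_approx_cst U (- (u * U y)) y).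
  by rewrite mulr1 addr0.
have lc' : lin_approx (Phi \o g) (coord c \o g) y (coef omega c (g y))^-1.
  exact: (lin_approx_comp cg (lin_approx_inv l0 la)).
exact: lin_approx_trans lc' lP.
Qed.

End Tiled.

(** * Developing a geodesic into the torus *)

Section Developing.
Variables (R : realType) (X : translationSurface R) (n : nat) (f : X -> torus R).
Local Notation C := (cplx R).
Local Notation pi := (@torus_proj R).
Local Notation omega := (ts_form X).
Hypotheses (holf : holomorphic f) (pullf : is_pullback f (torus_dz R) omega).

Lemma connected_line : connected [set: R].
Proof. by apply/connected_intervalP => x y _ _ z _. Qed.

(** A converse to [coord_along]: along a curve with the given derivative the regular coordinate
    minus t u has derivative 0, hence is locally constant, so the formula for f propagates along the
    whole line. *)
Lemma developing (g : R -> X) (u a : C) : continuous g -> (forall t, ~ form_zero omega (g t)) ->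
  (forall t c, chart_at (g t) c ->
    lin_approx (@rcplx R) (coord c \o g) t ((coef omega c (g t))^-1 * u)) ->
  f (g 0) = pi a -> forall t, f (g t) = pi (a + rcplx t * u).
Proof.
move=> cg nz gder fa t.
have loc s : \forall s' \near s, f (g s') = pi (a + rcplx s' * u) <-> f (g s) = pi (a + rcplx s * u).
  have [V [Phi [Psi [e [z0 [lc der]]]]]] := regular_coordinate holf pullf (nz s).
  have [e0 [oV Vq] h1 h2 [h3 h4]] := lc.
  have /nbhs_ballP[d d0 dV] : nbhs s (g @^-1` V) by apply: cg; exact: open_nbhs_nbhs.
  have Kder s' : `|s - s'| < d ->
      lin_approx (@rcplx R) (fun t => Phi (g t) + - u * rcplx t) s' 0.
    move=> ss'; have Vs' : V (g s') by exact: dV.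
    have [c ac cq] := atlas_cover (g s'); have gc : chart_at (g s') c by [].
    have [l0 la] := der _ _ Vs' gc.
    have lP := lin_approx_trans (lin_approx_comp (cg s') la) (gder _ _ gc).
    rewrite mulrA mulfV// mul1r in lP.
    have := lin_approxD lP (lin_approxZ (- u) (lin_approx_id (@rcplx R) s')).
    by rewrite mulr1 subrr.
  have ball0 x y : `|s - x| < d -> `|s - y| < d -> x <= y ->
      Phi (g x) + - u * rcplx x = Phi (g y) + - u * rcplx y.
    rewrite !ltr_norml => xd yd xy; apply/esym/eqP; rewrite -subr_eq0 -cabs_eq0 eq_le cabs_ge0 andbT.
    have /= := @curve_mvt R (fun t => Phi (g t) + - u * rcplx t) (fun=> 0) x y 0 xy.
    rewrite mul0r; apply => [z|z] zxy; last by rewrite cabs0.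
    by apply: Kder; rewrite ltr_norml; lra.
  apply/nbhs_ballP; exists d => // s' ss' /=.
  have ss : `|s - s| < d by rewrite subrr normr0.
  have E : Phi (g s') = Phi (g s) + u * (rcplx s' - rcplx s).
    have : Phi (g s') + - u * rcplx s' = Phi (g s) + - u * rcplx s.
      by have [h|/ltW h] := leP s s'; [rewrite -(ball0 _ _ ss ss' h)|rewrite (ball0 _ _ ss' ss h)].
    move=> /(congr1 (fun w => w + u * rcplx s')) E.
    transitivity (Phi (g s') + - u * rcplx s' + u * rcplx s'); first by ring.
    by rewrite E; ring.
  have fE : f (g s') = pi (z0 + Phi (g s) + u * (rcplx s' - rcplx s)).
    by rewrite h4; [rewrite expr1 E addrA|exact: dV].
  have fs : f (g s) = pi (z0 + Phi (g s)) by rewrite h4// expr1.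
  split => h.
    have := @proj_eqD R _ _ (- (u * (rcplx s' - rcplx s))) (etrans (esym fE) h).
    rewrite addrK -fs => ->; congr pi; ring.
  rewrite fE; have := @proj_eqD R _ _ (u * (rcplx s' - rcplx s)) (etrans (esym fs) h).
  by move=> ->; congr pi; ring.
apply: (@connected_pred _ _ (fun t => f (g t) = pi (a + rcplx t * u)) connected_line _ _ 0 t) => //.
- by move=> s _ hs; apply: filterS (loc s) => s' h _; exact/h.
- by move=> s _ hs; apply: filterS (loc s) => s' h _ /h.
by rewrite /rcplx rmorph0 mul0r addr0.
Qed.

End Developing.

(** * The cylinder and the saddle connections on its boundary *)

Section Geometry.
Variables (R : realType) (X : translationSurface R) (n : nat) (f : X -> torus R).
Local Notation C := (cplx R).
Local Notation pi := (@torus_proj R).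
Local Notation omega := (ts_form X).
Hypotheses (holf : holomorphic f) (pullf : is_pullback f (torus_dz R) omega).
Hypothesis zerof : forall p, form_zero omega p -> f p = torus_origin R.
Variable P0 : X.
Hypothesis zeroP : forall q, form_zero omega q <-> q = P0.
Context {H : branched_cover f P0 n}.
Variables (v1 v2 : C) (uni : unimodular v1 v2).
Local Notation b := (center v1 v2).
Variables (e : 'I_n -> X) (r : {perm 'I_n}).
Hypothesis eb : enumerates f e b.
Hypothesis hr : forall i, transport f b (b + v1) (e i) (e (r i)).
Hypothesis one_cycle : forall p q, q \in porbit r p.
Variables (i0 : 'I_n) (sg : C -> X).
Local Notation Hs := (slabY v1 0).
Hypothesis sgD : section_on f Hs sg.
Hypothesis sgb : sg b = e i0.
Local Notation bd := (bd (H := H) uni sgD).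

Let c12 : cross v1 v2 = 1. Proof. by case: uni. Qed.

Definition vlen : R := cabs v1.
Definition vdir : C := rcplx vlen^-1 * v1.
Local Notation nv := vlen.
Local Notation u := vdir.

Lemma vlen_gt0 : 0 < nv.
Proof.
rewrite /vlen cabs_gt0; apply/eqP => v0; move: c12; rewrite v0.
have := crossvv (0 : C); rewrite /cross /= !mul0r subrr => _ /eqP.
by rewrite eq_sym oner_eq0.
Qed.

Let nv0 : nv != 0. Proof. by rewrite gt_eqF// vlen_gt0. Qed.

Lemma vlen_vdir : rcplx nv * u = v1.
Proof. by rewrite /vdir mulrA -rcplxM mulfV// /rcplx rmorph1 mul1r. Qed.

Lemma cabs_vdir : cabs u = 1.
Proof. by rewrite /vdir cabsM cabs_rcplx ger0_norm ?invr_ge0 ?(ltW vlen_gt0)// mulVf. Qed.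

Lemma vdir_neq0 : u != 0. Proof. by rewrite -cabs_gt0 cabs_vdir. Qed.

Lemma cross_vdir z : cross v1 (z * u) = nv * complex.Im z.
Proof.
have E : cross v1 (z * v1) = complex.Im z * nv ^+ 2.
  rewrite /vlen /cabs sqr_sqrtr ?addr_ge0 ?sqr_ge0// /cross.
  by case: z v1 => x y [x1 y1] /=; ring.
have -> : z * u = rcplx nv^-1 * (z * v1) by rewrite /vdir; ring.
by rewrite crossZr E; field.
Qed.

(** Multiplication by the unit vector of [v1] takes the horizontal strip to the lattice strip. Its
    height is the inverse of |v1| because the unit parallelogram has area 1; with circumference n
    |v1| the annulus has area n. *)
Definition unroll (z : C) : X := sg (z * u).
Local Notation strip := [set z : C | 0 < complex.Im z < nv^-1].
Local Notation A := (unroll @` strip).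

Lemma stripE z : strip z <-> Hs (z * u).
Proof.
have n0 := vlen_gt0; rewrite /slabY /= /setI /= cross_vdir add0r.
split => [/andP[h1 h2]|[h1 h2]].
  by split; [rewrite mulr_gt0|rewrite -ltr_pdivlMl// mulr1].
by rewrite -(pmulr_rgt0 _ n0) h1 -[nv^-1]mulr1 ltr_pdivlMl.
Qed.

Lemma divu w : w / u * u = w. Proof. by rewrite divfK// vdir_neq0. Qed.

Lemma unrolled x : A x <-> exists2 z, Hs z & f x = pi z.
Proof.
split => [[z /stripE Hz <-]|[z Hz fx]].
  by exists (z * u) => //; have [] := sgD Hz.
have [k <-] := sg_surj (H := H) uni eb hr one_cycle sgD sgb Hz fx.
exists ((z + v1 *+ k) / u); last by rewrite /unroll divu.
apply/stripE; rewrite divu; exact: slabYMn.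
Qed.

Lemma f_unroll z : strip z -> f (unroll z) = pi (z * u).
Proof. by move=> /stripE/sgD[]. Qed.

Lemma open_strip : open strip.
Proof.
have -> : strip = (fun z : C => complex.Im z) @^-1` ([set x : R | 0 < x] `&` [set x | x < nv^-1]).
  by apply/seteqP; split => z /=; [move=> /andP[]|move=> [-> ->]].
apply: open_comp; first by move=> z _; exact: Im_continuous.
by apply: openI; [exact: open_gt|exact: open_lt].
Qed.

Lemma open_unrolled : open A.
Proof.
have -> : A = f @^-1` (pi @` Hs).
  by apply/seteqP; split => x /=; [move/unrolled => [z Hz ->]; exists z|move=> [z Hz zE]; apply/unrolled; exists z].
apply: open_comp; first by move=> x _; exact: (cover_continuous H).
by apply: torus_proj_open; have [] := clean_slab uni 0.
Qed.

Lemma unroll_inj z z' : strip z -> strip z' ->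
  (unroll z = unroll z' <-> exists k : int, z' = z + rcplx (k%:~R * (n%:R * nv))).
Proof.
move=> sz sz'; have Hz := proj1 (stripE _) sz; have Hz' := proj1 (stripE _) sz'.
have per w k : Hs w -> sg (w + v1 *+ k) = sg w <-> (n %| k)%N :=
  sg_period (H := H) uni eb hr one_cycle sgD sgb k.
have vE (k : nat) : v1 *+ k = rcplx (k%:R * nv) * u.
  by rewrite rcplxM -mulrA vlen_vdir /rcplx rmorph_nat mulr_natl.
have uI : injective (fun w : C => w * u) by move=> w w' /(mulIf vdir_neq0).
split => [E|[k ->]].
  have [k [kE|kE]] : exists k : nat, z * u = z' * u + v1 *+ k \/ z' * u = z * u + v1 *+ k.
    by apply: (same_slabY uni Hz Hz'); rewrite -!f_unroll// E.
    have /(per _ k Hz')/dvdnP[m km] : sg (z' * u + v1 *+ k) = sg (z' * u) by rewrite -kE.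
    exists (- m%:Z); apply: uI => /=; rewrite mulrDl kE km vE natrM mulrNz -pmulrn.
    rewrite -addrA -mulrDl -rcplxD mulNr -mulrA subrr.
    by rewrite /rcplx rmorph0 mul0r addr0.
  have /(per _ k Hz)/dvdnP[m km] : sg (z * u + v1 *+ k) = sg (z * u) by rewrite -kE.
  by exists m%:Z; apply: uI => /=; rewrite mulrDl kE km vE natrM -pmulrn -mulrA.
have half (w : C) (m : nat) : Hs (w * u) -> sg ((w + rcplx (m%:R * (n%:R * nv))) * u) = sg (w * u).
  move=> Hw; rewrite mulrDl mulrA -natrM -vE; apply/(per _ _ Hw); exact: dvdn_mull.
have nat_case (w w' : C) (m : nat) : Hs (w * u) -> w' = w + rcplx (m%:R * (n%:R * nv)) ->
    sg (w * u) = sg (w' * u) by move=> Hw ->; rewrite half.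
case: k => m; first by rewrite -pmulrn; exact: nat_case Hz erefl.
rewrite NegzE mulrNz -pmulrn /unroll; apply/esym/(nat_case _ _ m.+1).
  apply/stripE; move: sz; rewrite /= => sz.
  suff -> : complex.Im (z + rcplx (- m.+1%:R * (n%:R * nv))) = complex.Im z by [].
  by rewrite ImD /= addr0.
by rewrite -addrA -rcplxD mulNr addNr /rcplx rmorph0 addr0.
Qed.

Lemma unroll_continuous z : strip z -> {for z, continuous unroll}.
Proof.
move=> /stripE/sgD[_ cs].
apply: (@continuous_comp _ _ _ (fun w : C => w * u) sg z); last exact: cs.
by apply: (@continuousM_cplx R _ (fun w : C => w) (fun=> u) z); [|exact: cst_continuous].
Qed.

Lemma unroll_regular z : strip z -> ~ form_zero omega (unroll z).
Proof.
move=> sz /zerof; rewrite f_unroll//; have [_ _ h] := clean_slab uni 0.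
by apply: h; apply/stripE.
Qed.

Lemma flat_unrolled : (0 < n)%N -> flat_annulus u A.
Proof.
move=> n0; exists (n%:R * nv), nv^-1, unroll; split.
- by rewrite mulr_gt0 ?ltr0n ?vlen_gt0// invr_gt0 vlen_gt0.
- by split => //; exact: open_unrolled.
- exact: unroll_inj.
- exact: unroll_continuous.
move=> z c sz zc; have cz := unroll_continuous sz.
have cid : {for z, continuous (id : C -> C)} by [].
have [|l0 la] := coord_along holf pullf cid cz (unroll_regular sz) (f_unroll sz) (u := u) _ zc.
  apply: filterS (open_nbhs_nbhs (conj open_strip sz)) => w sw.
  by rewrite f_unroll//; congr pi; rewrite mulrBr addrC [u * w]mulrC [u * z]mulrC subrK.
exists ((coef omega c (unroll z))^-1 * u); last by rewrite mulrA mulfV// mul1r.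
by apply: lin_approx_deriv la; exact: separates_id.
Qed.

Lemma annulus_regular B q : flat_annulus u B -> B q -> ~ form_zero omega q.
Proof.
move=> [w [h [psi [_ [_ ->] _ _ pder]]]] [z sz <-] [c zc E].
have [l _] := pder z c sz zc; rewrite E mul0r => /esym/eqP.
by rewrite (negbTE vdir_neq0).
Qed.

Lemma bd_not_unrolled x : ~ A (bd x).
Proof.
move=> /unrolled[z [h1 h2]]; rewrite f_bd => /proj_lattice/(lattice_coord uni)[_].
rewrite crossBr crossZr crossvv mulr0 sub0r -rpredN opprK => yi.
by apply: (int_between yi (rpred0 _)); apply/andP.
Qed.

Lemma bd_closure x : closure A (bd x).
Proof.
move=> B /(proj2 (bdP uni sgD x))[rho rho0 h].
have [w [Hw dw]] := near_boundary uni x rho0; exists (sg w); split; last exact: h.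
by apply/unrolled; exists w => //; have [] := sgD Hw.
Qed.

Lemma covered x : A x \/ exists y, bd y = x.
Proof.
have [h|[y fx]] := slab_or_line f uni x; first by left; apply/unrolled.
right; have [k <-] := bd_surj (H := H) uni eb hr one_cycle sgD sgb fx.
by exists (y + k%:R).
Qed.

Lemma rcplx_vdir t : rcplx (t / nv) * v1 = rcplx t * u.
Proof. by rewrite rcplxM /vdir mulrA. Qed.

(* The horizontal line of B through a point outside A follows the lower edge of the
   strip up to P0, but B contains no zero of the form. *)
Lemma unrolled_maximal B : flat_annulus u B -> A `<=` B -> B = A.
Proof.
move=> fB AB; apply/seteqP; split => // q Bq; have [//|[x0 xq]] := covered q.
have := fB => -[w [h [psi [[w0 h0] [oB EB] _ cpsi pder]]]].
move: (Bq); rewrite EB => -[z1 sz1 zq].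
pose L t := psi (z1 + rcplx t); pose bt (t : R) := bd (x0 + t / nv).
have sL t : 0 < complex.Im (z1 + rcplx t) < h by rewrite ImD /= addr0.
have cl : continuous (fun t : R => z1 + rcplx t).
  have -> : (fun t : R => z1 + rcplx t) = (fun t : R => z1 + rcplx t * 1).
    by apply/funext => t; rewrite mulr1.
  exact: line_continuous.
have cL : continuous L.
  move=> t; apply: (@continuous_comp _ _ _ (fun t : R => z1 + rcplx t) psi t); first exact: cl.
  exact: (cpsi _ (sL t)).
have BL t : B (L t) by rewrite EB; exists (z1 + rcplx t); [exact: sL|].
have nz t : ~ form_zero omega (L t) by exact: annulus_regular (BL t).
have L0 : L 0 = q by rewrite /L /rcplx rmorph0 addr0.
have dL t c : chart_at (L t) c ->
    lin_approx (@rcplx R) (coord c \o L) t ((coef omega c (L t))^-1 * u).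
  move=> tc; have [l lder lE] := pder _ _ (sL t) tc.
  have l0 : coef omega c (L t) != 0.
    by apply/eqP => E; apply: (nz t); exists c.
  have -> : (coef omega c (L t))^-1 * u = l by rewrite -lE mulrA mulVf// mul1r.
  have la := deriv_lin_approx (@separates_id R _) lder.
  have near_eq : \forall t' \near t,
      (z1 + rcplx t') - (z1 + rcplx t) = rcplx t' - rcplx t /\
      coord c (L t') - coord c (L t) = coord c (L t') - coord c (L t).
    by apply/nbhs_ballP; exists 1 => //= t' _; split => //; ring.
  exact: (lin_approx_eqdiff near_eq (lin_approx_comp (cl t) la)).
(* The horizontal line of B and the lower edge develop to the same line in the torus and start at
   the same point. The first avoids [P0], so uniqueness of lifts makes them equal. *)
have fL t : f (L t) = pi (rcplx x0 * v1 + rcplx t * u).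
  by apply: (developing holf pullf cL nz dL); rewrite L0 -xq f_bd.
have fb t : f (bt t) = pi (rcplx x0 * v1 + rcplx t * u).
  by rewrite /bt f_bd rcplxD mulrDl rcplx_vdir.
have cb : continuous bt.
  move=> t; apply: (@continuous_comp _ _ _ (fun t : R => x0 + t / nv) bd t); last exact: bd_continuous.
  apply: (@continuousD R R R (fun=> x0) (fun t => t / nv)); first exact: cst_continuous.
  exact: mulrr_continuous.
have fLb t : setT t -> f (L t) = f (bt t) by rewrite fL fb.
have LP0 t : setT t -> L t = bt t -> L t <> P0 by move=> _ _ /zeroP; exact: nz.
have E t : L t = bt t.
  have E0 : L 0 = bt 0 by rewrite L0 /bt mul0r addr0.
  exact: (lift_unique (H := H) (@connected_line R) (fun s _ => cL s) (fun s _ => cb s) fLb LP0 I I E0).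
have [j [j' [_ jP _ _]]] := bd_segment (H := H) uni eb hr one_cycle sgD sgb x0.
case: (nz ((j - x0) * nv)); apply/zeroP; rewrite E /bt mulfK// addrC subrK//.
Qed.

(** The piece of the lower edge between the consecutive passages through [P0] around the parameter
    of x, run at unit speed. *)
Lemma saddle_through x : ~ A x -> exists2 s : set X,
  saddle_connection u s /\ s `<=` closure A `\` A & s x.
Proof.
move=> nA; have [//|[y <-]] := covered x; have n0 := vlen_gt0.
have [j [j' [/andP[j1 j2] jP jP' jN]]] := bd_segment (H := H) uni eb hr one_cycle sgD sgb y.
pose gm (t : R) := bd (j + t / nv).
have cgm : continuous gm.
  move=> t; apply: (@continuous_comp _ _ _ (fun t : R => j + t / nv) bd t); last exact: bd_continuous.
  apply: (@continuousD R R R (fun=> j) (fun t => t / nv)); first exact: cst_continuous.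
  exact: mulrr_continuous.
exists (gm @` `[0, (j' - j) * nv]); last first.
  exists ((y - j) * nv); last by rewrite /gm mulfK// addrC subrK.
  by rewrite /= in_itv /= mulr_ge0 ?ler_wpM2r ?subr_ge0 ?(ltW n0)//; lra.
split; last by move=> _ [t _ <-]; split; [exact: bd_closure|exact: bd_not_unrolled].
exists ((j' - j) * nv), gm; split => //.
- by rewrite mulr_gt0// subr_gt0; lra.
- exact: continuous_subspaceT.
- by split; apply/zeroP; rewrite /gm ?mul0r ?addr0// mulfK// addrC subrK.
move=> t /andP[t0 t1].
have nz : ~ form_zero omega (gm t).
  move/zeroP; apply: jN; rewrite ltrDl divr_gt0//=.
  by rewrite -ltrBrDl ltr_pdivrMr.
split => // c tc; have fg s : f (gm s) = pi (rcplx j * v1 + rcplx s * u).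
  by rewrite /gm f_bd rcplxD mulrDl rcplx_vdir.
have ct : {for t, continuous (@rcplx R)} by exact: rcplx_continuous.
have [|l0 la] := coord_along holf pullf ct (cgm t) nz (fg t) (u := u) _ tc.
  by apply/nbhs_ballP; exists 1 => //= s _; rewrite fg; congr pi; ring.
exists ((coef omega c (gm t))^-1 * u); last by rewrite mulrA mulfV// mul1r.
by apply: lin_approx_deriv la; exact: separates_rcplx.
Qed.

Lemma one_cylinder_vdir : (0 < n)%N -> one_cylinder_direction X u.
Proof.
move=> n0; split; first by rewrite cabsE cabs_vdir.
exists A; first by split; [exact: flat_unrolled|exact: unrolled_maximal].
apply/seteqP; split => // x _; have [Ax|nA] := pselect (A x); first by left.
by right; have [s sP sx] := saddle_through nA; exists s.
Qed.

End Geometry.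

Theorem proposition1p4 (R : realType) (n : nat) (X : translationSurface R) :
  prime n -> in_H2 X -> square_tiled n X ->
  exists u : cplx R, one_cylinder_direction X u.
Proof.
move=> pn [_ [P0 [ordP0 zeroP0]]] [f [holf degf pullf ramf zerof]].
have H : branched_cover f P0 n by exact: tiled_cover ordP0 zeroP0.
have [v1 [v2 [e [r [uni eb hr oc]]]]] := one_cycle_basis (H := H) pn.
have n0 := prime_gt0 pn; pose i0 := Ordinal n0.
have fe : f (e i0) = torus_proj (center v1 v2) by apply/(proj2 eb); exists i0.
have [sg [sgD sgb _]] := transport_ex (H := H) (clean_slab uni 0) (center_slabY uni) fe.
have zP q : form_zero (ts_form X) q <-> q = P0.
  by split => [/zeroP0//|->]; exact: form_zero_P0 ordP0.
exists (vdir v1).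
exact: (one_cylinder_vdir holf pullf zerof zP uni eb hr oc sgD sgb n0).
Qed.
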